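(* Let $d\ge1$ and let $C>0$ be any constant. There is a constant $C'$ depending only on $d$ and $C$ such that the following holds. Let $\mu,\nu$ be probability measures on the torus $\mathbb{T}^d=(\mathbb{R}/\mathbb{Z})^d$ that admit $M$-Lipschitz continuous log-densities, let $\lambda>0$ and let $h=1/m$ with $m\ge1$ an integer. If $h(M+\lambda^{-1})\le C$, then $$|T_\lambda(\mu_h,\nu_h)-T_\lambda(\mu,\nu)|\le C'\min\{h,\ h^2(\lambda^{-1}+M+1)\}.$$
   Context: On $\mathbb{T}^d$, $\|[x-y]\|_2$ denotes the usual distance ($[z]$ is a representative of $z$ modulo $\mathbb{Z}^d$ of minimal Euclidean norm). For probability measures $\mu,\nu$ on $\mathbb{T}^d$ and $\lambda\ge0$, $$T_\lambda(\mu,\nu)=\min_{\gamma\in\Pi(\mu,\nu)}\int_{(\mathbb{T}^d)^2}\|[y-x]\|_2^2\,d\gamma(x,y)+2\lambda H(\gamma,\mu\otimes\nu),$$ where $\Pi(\mu,\nu)$ is the set of couplings of $\mu,\nu$ and $H(\gamma,\pi)=\int\log(d\gamma/d\pi)\,d\gamma$ if $\gamma\ll\pi$, $+\infty$ otherwise. Densities are with respect to the Lebesgue measure. For $h=1/m$, the discretization $\mu_h$ of $\mu$ is the discrete measure with $n=m^d$ atoms on the regular grid of $\mathbb{T}^d$ of step $1/m$ which gives to each grid point the $\mu$-mass of its surrounding cell: $\mu_h=(q_h)_\#\mu$ where $q_h(x_1,\dots,x_d)=(\frac1m\lfloor mx_1+\frac12\rfloor,\dots,\frac1m\lfloor mx_d+\frac12\rfloor)$.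 *)

(* Defs.v *)
From HB Require Import structures.
From mathcomp Require Import all_boot all_order all_algebra.
From mathcomp Require Import generic_quotient ring_quotient.
From mathcomp Require Import all_classical all_reals all_analysis.
From mathcomp Require Import measurable_realfun.
From mathcomp Require Import lra.

Set Implicit Arguments.
Unset Strict Implicit.
Unset Printing Implicit Defensive.
Import Order.TTheory GRing.Theory Num.Theory.
Import numFieldNormedType.Exports.
Local Open Scope classical_set_scope.
Local Open Scope ring_scope.
Local Open Scope quotient_scope.

Definition integers (R : realType) : pred R := fun x => x \is a Num.int.

Lemma integers_zmod_closed (R : realType) : zmod_closed (@integers R).
Proof.
by split=> [|x y]; rewrite /in_mem /= /integers; [exact: rpred0 | exact: rpredB].
Qed.

HB.instance Definition _ (R : realType) :=
  GRing.isZmodClosed.Build R (@integers R) (@integers_zmod_closed R).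

Definition circle (R : realType) : Type :=
  Quotient.quot (GRing.ZmodClosed.clone R (@integers R) _).

HB.instance Definition _ (R : realType) := Choice.on (circle R).
HB.instance Definition _ (R : realType) := GRing.Zmodule.on (circle R).
HB.instance Definition _ (R : realType) := isPointed.Build (circle R) 0.

Definition circle_pi (R : realType) (x : measurableTypeR R) : circle R :=
  \pi_(Quotient.quot (GRing.ZmodClosed.clone R (@integers R) _)) x.

Section circle_measurable.
Variable R : realType.

(* The sigma-algebra is the quotient one: [A] is measurable iff its inverse
   image in the real line is Borel. *)
Let circle_measurable : set_system (circle R) :=
  image_set_system [set: R] (@circle_pi R) measurable.

Let circle_sigma_algebra : sigma_algebra setT circle_measurable.
Proof. exact/sigma_algebra_image/sigma_algebra_measurable. Qed.

Let circle_measurable0 : circle_measurable set0.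
Proof. by have [] := circle_sigma_algebra. Qed.

Let circle_measurableC A : circle_measurable A -> circle_measurable (~` A).
Proof. by have [_ + _] := circle_sigma_algebra => /[apply]; rewrite setTD. Qed.

Let circle_measurable_bigcup (F : (set (circle R))^nat) :
  (forall i, circle_measurable (F i)) -> circle_measurable (\bigcup_i F i).
Proof. by have [_ _] := circle_sigma_algebra; apply. Qed.

HB.instance Definition _ := @isMeasurable.Build default_measure_display
  (circle R) circle_measurable circle_measurable0 circle_measurableC
  circle_measurable_bigcup.

Lemma measurable_circle_pi :
  measurable_fun [set: measurableTypeR R] (@circle_pi R).
Proof. by move=> _ A. Qed.

HB.instance Definition _ :=
  isMeasurableFun.Build _ _ _ _ (@circle_pi R) measurable_circle_pi.

Lemma measurable_circle d (T : measurableType d) (f : circle R -> T) :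
  measurable_fun [set: measurableTypeR R] (f \o @circle_pi R) ->
  measurable_fun [set: circle R] f.
Proof. by move=> mf _ A mA; rewrite setTI; exact: mf. Qed.

End circle_measurable.
Arguments circle_pi {R} x.

Notation torus R d := (d.-tuple (circle R)).

Definition circle_leb (R : realType) : probability (circle R) R :=
  distribution (uniform_prob (@ltr01 R)) circle_pi.

Definition torus_cons (R : realType) (d : nat)
    (p : circle R * torus R d) : torus R d.+1 := [tuple of p.1 :: p.2].

Lemma measurable_torus_cons (R : realType) (d : nat) :
  measurable_fun setT (@torus_cons R d).
Proof.
apply: (@measurable_cons _ _ _ _ fst d snd).
- exact: measurable_fst.
- exact: measurable_snd.
Qed.

HB.instance Definition _ (R : realType) (d : nat) :=
  isMeasurableFun.Build _ _ _ _ (@torus_cons R d) (@measurable_torus_cons R d).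

(* The product of [d] copies of the Lebesgue measure of the circle. *)
Fixpoint torus_leb (R : realType) (d : nat) : probability (torus R d) R :=
  if d is d'.+1 then
    distribution (circle_leb R \x torus_leb R d')%E (@torus_cons R d')
  else \d_([tuple] : torus R 0).

Definition eucl_norm (R : realType) (d : nat) (w : 'rV[R]_d) : R :=
  Num.sqrt (\sum_(i < d) w ord0 i ^+ 2).

Definition torus_sub (R : realType) (d : nat) (x y : torus R d) : torus R d :=
  [tuple tnth x i - tnth y i | i < d].

Definition is_representative (R : realType) (d : nat) (z : torus R d)
    (w : 'rV[R]_d) : Prop :=
  forall i, circle_pi (w ord0 i) = tnth z i.

(* [z] : a representative of minimal Euclidean norm; it exists, see
   [min_representativeP]. *)
Definition min_representative (R : realType) (d : nat) (z : torus R d) :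
    'rV[R]_d :=
  get [set w | is_representative z w /\
    forall w', is_representative z w' -> eucl_norm w <= eucl_norm w'].

Definition torus_dist (R : realType) (d : nat) (x y : torus R d) : R :=
  eucl_norm (min_representative (torus_sub x y)).

Lemma circle_pi_eq (R : realType) (x y : R) :
  circle_pi x = circle_pi y <-> x - y \is a Num.int.
Proof.
rewrite /circle_pi; split.
- move/eqP; by rewrite -Quotient.idealrBE.
- move=> xy; apply/eqP; by rewrite -Quotient.idealrBE.
Qed.

Lemma circle_pi_repr (R : realType) (x : circle R) : circle_pi (repr x) = x.
Proof. exact: reprK. Qed.

Lemma min_representativeP (R : realType) (d : nat) (z : torus R d) :
  is_representative z (min_representative z) /\
  forall w, is_representative z w ->
    eucl_norm (min_representative z) <= eucl_norm w.
Proof.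
pose r (i : 'I_d) : R := repr (tnth z i).
pose w0 : 'rV[R]_d := \row_i (r i - (Num.floor (r i + 2^-1))%:~R).
suff : [set w | is_representative z w /\
    forall w', is_representative z w' -> eucl_norm w <= eucl_norm w'] w0.
  exact: getI.
split=> [i|w' zw'].
  rewrite mxE -[RHS]circle_pi_repr; apply/circle_pi_eq.
  by rewrite addrAC subrr add0r rpredN intr_int.
rewrite /eucl_norm ler_wsqrtr// ler_sum// => i _.
have : w' ord0 i - w0 ord0 i \is a Num.int.
  apply/circle_pi_eq; rewrite zw' mxE -[LHS]circle_pi_repr; apply/circle_pi_eq.
  by rewrite opprB addrC subrK intr_int.
move=> /intrP[k]; move/eqP; rewrite subr_eq => /eqP ->.
have /andP[] := floor_itv (r i + 2^-1); rewrite intrD mxE.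
move: (Num.floor _)%:~R => f fl fu.
have [->|k0] := eqVneq k 0; first by rewrite add0r.
have : (k%:~R <= -1 :> R) \/ (1 <= k%:~R :> R).
  rewrite -[-1]/((-1)%:~R : R) -[1]/(1%:~R : R) !ler_int.
  by case: k k0 => [[|k]|k]; [|right|left].
by move=> [] hk; nra.
Qed.

Definition circle_round (R : realType) (m : nat) (x : circle R) : circle R :=
  circle_pi ((Num.floor (m%:R * repr x + 2^-1))%:~R / m%:R).

(* The choice of the representative of [x] is irrelevant. *)
Lemma circle_round_pi (R : realType) (m : nat) (x : R) :
  circle_round m (circle_pi x) =
  circle_pi ((Num.floor (m%:R * x + 2^-1))%:~R / m%:R).
Proof.
rewrite /circle_round; have : repr (circle_pi x) - x \is a Num.int.
  by apply/circle_pi_eq; rewrite circle_pi_repr.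
move=> /intrP[k]; move/eqP; rewrite subr_eq => /eqP ->.
have [->|m0] := eqVneq m 0%N; first by rewrite invr0 !mulr0.
apply/circle_pi_eq; rewrite mulrDr -addrA.
have -> : m%:R * k%:~R = (m%:Z * k)%:~R :> R by rewrite intrM.
rewrite floorDzr ?intr_int// intrKfloor intrD mulrDl [X in X + _ - _]mulrC intrM.
by rewrite mulKf ?pnatr_eq0// addrK intr_int.
Qed.

Lemma measurable_circle_round (R : realType) (m : nat) :
  measurable_fun setT (@circle_round R m).
Proof.
apply: measurable_circle.
rewrite [X in measurable_fun _ X](_ : _ =
  circle_pi \o (fun x : R => (Num.floor (m%:R * x + 2^-1))%:~R / m%:R)); last first.
  by apply/funext => x /=; exact: circle_round_pi.
apply: measurableT_comp => //; apply: nondecreasing_measurable => // x y xy.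
by rewrite ler_wpM2r ?invr_ge0// ler_int le_floor// lerD2r ler_wpM2l.
Qed.

Definition grid_round (R : realType) (d m : nat) (x : torus R d) : torus R d :=
  [tuple circle_round m (tnth x i) | i < d].

Lemma measurable_grid_round (R : realType) (d m : nat) :
  measurable_fun setT (@grid_round R d m).
Proof.
apply/measurable_fun_tnthP => i.
rewrite [X in measurable_fun _ X](_ : _ =
  circle_round m \o (fun x : torus R d => tnth x i)); last first.
  by apply/funext => x /=; rewrite tnth_mktuple.
apply: measurableT_comp; first exact: measurable_circle_round.
exact: measurable_tnth.
Qed.

HB.instance Definition _ (R : realType) (d m : nat) :=
  isMeasurableFun.Build _ _ _ _ (@grid_round R d m)
    (@measurable_grid_round R d m).

Definition discretization (R : realType) (d m : nat)
    (mu : probability (torus R d) R) : probability (torus R d) R :=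
  distribution mu (@grid_round R d m).

Definition couplings d1 d2 (T1 : measurableType d1) (T2 : measurableType d2)
    (R : realType) (mu : probability T1 R) (nu : probability T2 R) :
    set (probability (T1 * T2)%type R) :=
  [set gamma |
    (forall A, measurable A -> gamma (A `*` setT) = mu A) /\
    (forall B, measurable B -> gamma (setT `*` B) = nu B)].

Local Open Scope ereal_scope.
Local Open Scope charge_scope.

Definition relative_entropy d (T : measurableType d) (R : realType)
    (gamma rho : probability T R) : \bar R :=
  if `[< gamma `<< rho >] then
    \int[gamma]_z lne (('d (charge_of_finite_measure gamma) '/d rho) z)
  else +oo.

Definition transport_cost (R : realType) (d : nat) (lambda : R)
    (mu nu : probability (torus R d) R)
    (gamma : probability (torus R d * torus R d)%type R) : \bar R :=
  \int[gamma]_z (torus_dist z.2 z.1 ^+ 2)%:E +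
  (2 * lambda)%:E * relative_entropy gamma (mu \x nu).

(* The infimum is a minimum: the couplings form a compact set and the cost is
   lower semicontinuous. *)
Definition entropic_cost (R : realType) (d : nat) (lambda : R)
    (mu nu : probability (torus R d) R) : \bar R :=
  ereal_inf [set transport_cost lambda mu nu gamma | gamma in couplings mu nu].

Definition has_lipschitz_log_density (R : realType) (d : nat) (M : R)
    (mu : probability (torus R d) R) : Prop :=
  exists f : torus R d -> R,
    [/\ measurable_fun setT f,
        forall A, measurable A ->
          mu A = \int[torus_leb R d]_(x in A) (expR (f x))%:E &
        forall x y, (`|f x - f y| <= M * torus_dist x y)%R].

(* Main.v *)
(* The optimal plan of an entropic problem has density
   r = u(x) exp(-c/(2 lambda)) v(y) with respect to the product of the marginals;
   u and v are the fixed point of the Sinkhorn iteration, which contracts the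
   Hilbert projective distance, and log r is (1/lambda)-Lipschitz because c is
   1-Lipschitz for the l1 distance.  Rounding with q the optimal plan of
   (mu, nu), or spreading that of (mu_h, nu_h) over the cells, gives a coupling
   for the other problem.  Gibbs' inequality and the data processing inequality
   leave only the change E[c - c o q] of the mean cost to be bounded, for a plan
   whose density w with respect to the Lebesgue measure is log-Lipschitz of
   constant L = M + 1/lambda, at least at scales above h.

   Let s be the reflection of each cell about its center. As s preserves the
   Lebesgue measure and q o s = q almost everywhere,
     2 E[(c - c o q) w] = E[(c + c o s - 2 c o q) w]
                          + E[(c o s - c o q) (w o s - w)].
   The last term is O(h) O(h L).  The second difference of c is at most
   2 d h^2 by semiconcavity; it is nonnegative away from a neighbourhood of width
   O(h) of the cut locus, where it is at least -O(h).  That neighbourhood has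
   mass O(h (L + 1)), since it has about 1/(h (L + 1)) disjoint translates
   whose masses are comparable. *)

From HB Require Import structures.
Require Import Defs.
From mathcomp Require Import all_boot all_order all_algebra.
From mathcomp Require Import all_classical all_reals all_analysis.
From mathcomp Require Import measurable_realfun.
From mathcomp Require Import ring lra.

Set Implicit Arguments.
Unset Strict Implicit.
Unset Printing Implicit Defensive.
Import Order.TTheory GRing.Theory Num.Theory.
Import numFieldNormedType.Exports.
Local Open Scope classical_set_scope.
Local Open Scope ring_scope.

(** * Bounded measurable functions and their means *)

(** No minimiser of the entropic problem is ever needed: the potentials give a dual value that lies
    below the cost of every coupling, and an explicit plan gives the upper bound. Two one-sided
    comparisons then suffice, each between the dual value of one problem and a coupling of the
    other. A direct estimate of the rounding error stops at order h, since rounding changes the cost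
    by O(h). The second order comes from the cancellation of the first-order terms between a point
    and its mirror image in the cell, which is why the plans are described by densities with respect
    to a measure that the reflection preserves. The obstacle is that the squared distance is not
    smooth: it has a concave kink where a coordinate difference equals 1/2. Second differences are
    therefore O(h^2) from above only, and the kink has to be paid for by the mass near it. The
    potentials are built by iteration because the fixed-point equation holds at every point and
    transfers the regularity of the kernel to them. The bound on h times the log-Lipschitz constant
    keeps the variation of a density inside one cell within a constant factor. *)

Definition bounded_measurable d (T : measurableType d) (R : realType)
    (f : T -> R) : Prop :=
  measurable_fun setT f /\ exists B, forall x, `|f x| <= B.

Section bounded_measurable_theory.
Context d (T : measurableType d) (R : realType).
Implicit Types f g : T -> R.

Lemma bounded_measurable_cst (r : R) : bounded_measurable (fun _ : T => r).
Proof. by split; [exact: measurable_cst | exists `|r|]. Qed.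

Lemma bounded_measurableD f g : bounded_measurable f -> bounded_measurable g ->
  bounded_measurable (fun x => f x + g x).
Proof.
move=> [mf [B fB]] [mg [B' gB]]; split; first exact: measurable_funD.
by exists (B + B') => x; rewrite (le_trans (ler_normD _ _))// lerD.
Qed.

Lemma bounded_measurableN f : bounded_measurable f ->
  bounded_measurable (fun x => - f x).
Proof.
move=> [mf [B fB]]; split; first exact: measurableT_comp.
by exists B => x; rewrite normrN.
Qed.

Lemma bounded_measurableB f g : bounded_measurable f -> bounded_measurable g ->
  bounded_measurable (fun x => f x - g x).
Proof. by move=> bf bg; exact/bounded_measurableD/bounded_measurableN. Qed.

Lemma bounded_measurableM f g : bounded_measurable f -> bounded_measurable g ->
  bounded_measurable (fun x => f x * g x).
Proof.
move=> [mf [B fB]] [mg [B' gB]]; split; first exact: measurable_funM.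
by exists (B * B') => x; rewrite normrM ler_pM.
Qed.

Lemma bounded_measurable_norm f : bounded_measurable f ->
  bounded_measurable (fun x => `|f x|).
Proof.
move=> [mf [B fB]]; split; first exact: measurableT_comp.
by exists B => x; rewrite normr_id.
Qed.

Lemma bounded_measurable_comp d' (T' : measurableType d') (f : T' -> R)
    (h : T -> T') : bounded_measurable f -> measurable_fun setT h ->
  bounded_measurable (f \o h).
Proof.
move=> [mf [B fB]] mh; split; first exact: measurableT_comp.
by exists B => x; exact: fB.
Qed.

Lemma bounded_measurable_expR f : bounded_measurable f ->
  bounded_measurable (fun x => expR (f x)).
Proof.
move=> [mf [B fB]]; split; first exact: measurableT_comp.
exists (expR B) => x; rewrite ger0_norm ?expR_ge0// ler_expR.
exact: le_trans (ler_norm _) (fB x).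
Qed.

Lemma bounded_measurable_inv f (a : R) : bounded_measurable f -> 0 < a ->
  (forall x, a <= f x) -> bounded_measurable (fun x => (f x)^-1).
Proof.
move=> [mf _] a0 af.
have f0 x : 0 < f x by exact: lt_le_trans (af x).
split.
  have -> : (fun x => (f x)^-1) = (fun x => expR (- ln (f x))).
    by apply/funext => x; rewrite expRN lnK// posrE.
  apply: measurableT_comp => //; apply: measurableT_comp => //.
  by apply: measurableT_comp => //; exact: measurable_ln.
exists a^-1 => x; rewrite gtr0_norm ?invr_gt0// lef_pV2 ?posrE //; exact: af.
Qed.

Lemma bounded_measurable_ln f (a : R) : bounded_measurable f -> 0 < a ->
  (forall x, a <= f x) -> bounded_measurable (fun x => ln (f x)).
Proof.
move=> [mf [B fB]] a0 af.
have f0 x : 0 < f x by exact: lt_le_trans (af x).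
split; first by apply: measurableT_comp => //; exact: measurable_ln.
exists (`|ln a| + `|ln B|) => x.
have fxB : f x <= B by exact: le_trans (ler_norm _) (fB x).
have l1 : ln a <= ln (f x) by rewrite ler_ln ?posrE.
have l2 : ln (f x) <= ln B by rewrite ler_ln ?posrE// (lt_le_trans (f0 x)).
have := ler_norm (ln B); have := ler_norm (- ln a); rewrite normrN.
have := normr_ge0 (ln B); have := normr_ge0 (ln a).
by rewrite ler_norml; lra.
Qed.

Lemma bounded_measurable_indic (A : set T) : measurable A ->
  bounded_measurable (\1_A : T -> R).
Proof.
move=> mA; split; first exact: measurable_indic.
by exists 1 => x; rewrite indicE; case: (_ \in _); rewrite ?normr1 ?normr0.
Qed.

Lemma bounded_measurable_sum n (F : 'I_n -> T -> R) :
  (forall i, bounded_measurable (F i)) ->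
  bounded_measurable (fun x => \sum_(i < n) F i x).
Proof.
elim: n F => [F _|n IH F bF].
  under eq_fun do rewrite big_ord0.
  exact: bounded_measurable_cst.
under eq_fun do rewrite big_ord_recr/=.
by apply: bounded_measurableD => //; apply: IH.
Qed.

End bounded_measurable_theory.

(** Bounded functions are integrable for every probability, so a real-valued mean suffices for
    costs, potentials and densities of plans. Extended reals remain only for entropies and general
    nonnegative integrals. *)
Definition mean d (T : measurableType d) (R : realType)
    (P : probability T R) (f : T -> R) : R := \int[P]_x f x.

Section mean_theory.
Context d (T : measurableType d) (R : realType) (P : probability T R).
Implicit Types f g : T -> R.

Lemma bounded_measurable_integrable f : bounded_measurable f ->
  P.-integrable setT (EFin \o f).
Proof.
move=> [mf [B fB]]; apply: measurable_bounded_integrable => //.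
  by rewrite (le_lt_trans (probability_le1 _ _)) ?ltry.
by exists B; split; [exact: num_real | move=> r Br x _ /=; exact: le_trans (fB x) (ltW Br)].
Qed.

Lemma EFin_mean f : bounded_measurable f ->
  (mean P f)%:E = (\int[P]_x (f x)%:E)%E.
Proof.
move=> /bounded_measurable_integrable bf; rewrite fineK//.
exact: integrable_fin_num.
Qed.

Lemma mean_cst r : mean P (fun=> r) = r.
Proof.
rewrite /mean Rintegral_cst// -[RHS]mulr1; congr (_ * _).
rewrite -[RHS]/(fine 1%:E); congr fine.
exact: probability_setT.
Qed.

Lemma eq_mean f g : f =1 g -> mean P f = mean P g.
Proof. by move=> /funext ->. Qed.

Lemma meanD f g : bounded_measurable f -> bounded_measurable g ->
  mean P (fun x => f x + g x) = mean P f + mean P g.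
Proof. by move=> *; rewrite /mean RintegralD//; exact: bounded_measurable_integrable. Qed.

Lemma meanB f g : bounded_measurable f -> bounded_measurable g ->
  mean P (fun x => f x - g x) = mean P f - mean P g.
Proof. by move=> *; rewrite /mean RintegralB//; exact: bounded_measurable_integrable. Qed.

Lemma meanZ f r : bounded_measurable f ->
  mean P (fun x => r * f x) = r * mean P f.
Proof. by move=> *; rewrite /mean RintegralZl//; exact: bounded_measurable_integrable. Qed.

Lemma le_mean f g : bounded_measurable f -> bounded_measurable g ->
  (forall x, f x <= g x) -> mean P f <= mean P g.
Proof. by move=> *; rewrite le_Rintegral//; exact: bounded_measurable_integrable. Qed.

Lemma mean_ge_cst f r : bounded_measurable f -> (forall x, r <= f x) ->
  r <= mean P f.
Proof.
move=> bf rf; rewrite -[leLHS]mean_cst.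
by apply: le_mean => //; exact: bounded_measurable_cst.
Qed.

Lemma mean_le_cst f r : bounded_measurable f -> (forall x, f x <= r) ->
  mean P f <= r.
Proof.
move=> bf rf; rewrite -[leRHS]mean_cst.
by apply: le_mean => //; exact: bounded_measurable_cst.
Qed.

Lemma le_norm_mean f : bounded_measurable f ->
  `|mean P f| <= mean P (fun x => `|f x|).
Proof. by move=> *; rewrite le_normr_Rintegral//; exact: bounded_measurable_integrable. Qed.

Lemma mean_sum n (F : 'I_n -> T -> R) : (forall i, bounded_measurable (F i)) ->
  mean P (fun x => \sum_(i < n) F i x) = \sum_(i < n) mean P (F i).
Proof.
elim: n F => [F _|n IH F bF].
  rewrite big_ord0 -[RHS]mean_cst; apply: eq_mean => x.
  by rewrite big_ord0.
rewrite big_ord_recr/= -IH// -meanD//.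
  by apply: eq_mean => x; rewrite big_ord_recr.
exact: bounded_measurable_sum.
Qed.

Lemma mean_indic (A : set T) : measurable A -> (mean P \1_A)%:E = P A.
Proof.
move=> mA; rewrite EFin_mean; last exact: bounded_measurable_indic.
by rewrite integral_indic// setIT.
Qed.

Lemma ae_eq_mean f g : bounded_measurable f -> bounded_measurable g ->
  {ae P, forall x, f x = g x} -> mean P f = mean P g.
Proof.
move=> [mf _] [mg _] fg; congr fine; apply: ae_eq_integral => //.
- exact/measurable_EFinP.
- exact/measurable_EFinP.
- by apply: filterS fg => x fgx _; rewrite fgx.
Qed.

End mean_theory.

Lemma mean_distribution d d' (T : measurableType d) (T' : measurableType d')
    (R : realType) (P : probability T R) (X : {mfun T >-> T'}) (f : T' -> R) :
  bounded_measurable f -> mean (distribution P X) f = mean P (f \o X).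
Proof.
move=> bf; rewrite /mean /Rintegral integral_distribution//.
  by apply/measurable_EFinP; case: bf.
by apply: (bounded_measurable_integrable P); exact: bounded_measurable_comp.
Qed.

Section mean_product.
Context d1 d2 (T1 : measurableType d1) (T2 : measurableType d2) (R : realType)
  (P : probability T1 R) (Q : probability T2 R).
Implicit Types f : T1 * T2 -> R.

Lemma bounded_measurable_pair2 f x : bounded_measurable f ->
  bounded_measurable (fun y => f (x, y)).
Proof.
by move=> bf; apply: bounded_measurable_comp bf _; exact: pair1_measurable.
Qed.

Lemma bounded_measurable_pair1 f y : bounded_measurable f ->
  bounded_measurable (fun x => f (x, y)).
Proof.
by move=> bf; apply: bounded_measurable_comp bf _; exact: pair2_measurable.
Qed.

Lemma bounded_measurable_fst (g : T1 -> R) : bounded_measurable g ->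
  bounded_measurable (fun z : T1 * T2 => g z.1).
Proof.
by move=> bg; apply: (bounded_measurable_comp bg); exact: measurable_fst.
Qed.

Lemma bounded_measurable_snd (g : T2 -> R) : bounded_measurable g ->
  bounded_measurable (fun z : T1 * T2 => g z.2).
Proof.
by move=> bg; apply: (bounded_measurable_comp bg); exact: measurable_snd.
Qed.

Lemma bounded_measurable_mean2 f : bounded_measurable f ->
  bounded_measurable (fun x => mean Q (fun y => f (x, y))).
Proof.
move=> bf; have [_ [B fB]] := bf; split; last first.
  exists B => x; have bx := bounded_measurable_pair2 x bf.
  rewrite (le_trans (le_norm_mean _ bx))//.
  by apply: mean_le_cst => //; exact: bounded_measurable_norm.
apply/measurable_EFinP.
have := measurable_fubini_F (bounded_measurable_integrable (P \x Q)%E bf).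
apply: eq_measurable_fun => x _ /=.
by rewrite EFin_mean//; exact: bounded_measurable_pair2.
Qed.

Lemma bounded_measurable_mean1 f : bounded_measurable f ->
  bounded_measurable (fun y => mean P (fun x => f (x, y))).
Proof.
move=> bf; have [_ [B fB]] := bf; split; last first.
  exists B => y; have bx := bounded_measurable_pair1 y bf.
  rewrite (le_trans (le_norm_mean _ bx))//.
  by apply: mean_le_cst => //; exact: bounded_measurable_norm.
apply/measurable_EFinP.
have := measurable_fubini_G (bounded_measurable_integrable (P \x Q)%E bf).
apply: eq_measurable_fun => y _ /=.
by rewrite EFin_mean//; exact: bounded_measurable_pair1.
Qed.

Lemma mean_product12 f : bounded_measurable f ->
  mean (P \x Q)%E f = mean P (fun x => mean Q (fun y => f (x, y))).
Proof.
move=> bf; apply: EFin_inj; rewrite !EFin_mean//; last first.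
  exact: bounded_measurable_mean2.
rewrite -(integral12_prod_meas1 (bounded_measurable_integrable _ bf)).
apply: eq_integral => x _ /=.
by rewrite EFin_mean//; exact: bounded_measurable_pair2.
Qed.

Lemma mean_product21 f : bounded_measurable f ->
  mean (P \x Q)%E f = mean Q (fun y => mean P (fun x => f (x, y))).
Proof.
move=> bf; apply: EFin_inj; rewrite !EFin_mean//; last first.
  exact: bounded_measurable_mean1.
rewrite -(integral21_prod_meas1 (bounded_measurable_integrable _ bf)).
apply: eq_integral => x _ /=.
by rewrite EFin_mean//; exact: bounded_measurable_pair1.
Qed.

End mean_product.

(** * The Sinkhorn fixed point *)

(** The two-sided bounds make the class stable under inversion, hence under the Sinkhorn step, and
    keep logarithms bounded. *)
Definition bounded_positive d (T : measurableType d) (R : realType)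
    (f : T -> R) : Prop :=
  bounded_measurable f /\ exists2 a, 0 < a & forall x, a <= f x.

Lemma bounded_positive_gt0 d (T : measurableType d) (R : realType)
  (f : T -> R) x : bounded_positive f -> 0 < f x.
Proof. by move=> [_ [a a0 af]]; exact: lt_le_trans (af x). Qed.

Lemma bounded_positive_inv d (T : measurableType d) (R : realType)
  (f : T -> R) : bounded_positive f -> bounded_positive (fun x => (f x)^-1).
Proof.
move=> pf; have [bf [a a0 af]] := pf; split.
  exact: bounded_measurable_inv a0 af.
have [_ [B fB]] := bf.
have B1 : 0 < `|B| + 1 by have := normr_ge0 B; lra.
exists (`|B| + 1)^-1; first by rewrite invr_gt0.
move=> x; rewrite lef_pV2 ?posrE ?(bounded_positive_gt0 x pf)//.
by have := fB x; have := ler_norm (f x); have := ler_norm B; lra.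
Qed.

(* [projectively_close v v' t]: the ratio [v' / v] oscillates by at most a
   factor [1 + t]; this bounds the Hilbert projective distance. *)
Definition projectively_close (R : realType) (T : Type) (v v' : T -> R)
    (t : R) : Prop :=
  exists A B, [/\ 0 < A, A <= B, B <= (1 + t) * A &
    forall x, A * v x <= v' x /\ v' x <= B * v x].

Section projectively_close_theory.
Context (R : realType) (T : Type).
Implicit Types (v : T -> R) (s t c : R).

Lemma projectively_close_sym v v' t :
  projectively_close v v' t -> projectively_close v' v t.
Proof.
move=> [A [B [A0 AB BA vv']]]; have B0 : 0 < B by exact: lt_le_trans AB.
exists B^-1, A^-1; split.
- by rewrite invr_gt0.
- by rewrite lef_pV2 ?posrE.
- by rewrite ler_pdivlMr// ler_pdivrMl// mulrC.
- by move=> x; have [h1 h2] := vv' x; rewrite ler_pdivlMl// ler_pdivrMl.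
Qed.

Lemma projectively_close_trans v v' v'' s t :
  projectively_close v v' s -> projectively_close v' v'' t ->
  projectively_close v v'' ((1 + s) * (1 + t) - 1).
Proof.
move=> [A [B [A0 AB BA vv']]] [A' [B' [A'0 AB' BA' v'v'']]].
have B0 : 0 < B by exact: lt_le_trans AB.
have B'0 : 0 < B' by exact: lt_le_trans AB'.
exists (A' * A), (B' * B); split.
- exact: mulr_gt0.
- by apply: ler_pM => //; exact: ltW.
- have := ler_pM (ltW B'0) (ltW B0) BA' BA; nra.
- move=> x; have [h1 h2] := vv' x; have [h3 h4] := v'v'' x; split.
  + by rewrite -mulrA (le_trans _ h3)// ler_pM2l.
  + by rewrite -mulrA (le_trans h4)// ler_pM2l.
Qed.

(** Projective invariance: the iterates can be normalised freely. *)
Lemma projectively_close_scale v v' c c' t : 0 < c -> 0 < c' ->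
  projectively_close v v' t ->
  projectively_close (fun x => c * v x) (fun x => c' * v' x) t.
Proof.
move=> c0 c'0 [A [B [A0 AB BA vv']]].
exists (c' * A / c), (c' * B / c); split.
- by rewrite divr_gt0// mulr_gt0.
- by rewrite ler_pM2r ?invr_gt0// ler_pM2l.
- by rewrite [leRHS]mulrA ler_pM2r ?invr_gt0// [leRHS]mulrCA ler_pM2l.
- move=> x; have [h1 h2] := vv' x.
  have e D : c' * D / c * (c * v x) = c' * (D * v x).
    by rewrite mulrA mulfVK ?gt_eqF// mulrA.
  by rewrite !e !(ler_pM2l c'0).
Qed.

Lemma projectively_close_inv v v' t : (forall x, 0 < v x) ->
  projectively_close v v' t ->
  projectively_close (fun x => (v x)^-1) (fun x => (v' x)^-1) t.
Proof.
move=> v0 /projectively_close_sym[A [B [A0 AB BA vv']]].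
have B0 : 0 < B by exact: lt_le_trans AB.
exists A, B; split => // x; have [h1 h2] := vv' x; have vx0 := v0 x.
have v'0 : 0 < v' x by rewrite -(pmulr_rgt0 _ B0) (lt_le_trans vx0).
by rewrite ler_pdivrMr// ler_pdivlMl// ler_pdivlMr// ler_pdivrMl// !(mulrC (v' x)).
Qed.

(** Agreement at one point puts 1 between the bounds [A] and [B] of the ratio, so the ratio differs
    from 1 by at most [B - A <= t * A <= t]. *)
Lemma projectively_close_norm v v' t (x0 : T) : (forall x, 0 < v x) ->
  v x0 = v' x0 -> projectively_close v v' t ->
  forall x, `|v' x - v x| <= t * v x.
Proof.
move=> v0 e [A [B [A0 AB BA vv']]] x.
have [a1 a2] : A <= 1 /\ 1 <= B.
  have [] := vv' x0; rewrite -e => h1 h2; have v0x := v0 x0.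
  by split; rewrite -(ler_pM2r v0x) mul1r.
have [h1 h2] := vv' x; have vx := v0 x.
have tA : B - A <= t by nra.
by rewrite ler_norml; apply/andP; split; nra.
Qed.

Lemma norm_projectively_close v v' (a s : R) : 0 < a -> 0 <= s -> s <= 2^-1 ->
  (forall x, a <= v x) -> (forall x, `|v' x - v x| <= s * a) ->
  projectively_close v v' (4 * s).
Proof.
(* [1 + s <= (1 + 4 * s) * (1 - s)] holds because [s] is between 0 and 1/2. *)
move=> a0 s0 s2 av vv'; exists (1 - s), (1 + s); split; [lra..|nra|].
move=> x; have := vv' x; rewrite ler_norml => /andP[h1 h2]; have := av x.
by split; nra.
Qed.

(** Projective distance zero means proportionality: one cross inequality holds up to every [e > 0],
    and exchanging the two points turns it into an equality. *)
Lemma projectively_close_eq v v' (x0 x : T) : (forall x, 0 < v x) ->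
  (forall t, 0 < t -> projectively_close v v' t) ->
  v' x * v x0 = v' x0 * v x.
Proof.
move=> v0 vv'.
have le y z : v' y * v z <= v' z * v y.
  have vy := v0 y; have vz := v0 z.
  have v'z : 0 < v' z.
    have [A [B [A0 _ _ /(_ z)[h1 h2]]]] := vv' _ ltr01.
    by apply: lt_le_trans h1; exact: mulr_gt0.
  apply/ler_addgt0Pr => e e0.
  have p0 := mulr_gt0 v'z vy.
  have t0 : 0 < e / (v' z * v y) by rewrite divr_gt0.
  have [A [B [A0 AB BA h]]] := vv' _ t0.
  have [_ h2] := h y; have [h3 _] := h z.
  have -> : v' z * v y + e = (1 + e / (v' z * v y)) * (v' z * v y).
    by rewrite mulrDl mul1r mulfVK// gt_eqF.
  move: (e / _) t0 BA => t t0 BA.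
  have B0 : 0 < B by exact: lt_le_trans AB.
  have h5 : v' y * v z <= B * v y * v z by rewrite ler_pM2r.
  have h6 : A * v z * v y <= v' z * v y by rewrite ler_pM2r.
  have h7 : B * (v y * v z) <= (1 + t) * A * (v y * v z).
    by rewrite ler_pM2r// mulr_gt0.
  have : (1 + t) * (A * v z * v y) <= (1 + t) * (v' z * v y).
    by rewrite ler_pM2l// addr_gt0.
  lra.
by apply/eqP; rewrite eq_le !le.
Qed.

End projectively_close_theory.

(** * Contraction of the half-step in the projective distance *)

Section sinkhorn_half_step.
Context d1 d2 (T1 : measurableType d1) (T2 : measurableType d2) (R : realType)
  (Q : probability T2 R) (K : T1 * T2 -> R) (k : R).
Hypotheses (bK : bounded_measurable K) (k_gt0 : 0 < k)
  (kK : forall z, k <= K z) (K1 : forall z, K z <= 1).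
Implicit Types v : T2 -> R.

Definition kernel_mean v (x : T1) : R := mean Q (fun y => K (x, y) * v y).

(** The potential that gives the plan with density [half_step v x * K (x, y) * v y] mass one on
    every fibre over [x]. *)
Definition half_step v (x : T1) : R := (kernel_mean v x)^-1.

Let bKv v x : bounded_measurable v ->
  bounded_measurable (fun y => K (x, y) * v y).
Proof. by move=> bv; apply: bounded_measurableM => //; exact: bounded_measurable_pair2. Qed.

Lemma kernel_mean_ge v x : bounded_measurable v -> (forall y, 0 <= v y) ->
  k * mean Q v <= kernel_mean v x.
Proof.
move=> bv v0; rewrite -meanZ//; apply: le_mean => //.
- by apply: bounded_measurableM => //; exact: bounded_measurable_cst.
- exact: bKv.
- by move=> y; rewrite ler_wpM2r.
Qed.

Lemma kernel_mean_le v x : bounded_measurable v -> (forall y, 0 <= v y) ->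
  kernel_mean v x <= mean Q v.
Proof.
move=> bv v0; apply: le_mean => //; first exact: bKv.
by move=> y; rewrite -[leRHS]mul1r ler_wpM2r.
Qed.

Lemma kernel_meanB v v' A x : bounded_measurable v -> bounded_measurable v' ->
  kernel_mean (fun y => v' y - A * v y) x
  = kernel_mean v' x - A * kernel_mean v x.
Proof.
move=> bv bv'; rewrite /kernel_mean -meanZ; last exact: bKv.
rewrite -meanB; first by apply: eq_mean => y; ring.
  exact: bKv.
apply: bounded_measurableM; first exact: bounded_measurable_cst.
exact: bKv.
Qed.

Lemma bounded_measurable_kernel_mean v : bounded_measurable v ->
  bounded_measurable (kernel_mean v).
Proof.
(* A mean over the second factor is the same for every probability on the first one; the Dirac mass
   supplies one. *)
move=> bv; apply: (@bounded_measurable_mean2 _ _ T1 T2 _ (dirac point) Q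
  (fun z => K z * v z.2)).
by apply: bounded_measurableM => //; exact: bounded_measurable_snd.
Qed.

Lemma bounded_positive_kernel_mean v : bounded_positive v ->
  bounded_positive (kernel_mean v).
Proof.
move=> pv; have [bv [a a0 av]] := pv.
split; first exact: bounded_measurable_kernel_mean.
exists (k * a); first exact: mulr_gt0.
move=> x; rewrite (le_trans _ (kernel_mean_ge x bv _))//.
  by rewrite ler_pM2l//; exact: mean_ge_cst.
by move=> y; rewrite ltW// bounded_positive_gt0.
Qed.

Lemma bounded_positive_half_step v : bounded_positive v ->
  bounded_positive (half_step v).
Proof. by move=> pv; apply/bounded_positive_inv/bounded_positive_kernel_mean. Qed.

Lemma half_step_kernel_mean v x : bounded_positive v ->
  half_step v x * kernel_mean v x = 1.
Proof.
move=> pv; rewrite mulVf// gt_eqF// bounded_positive_gt0//.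
exact: bounded_positive_kernel_mean.
Qed.

Lemma kernel_meanZ c v x : bounded_measurable v ->
  kernel_mean (fun y => c * v y) x = c * kernel_mean v x.
Proof.
move=> bv; rewrite /kernel_mean -meanZ; last exact: bKv.
by apply: eq_mean => y; rewrite mulrCA.
Qed.

(** Every kernel mean of [v] lies between [k * mean Q v] and [mean Q v]. The resulting bound does
    not depend on [v]: the image of the half-step has finite projective diameter. *)
Lemma half_step_ratio v x x' : bounded_positive v ->
  k * half_step v x' <= half_step v x.
Proof.
move=> pv; have pG := bounded_positive_kernel_mean pv.
have [bv _] := pv; have v0 y : 0 <= v y by rewrite ltW// bounded_positive_gt0.
have Gx := bounded_positive_gt0 x pG; have Gx' := bounded_positive_gt0 x' pG.
rewrite /half_step ler_pdivrMr// ler_pdivlMl//.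
rewrite (le_trans _ (kernel_mean_ge x' bv v0))// mulrC ler_pM2l//.
exact: kernel_mean_le.
Qed.

(** Birkhoff's contraction. For [f >= 0] all kernel means agree up to a factor [k], so the ratio of
    the kernel means of [f] and [v] at any point is at least [k ^+ 2] times the ratio at [x0].
    Applied to [v' - A * v] and [B * v - v'], this moves both bounds of the ratio towards its value
    [r] at [x0], and their distance shrinks from [B - A] to [(1 - k ^+ 2) * (B - A)]. *)
Lemma projectively_close_kernel_mean v v' t :
  bounded_positive v -> bounded_measurable v' ->
  projectively_close v v' t ->
  projectively_close (kernel_mean v) (kernel_mean v') ((1 - k ^+ 2) * t).
Proof.
move=> pv bv' [A [B [A0 AB BA vv']]].
have [bv _] := pv; have v0 y : 0 < v y by rewrite bounded_positive_gt0.
have G0 x : 0 < kernel_mean v x.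
  exact/bounded_positive_gt0/bounded_positive_kernel_mean.
pose x0 : T1 := point.
have k1 : k <= 1 by exact: le_trans (kK (x0, point)) (K1 _).
have key f x : bounded_measurable f -> (forall y, 0 <= f y) ->
    k ^+ 2 * kernel_mean f x0 * kernel_mean v x <=
    kernel_mean f x * kernel_mean v x0.
  move=> bf f0.
  have mf0 : 0 <= mean Q f by exact: mean_ge_cst.
  have mv0 : 0 <= mean Q v by apply: mean_ge_cst => // y; exact: ltW.
  have v0' y := ltW (v0 y).
  have f1 := kernel_mean_ge x bf f0; have f2 := kernel_mean_le x0 bf f0.
  have v1 := kernel_mean_ge x0 bv v0'; have v2 := kernel_mean_le x bv v0'.
  have f3 : 0 <= kernel_mean f x0.
    by rewrite (le_trans _ (kernel_mean_ge x0 bf f0))// mulr_ge0// ltW.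
  have h1 := ler_pM f3 (ltW (G0 x)) f2 v2.
  have h2 := ler_pM (mulr_ge0 (ltW k_gt0) mf0) (mulr_ge0 (ltW k_gt0) mv0) f1 v1.
  have k20 : 0 <= k ^+ 2 by rewrite exprn_ge0// ltW.
  have := ler_wpM2l k20 h1; nra.
pose r := kernel_mean v' x0 / kernel_mean v x0.
have rE : r * kernel_mean v x0 = kernel_mean v' x0 by rewrite mulfVK// gt_eqF.
have bAv c : bounded_measurable (fun y => c * v y).
  by apply: bounded_measurableM => //; exact: bounded_measurable_cst.
have lo x : (A + k ^+ 2 * (r - A)) * kernel_mean v x <= kernel_mean v' x.
  have := key (fun y => v' y - A * v y) x.
  rewrite !kernel_meanB// => /(_ (bounded_measurableB bv' (bAv A))) h.
  rewrite -(ler_pM2r (G0 x0)).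
  move: h; rewrite -rE => h.
  have : k ^+ 2 * (r * kernel_mean v x0 - A * kernel_mean v x0) * kernel_mean v x
    <= (kernel_mean v' x - A * kernel_mean v x) * kernel_mean v x0.
    by apply: h => y; rewrite subr_ge0; have [] := vv' y.
  nra.
have hi x : kernel_mean v' x <= (B - k ^+ 2 * (B - r)) * kernel_mean v x.
  have := key (fun y => B * v y - v' y) x.
  have e z : kernel_mean (fun y => B * v y - v' y) z
      = B * kernel_mean v z - kernel_mean v' z.
    rewrite -[RHS]opprB -kernel_meanB// -[RHS]mulN1r -kernel_meanZ//.
      by congr mean; apply/funext => y; congr (_ * _); ring.
    exact: bounded_measurableB.
  rewrite !e => /(_ (bounded_measurableB (bAv B) bv')) h.
  rewrite -(ler_pM2r (G0 x0)).
  have : k ^+ 2 * (B * kernel_mean v x0 - r * kernel_mean v x0) * kernel_mean v x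
    <= (B * kernel_mean v x - kernel_mean v' x) * kernel_mean v x0.
    by rewrite rE; apply: h => y; rewrite subr_ge0; have [] := vv' y.
  nra.
have rA : A <= r.
  rewrite ler_pdivlMr// -kernel_meanZ//; apply: le_mean; try exact: bKv.
  move=> y; have [h1 h2] := vv' y; rewrite ler_wpM2l//.
  exact: le_trans (ltW k_gt0) (kK _).
have rB : r <= B.
  rewrite ler_pdivrMr// -kernel_meanZ//; apply: le_mean; try exact: bKv.
  move=> y; have [h1 h2] := vv' y; rewrite ler_wpM2l//.
  exact: le_trans (ltW k_gt0) (kK _).
have k21 : k ^+ 2 <= 1 by rewrite expr_le1// ltW.
have k20 : 0 < k ^+ 2 by rewrite exprn_gt0.
exists (A + k ^+ 2 * (r - A)), (B - k ^+ 2 * (B - r)); split.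
- nra.
- nra.
- have t0 : 0 <= t by nra.
  have h : (1 - k ^+ 2) * (B - A) <= (1 - k ^+ 2) * (t * A).
    by rewrite ler_wpM2l//; lra.
  have h' : (1 - k ^+ 2) * t * A <= (1 - k ^+ 2) * t * (A + k ^+ 2 * (r - A)).
    by rewrite ler_wpM2l//; [rewrite mulr_ge0//; lra | nra].
  nra.
- by move=> x; split.
Qed.

Lemma projectively_close_half_step v v' t :
  bounded_positive v -> bounded_positive v' ->
  projectively_close v v' t ->
  projectively_close (half_step v) (half_step v') ((1 - k ^+ 2) * t).
Proof.
move=> pv [bv' _] vv'; apply: projectively_close_inv.
  by move=> x; exact/bounded_positive_gt0/bounded_positive_kernel_mean.
exact: projectively_close_kernel_mean.
Qed.

End sinkhorn_half_step.

(** Adding and subtracting the tail [c / (1 - q) * q ^+ n] of the geometric series gives a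
    nonincreasing and a nondecreasing sequence with a common limit, which encloses [w] and provides
    the rate. *)
Lemma geometric_cauchy_cvg (R : realType) (w : R^nat) (c q : R) :
  0 <= q -> q < 1 -> (forall n, `|w n.+1 - w n| <= c * q ^+ n) ->
  exists2 l : R, w @ \oo --> l & forall n, `|l - w n| <= c / (1 - q) * q ^+ n.
Proof.
move=> q0 q1 wc; set a := c / (1 - q).
have aq n : a * q ^+ n - a * q ^+ n.+1 = c * q ^+ n.
  have -> : a * q ^+ n - a * q ^+ n.+1 = a * (1 - q) * q ^+ n.
    by rewrite exprS; ring.
  by rewrite /a mulfVK// gt_eqF// subr_gt0.
have aq0 : (fun n => a * q ^+ n) @ \oo --> (0 : R).
  by apply: cvg_geometric; rewrite ger0_norm.
pose u n := w n + a * q ^+ n; pose v n := w n - a * q ^+ n.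
have hu : nonincreasing_seq u.
  apply/nonincreasing_seqP => n.
  by have := wc n; have := aq n; rewrite /u ler_norml; lra.
have hv : nondecreasing_seq v.
  apply/nondecreasing_seqP => n.
  by have := wc n; have := aq n; rewrite /v ler_norml; lra.
have c0 : 0 <= c by have := wc 0; rewrite expr0 mulr1; apply: le_trans.
have a0 : 0 <= a by rewrite divr_ge0// subr_ge0 ltW.
have vu n : v n <= u n.
  by rewrite /u /v lerD2l ge0_cp// mulr_ge0// exprn_ge0.
have cu : cvgn u.
  apply: nonincreasing_is_cvgn => //; exists (v 0%N) => _ [n _ <-].
  by rewrite (le_trans _ (vu n))//; exact: hv.
have wE : w = (fun n => u n - a * q ^+ n).
  by apply/funext => n; rewrite /u addrK.
have cw : w @ \oo --> limn u.
  by rewrite wE -[X in _ --> X]subr0; exact: cvgB.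
have cv : v @ \oo --> limn u.
  by rewrite -[X in _ --> X]subr0; exact: cvgB.
exists (limn u) => // n; have h1 := nonincreasing_cvgn_ge hu cu n.
have h2 := nondecreasing_cvgn_le hv (cvgP _ cv) n.
rewrite (cvg_lim _ cv)// in h2.
by move: h1 h2; rewrite /u /v ler_norml; lra.
Qed.

(** * Convergence of the normalised iteration *)

Section sinkhorn.
Context d1 d2 (T1 : measurableType d1) (T2 : measurableType d2) (R : realType)
  (P : probability T1 R) (Q : probability T2 R) (K : T1 * T2 -> R) (k : R).
Hypotheses (bK : bounded_measurable K) (k_gt0 : 0 < k)
  (kK : forall z, k <= K z) (K1 : forall z, K z <= 1).

Let K' (z : T2 * T1) := K (z.2, z.1).

Let bK' : bounded_measurable K'.
Proof.
apply: (bounded_measurable_comp bK).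
by apply: measurable_fun_pair; [exact: measurable_snd | exact: measurable_fst].
Qed.

Let sinkhorn_step (v : T2 -> R) : T2 -> R := half_step P K' (half_step Q K v).

Local Notation F := sinkhorn_step.

Let F_pos v : bounded_positive v -> bounded_positive (F v).
Proof.
move=> pv; apply: (bounded_positive_half_step P bK' k_gt0).
- by move=> z; exact: kK.
- exact: (bounded_positive_half_step Q bK k_gt0).
Qed.

Let q := 1 - k ^+ 2.

Let k_le1 : k <= 1.
Proof. exact: le_trans (kK (point, point)) (K1 _). Qed.

Let q_ge0 : 0 <= q.
Proof. by rewrite subr_ge0 expr_le1// ltW. Qed.

Let q_lt1 : q < 1.
Proof. by rewrite ltrBlDr ltrDl exprn_gt0. Qed.

Let F_close v v' t : bounded_positive v -> bounded_positive v' ->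
  projectively_close v v' t -> projectively_close (F v) (F v') (q * (q * t)).
Proof.
move=> pv pv' vv'; have hK' z : k <= K' z := kK _.
have hK1 z : K' z <= 1 := K1 _.
apply: (projectively_close_half_step P bK' k_gt0) => //.
- exact: (bounded_positive_half_step Q bK k_gt0).
- exact: (bounded_positive_half_step Q bK k_gt0).
- exact: (projectively_close_half_step Q bK k_gt0).
Qed.

Let y0 : T2 := point.

(** The step contracts only up to scalars; fixing the value 1 at [y0] turns projective closeness of
    the iterates into pointwise closeness. *)
Let iterate (n : nat) : T2 -> R :=
  iter n (fun v y => (F v y0)^-1 * F v y) (fun=> 1).

Local Notation w := iterate.

Let pcst (c : R) d (T : measurableType d) : 0 < c ->
  bounded_positive (fun _ : T => c).
Proof. by move=> c0; split; [exact: bounded_measurable_cst | exists c]. Qed.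

Let w_pos n : bounded_positive (w n).
Proof.
elim: n => [|n IH]; first exact: pcst.
have pF := F_pos IH; have F0 := bounded_positive_gt0 y0 pF.
have [bF [a a0 aF]] := pF.
split; first by apply: bounded_measurableM => //; exact: bounded_measurable_cst.
exists ((F (w n) y0)^-1 * a); first by rewrite mulr_gt0// invr_gt0.
by move=> y; rewrite ler_pM2l// invr_gt0.
Qed.

Let w_y0 n : w n y0 = 1.
Proof.
case: n => //= n; rewrite mulVf// gt_eqF// bounded_positive_gt0//.
exact/F_pos/w_pos.
Qed.

Let F_ratio v y y' : bounded_positive v -> k * F v y' <= F v y.
Proof.
move=> pv; apply: (half_step_ratio P bK' k_gt0).
- by move=> z; exact: kK.
- by move=> z; exact: K1.
- exact: (bounded_positive_half_step Q bK k_gt0).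
Qed.

(** The values of an image of the step compare within a factor [k], and one of them is 1. *)
Let w_ge n y : k <= w n y.
Proof.
case: n => [|n] /=; first exact: k_le1.
have F0 := bounded_positive_gt0 y0 (F_pos (w_pos n)).
rewrite ler_pdivlMl//mulrC; exact/F_ratio/w_pos.
Qed.

Let w_le n y : w n y <= k^-1.
Proof.
case: n => [|n] /=; first by rewrite invf_ge1.
have F0 := bounded_positive_gt0 y0 (F_pos (w_pos n)).
rewrite ler_pdivrMl// ler_pdivlMr// mulrC; exact/F_ratio/w_pos.
Qed.

Let p := q * q.

Let w_close : exists2 t, 0 <= t &
  forall n, projectively_close (w n) (w n.+1) (p ^+ n * t).
Proof.
have k1_ge : k <= k^-1 by rewrite (le_trans k_le1)// invf_ge1.
have ki : 0 < k^-1 by rewrite invr_gt0.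
(* Iterate 0 is the constant 1 and iterate 1 lies between [k] and [k^-1], so [1 + t] is the quotient
   of these two bounds. *)
exists (k^-1 / k - 1).
  by rewrite subr_ge0 ler_pdivlMr// mul1r.
elim=> [|n IH].
  exists k, k^-1; split => //.
    by rewrite expr0 mul1r subrKC mulfVK// gt_eqF.
  by move=> y; rewrite !mulr1; split; [exact: (w_ge 1) | exact: (w_le 1)].
have := F_close (w_pos n) (w_pos n.+1) IH.
rewrite exprS mulrA -[p * _ * _]mulrA -/p.
have F0 := bounded_positive_gt0 y0 (F_pos (w_pos n)).
have F1 := bounded_positive_gt0 y0 (F_pos (w_pos n.+1)).
by move/(projectively_close_scale _ _); apply; rewrite invr_gt0.
Qed.

Let p_ge0 : 0 <= p. Proof. exact: mulr_ge0. Qed.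

Let p_lt1 : p < 1.
Proof. by rewrite (le_lt_trans _ q_lt1)// ler_piMr// ltW. Qed.

(** The rate is uniform in [y], as is needed to pass back from pointwise to projective closeness in
    [w_limit_close]. *)
Let limit : exists v : T2 -> R, [/\ bounded_positive v, v y0 = 1 &
  exists2 c, 0 <= c & forall n y, `|v y - w n y| <= c * p ^+ n].
Proof.
have [t t0 wt] := w_close.
have step n y : `|w n.+1 y - w n y| <= (t / k) * p ^+ n.
  have w0 z := bounded_positive_gt0 z (w_pos n).
  have e : w n y0 = w n.+1 y0 by rewrite !w_y0.
  rewrite (le_trans (projectively_close_norm w0 e (wt n) y))//.
  rewrite [leRHS]mulrC [leRHS]mulrA ler_wpM2l//.
  by rewrite mulr_ge0// exprn_ge0.
have /choice[v hv] y : exists l : R, w ^~ y @ \oo --> l /\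
    forall n, `|l - w n y| <= t / k / (1 - p) * p ^+ n.
  have [l l1 l2] := geometric_cauchy_cvg p_ge0 p_lt1 (step ^~ y).
  by exists l.
have c0 : 0 <= t / k / (1 - p).
  by rewrite !divr_ge0 ?subr_ge0 ?(ltW k_gt0) ?(ltW p_lt1).
have vlim y : limn (w ^~ y) = v y by apply: cvg_lim => //; have [] := hv y.
have cw y : cvgn (w ^~ y) by apply: cvgP; have [+ _] := hv y; exact.
have v_ge y : k <= v y.
  by rewrite -vlim; apply: limr_ge => //; apply: nearW => n; exact: w_ge.
have v_le y : v y <= k^-1.
  by rewrite -vlim; apply: limr_le => //; apply: nearW => n; exact: w_le.
exists v; split.
- split; last by exists k.
  split.
    apply: (@measurable_fun_cvg _ _ _ _ w) => [n|y _].
      by have [[]] := w_pos n.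
    by have [] := hv y.
  exists k^-1 => y; rewrite ger0_norm ?v_le//.
  exact: le_trans (ltW k_gt0) (v_ge y).
- by rewrite -vlim; under eq_fun do rewrite w_y0; rewrite lim_cst.
- by exists (t / k / (1 - p)) => // n y; have [_] := hv y.
Qed.

(** Since the iterates are at least [k], an error [s * k] is a relative error [s]. Two consecutive
    indices are needed because the step sends iterate [n] to a multiple of iterate [n.+1]. *)
Let w_limit_close v c : 0 <= c -> bounded_positive v ->
  (forall n y, `|v y - w n y| <= c * p ^+ n) ->
  forall e, 0 < e -> exists n, projectively_close (w n) v e /\
    projectively_close (w n.+1) v e.
Proof.
move=> c0 pv vw e e0.
have [s [s0 s2 se]] : exists s, [/\ 0 < s, s <= 2^-1 & 4 * s <= e].
  exists (Num.min 2^-1 (e / 4)); split.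
  - by rewrite lt_min invr_gt0 ltr0n divr_gt0.
  - by rewrite ge_min lexx.
  - have : Num.min 2^-1 (e / 4) <= e / 4 by rewrite ge_min lexx orbT.
    lra.
have : (fun n => c * p ^+ n) @ \oo --> (0 : R).
  by apply: cvg_geometric; rewrite ger0_norm.
have sk : 0 < s * k by rewrite mulr_gt0.
move=> /cvgrPdist_le/(_ _ sk)[n _ hn].
have close m : (n <= m)%N -> projectively_close (w m) v e.
  move=> nm; have [A [B [A0 AB BA h]]] : projectively_close (w m) v (4 * s).
    apply: (norm_projectively_close k_gt0 (ltW s0) s2 (w_ge m)) => y.
    apply: le_trans (vw m y) _; have := hn m nm; rewrite sub0r normrN.
    exact: le_trans (ler_norm _).
  exists A, B; split => //; apply: le_trans BA _.
  by rewrite ler_pM2r// lerD2l.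
by exists n; split; apply: close.
Qed.

(** Projective convergence makes the limit a fixed point up to the scalar [F v y0]. That scalar is
    1: the total mass of the plan is 1 when integrated over [y] first and the inverse of the scalar
    when integrated over [x] first. *)
Lemma sinkhorn_potentials : exists u v, [/\ bounded_positive u,
  bounded_positive v, u = half_step Q K v & v = half_step P K' u].
Proof.
have [v [pv v0 [c c0 vw]]] := limit.
have pF := F_pos pv; have F0 := bounded_positive_gt0 y0 pF.
have Fv y : F v y = F v y0 * v y.
  rewrite -[LHS]mulr1 -[in LHS]v0.
  apply: projectively_close_eq => [x|t t0]; first exact: bounded_positive_gt0.
  have [s [s0 s1 st]] : exists s, [/\ 0 < s, s <= 1 & 3 * s <= t].
    (* Two estimates of size [s] are chained, and [(1 + s) ^+ 2 - 1 <= 3 * s] for [s <= 1]. *)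
    exists (Num.min 1 (t / 3)); split.
    - by rewrite lt_min ltr01 divr_gt0.
    - by rewrite ge_min lexx.
    - have : Num.min 1 (t / 3) <= t / 3 by rewrite ge_min lexx orbT.
      lra.
  have [n [c1 c2]] := w_limit_close c0 pv vw s0.
  have Fn0 := bounded_positive_gt0 y0 (F_pos (w_pos n)).
  have h3 : projectively_close (F (w n)) (F v) s.
    have [A [B [A0 AB BA h]]] := F_close (w_pos n) pv c1.
    exists A, B; split => //; apply: le_trans BA _.
    rewrite ler_pM2r// lerD2l mulrA -/p.
    by rewrite -[leRHS]mul1r ler_wpM2r ?(ltW s0)// ltW.
  have {}h3 : projectively_close (w n.+1) (F v) s.
    have := projectively_close_scale _ ltr01 h3.
    rewrite (_ : (fun x => 1 * F v x) = F v); last first.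
      by apply/funext => x; rewrite mul1r.
    by apply; rewrite invr_gt0.
  have [A [B [A0 AB BA h]]] :=
    projectively_close_trans (projectively_close_sym c2) h3.
  exists A, B; split => //; apply: le_trans BA _.
  by rewrite ler_pM2r//; nra.
pose u := half_step Q K v; have pu : bounded_positive u.
  exact: (bounded_positive_half_step Q bK k_gt0).
have [bu _] := pu; have [bv _] := pv.
have uv x : mean Q (fun y => u x * K (x, y) * v y) = 1.
  rewrite -(half_step_kernel_mean Q bK k_gt0 kK x pv) /kernel_mean -meanZ.
    by apply: eq_mean => y; rewrite mulrA.
  by apply: bounded_measurableM => //; exact: bounded_measurable_pair2.
have vu y : F v y0 * mean P (fun x => u x * K (x, y) * v y) = 1.
  have hK' z : k <= K' z := kK _.
  have -> : mean P (fun x => u x * K (x, y) * v y)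
      = v y * kernel_mean P K' u y.
    rewrite /kernel_mean -meanZ.
      by apply: eq_mean => x; rewrite mulrC [u x * _]mulrC.
    by apply: bounded_measurableM => //; exact: (bounded_measurable_pair2 _ bK').
  rewrite mulrA -Fv; exact: (half_step_kernel_mean P bK' k_gt0 hK' y pu).
have bf : bounded_measurable (fun z : T1 * T2 => u z.1 * K z * v z.2).
  apply: bounded_measurableM; last exact: bounded_measurable_snd.
  by apply: bounded_measurableM => //; exact: bounded_measurable_fst.
have F1 : F v y0 = 1.
  have := mean_product21 P Q bf; rewrite mean_product12//=.
  rewrite (eq_mean _ uv) mean_cst.
  have e y : mean P (fun x => u x * K (x, y) * v y) = (F v y0)^-1.
    by apply: (mulfI (lt0r_neq0 F0)); rewrite vu mulfV// gt_eqF.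
  by rewrite (eq_mean _ e) mean_cst => /esym/eqP; rewrite invr_eq1 => /eqP.
exists u, v; split => //.
by apply/funext => y; rewrite -[LHS]mul1r -F1 -Fv.
Qed.

End sinkhorn.

(** * Densities, image measures and relative entropy *)

Section density_measure.
Context d (T : measurableType d) (R : realType) (rho : probability T R)
  (r : T -> R).
Hypotheses (pr : bounded_positive r) (mean_r : mean rho r = 1).

(* The hypotheses are arguments so that the probability structure below can be
   inferred. *)
Definition density_measure of bounded_positive r & mean rho r = 1 :=
  fun A : set T => (\int[rho]_(x in A) (r x)%:E)%E.

Local Notation gamma := (density_measure pr mean_r).

Let r_ge0 x : 0 <= r x.
Proof. exact/ltW/bounded_positive_gt0. Qed.

Let mr : measurable_fun setT (EFin \o r).
Proof. by apply/measurable_EFinP; have [[]] := pr. Qed.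

Let gamma0 : gamma set0 = 0%E.
Proof. by rewrite /density_measure integral_set0. Qed.

Let gamma_ge0 A : (0 <= gamma A)%E.
Proof. by apply: integral_ge0 => x _; rewrite lee_fin. Qed.

Let gamma_sigma_additive : semi_sigma_additive gamma.
Proof.
apply: (@semi_sigma_additive_nng_induced _ _ _ rho (EFin \o r)) => //.
Qed.

HB.instance Definition _ :=
  isMeasure.Build _ _ _ gamma gamma0 gamma_ge0 gamma_sigma_additive.

Let gamma_setT : gamma setT = 1%E.
Proof. by rewrite /density_measure -EFin_mean ?mean_r//; case: pr. Qed.

HB.instance Definition _ := Measure_isProbability.Build _ _ _ gamma gamma_setT.

End density_measure.

Definition has_density d (T : measurableType d) (R : realType)
    (gamma rho : probability T R) (r : T -> R) : Prop :=
  bounded_positive r /\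
  forall A, measurable A -> gamma A = (\int[rho]_(x in A) (r x)%:E)%E.

Lemma has_density_exists d (T : measurableType d) (R : realType)
    (rho : probability T R) (r : T -> R) :
  bounded_positive r -> mean rho r = 1 ->
  exists gamma : probability T R, has_density gamma rho r.
Proof. by move=> pr mr; exists (density_measure pr mr). Qed.

Section has_density_theory.
Context d (T : measurableType d) (R : realType) (gamma rho : probability T R)
  (r : T -> R).
Hypothesis dr : has_density gamma rho r.

Let br : bounded_measurable r.
Proof. by have [[]] := dr. Qed.

Let mr : measurable_fun setT (EFin \o r).
Proof. by apply/measurable_EFinP; have [] := br. Qed.

Lemma has_density_dominates : gamma `<< rho.
Proof.
apply/null_content_dominatesP => A mA A0; have [_ ->//] := dr.
by apply: null_set_integral => //; exact: measurable_funTS.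
Qed.

(** The Radon-Nikodym derivative and [r] have equal integrals over every measurable set, so they
    agree almost everywhere. *)
Lemma ge0_integral_has_density (f : T -> \bar R) :
  measurable_fun setT f -> (forall x, 0 <= f x)%E ->
  (\int[gamma]_x f x = \int[rho]_x (f x * (r x)%:E))%E.
Proof.
move=> mf f0; have dom := has_density_dominates.
rewrite -(Radon_Nikodym_SigmaFinite.change_of_variables dom f0 measurableT mf).
have mF := measurable_int _ (Radon_Nikodym_SigmaFinite.f_integrable dom).
apply: ae_eq_integral => //.
- exact: emeasurable_funM.
- exact: emeasurable_funM.
- apply: ae_eqe_mul2l; apply: integral_ae_eq => //.
    exact: Radon_Nikodym_SigmaFinite.f_integrable.
  move=> E _ mE; have [_ dE] := dr.
  exact: etrans (esym (Radon_Nikodym_SigmaFinite.f_integral dom mE)) (dE E mE).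
Qed.

Lemma mean_density : mean rho r = 1.
Proof.
apply: EFin_inj; rewrite EFin_mean//.
have [_ /(_ _ measurableT) <-] := dr; exact: probability_setT.
Qed.

Lemma mean_has_density (f : T -> R) : bounded_measurable f ->
  mean gamma f = mean rho (fun x => f x * r x).
Proof.
move=> bf; have [mf [B fB]] := bf.
have bB : bounded_measurable (fun _ : T => B).
  exact: bounded_measurable_cst.
have e g : bounded_measurable g -> (forall x, 0 <= g x) ->
    mean gamma g = mean rho (fun x => g x * r x).
  move=> bg g0; apply: EFin_inj; rewrite !EFin_mean//; last first.
    exact: bounded_measurableM.
  apply: (ge0_integral_has_density (f := EFin \o g)) => [|x] /=.
    by apply/measurable_EFinP; case: bg.
  by rewrite lee_fin.
have B0 : 0 <= B by exact: le_trans (normr_ge0 _) (fB point).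
(* Adding the bound [B] makes [f] nonnegative; as [r] has mean 1, the added constant cancels. *)
have /e : bounded_measurable (fun x => f x + B) by exact: bounded_measurableD.
rewrite meanD// mean_cst (eq_mean _ (fun x => mulrDl (f x) B (r x))).
rewrite meanD; [|exact: bounded_measurableM..].
rewrite meanZ// mean_density mulr1 => h; apply: (addIr B); apply: h => x.
by have := fB x; rewrite ler_norml; lra.
Qed.

End has_density_theory.

(** A relation rather than the term [distribution P X]: marginals of couplings, invariant measures
    and products of discretizations are images without being written as such. *)
Definition pushes d d' (T : measurableType d) (T' : measurableType d')
    (R : realType) (X : T -> T') (P : probability T R) (P' : probability T' R)
    : Prop :=
  measurable_fun setT X /\ forall A, measurable A -> P' A = P (X @^-1` A).

Section pushes_theory.
Context d d' (T : measurableType d) (T' : measurableType d') (R : realType)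
  (X : T -> T') (P : probability T R) (P' : probability T' R).
Hypothesis XP : pushes X P P'.

Let mX : measurable_fun setT X. Proof. by case: XP. Qed.
Let X_mixin := isMeasurableFun.Build _ _ _ _ X mX.
Let X_pack : {mfun T >-> T'} := HB.pack X X_mixin.

Lemma ge0_integral_pushes (f : T' -> \bar R) :
  measurable_fun setT f -> (forall y, 0 <= f y)%E ->
  (\int[P']_y f y = \int[P]_x f (X x))%E.
Proof.
move=> mf f0.
rewrite -[RHS](ge0_integral_distribution (P := P) X_pack mf f0).
by apply: eq_measure_integral => A mA _; case: XP => _ /(_ _ mA).
Qed.

Lemma integral_pushes (f : T' -> \bar R) : measurable_fun setT f ->
  (\int[P']_y f y = \int[P]_x f (X x))%E.
Proof.
move=> mf; rewrite integralE [RHS]integralE.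
have mp : measurable_fun setT (f^\+)%E by exact: measurable_funepos.
have mn : measurable_fun setT (f^\-)%E by exact: measurable_funeneg.
rewrite (ge0_integral_pushes mp)//; rewrite (ge0_integral_pushes mn)//.
by congr (_ - _)%E; apply: eq_integral => x _; rewrite ?funeposE ?funenegE.
Qed.

Lemma mean_pushes (f : T' -> R) : bounded_measurable f ->
  mean P' f = mean P (f \o X).
Proof.
move=> bf; congr fine; rewrite integral_pushes//.
by apply/measurable_EFinP; case: bf.
Qed.

Lemma pushes_dominates (Q : probability T R) (Q' : probability T' R) :
  pushes X Q Q' -> P `<< Q -> P' `<< Q'.
Proof.
move=> [_ hQ] /null_content_dominatesP PQ; apply/null_content_dominatesP => A mA.
have [_ hP] := XP; move=> /(etrans (esym (hQ A mA))) QA.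
apply: etrans (hP A mA) _; apply: PQ => //.
by rewrite -[Y in measurable Y]setTI; exact: mX.
Qed.

End pushes_theory.

(* Unlike in [le_integral], the functions need not be integrable. *)
Lemma measurable_le_integral d (T : measurableType d) (R : realType)
    (mu : {measure set T -> \bar R}) (f g : T -> \bar R) :
  measurable_fun setT f -> measurable_fun setT g ->
  (forall x, f x <= g x)%E -> (\int[mu]_x f x <= \int[mu]_x g x)%E.
Proof.
move=> mf mg fg; rewrite integralE [leRHS]integralE.
apply: leeB; apply: ge0_le_integral => //.
- exact: measurable_funepos.
- exact: measurable_funepos.
- by move=> x _; rewrite !funeposE ge_max !le_max fg lexx orbT.
- exact: measurable_funeneg.
- exact: measurable_funeneg.
- by move=> x _; rewrite !funenegE ge_max !le_max leeN2 fg lexx orbT.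
Qed.

(** * Data processing and Gibbs' inequality for the relative entropy *)

Lemma measurable_lne d (T : measurableType d) (R : realType) (F : T -> R) :
  measurable_fun setT F -> measurable_fun setT (fun x => lne (F x)%:E).
Proof.
move=> mF; apply: measurable_fun_ifT.
- exact: measurable_fun_ler.
- exact: measurable_cst.
- by apply/measurable_EFinP; apply: measurableT_comp => //; exact: measurable_ln.
Qed.

(** The entropy is defined with the derivative of a charge, while the derivative for sigma-finite
    measures is finite and nonnegative at every point and comes with a change of variables. The two
    agree almost everywhere for [rho], hence for [gamma]. *)
Lemma relative_entropyE d (T : measurableType d) (R : realType)
    (gamma rho : probability T R) : gamma `<< rho ->
  exists F : T -> R, [/\ measurable_fun setT F, forall x, 0 <= F x,
    forall f : T -> \bar R, measurable_fun setT f -> (forall x, 0 <= f x)%E ->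
      (\int[gamma]_x f x = \int[rho]_x (f x * (F x)%:E))%E &
    relative_entropy gamma rho = (\int[gamma]_x lne (F x)%:E)%E].
Proof.
move=> dom; set G := Radon_Nikodym_SigmaFinite.f gamma rho.
have G0 x : (0 <= G x)%E by exact: Radon_Nikodym_SigmaFinite.f_ge0.
have Gfin x : G x \is a fin_num by exact: Radon_Nikodym_SigmaFinite.f_fin_num.
have mG : measurable_fun setT G.
  exact: measurable_int (Radon_Nikodym_SigmaFinite.f_integrable dom).
have GE x : G x = (fine (G x))%:E by rewrite fineK.
have mF : measurable_fun setT (fun x => fine (G x)).
  apply/measurable_EFinP; rewrite (_ : EFin \o _ = G)//.
  by apply/funext => x /=; rewrite fineK.
exists (fun x => fine (G x)); split => //.
- by move=> x; rewrite fine_ge0.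
- move=> f mf f0; under [RHS]eq_integral do rewrite -GE.
  by rewrite (Radon_Nikodym_SigmaFinite.change_of_variables dom).
- rewrite /relative_entropy asboolT//.
  set RN := Radon_Nikodym _ _.
  have mRN : measurable_fun setT RN.
    exact: measurable_int (Radon_Nikodym_integrable _).
  have RNfin x : RN x \is a fin_num by exact: Radon_Nikodym_fin_num.
  have mFR : measurable_fun setT (fun x => fine (RN x)).
    apply/measurable_EFinP; rewrite (_ : EFin \o _ = RN)//.
    by apply/funext => x /=; rewrite fineK.
  apply: ae_eq_integral => //.
  + rewrite (_ : (fun x => lne (RN x)) = (fun x => lne (fine (RN x))%:E)).
      exact: measurable_lne.
    by apply/funext => x; rewrite fineK.
  + exact: measurable_lne.
  + apply: (null_dominates_ae_eq measurableT dom).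
    have := ae_eq_Radon_Nikodym_SigmaFinite dom measurableT.
    apply: filterS => x /(_ I) e _.
    by congr lne; rewrite [RHS]fineK // /G e.
Qed.

(** Data processing. With [F] the density of the images, [g = (F \o X) / r] has mean 1 under
    [gamma], and [ln g <= g - 1] bounds [ln (F \o X)] by [ln r + g - 1]. For [X] the identity this
    bounds the entropy of [gamma] itself. *)
Lemma relative_entropy_pushes_le d d' (T : measurableType d)
    (T' : measurableType d') (R : realType) (gamma rho : probability T R)
    (gamma' rho' : probability T' R) (r : T -> R) (X : T -> T') :
  has_density gamma rho r -> pushes X gamma gamma' -> pushes X rho rho' ->
  (relative_entropy gamma' rho' <= (mean gamma (fun x => ln (r x)))%:E)%E.
Proof.
move=> dr Xg Xr.
have [pr _] := dr; have r0 x := bounded_positive_gt0 x pr.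
have [br [a a0 ar]] := pr; have blr := bounded_measurable_ln br a0 ar.
have brV := bounded_measurable_inv br a0 ar.
have dom' : gamma' `<< rho'.
  apply: (pushes_dominates Xg Xr); exact: (has_density_dominates dr).
have [F [mF F0 Fint ->]] := relative_entropyE dom'.
have [mX _] := Xg.
have mFX : measurable_fun setT (F \o X) by exact: measurableT_comp.
rewrite (integral_pushes Xg (measurable_lne mF)).
pose g x := F (X x) / r x.
have g0 x : 0 <= g x by rewrite divr_ge0// ltW.
have mg : measurable_fun setT g by apply: measurable_funM => //; case: brV.
have intg : (\int[gamma]_x (g x)%:E = 1)%E.
  rewrite (ge0_integral_has_density dr (f := EFin \o g)); last 2 first.
  - exact/measurable_EFinP.
  - by move=> x /=; rewrite lee_fin.
  under eq_integral do rewrite -EFinM mulfVK ?gt_eqF//.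
  rewrite -(ge0_integral_pushes Xr (f := EFin \o F)); last 2 first.
  - exact/measurable_EFinP.
  - by move=> x /=; rewrite lee_fin.
  have -> : (\int[rho']_y (EFin \o F) y = \int[gamma']_y cst 1 y)%E.
    rewrite Fint//.
    by apply: eq_integral => y _; rewrite mul1e.
  by rewrite integral_cst// mul1e; exact: probability_setT.
have ig : gamma.-integrable setT (EFin \o g).
  apply/integrableP; split; first exact/measurable_EFinP.
  under eq_integral do rewrite gee0_abs ?lee_fin//=.
  by rewrite intg ltry.
have bl1 : bounded_measurable (fun x => ln (r x) - 1).
  by apply: bounded_measurableB => //; exact: bounded_measurable_cst.
have il1 := bounded_measurable_integrable gamma bl1.
apply: (@le_trans _ _ (\int[gamma]_x ((ln (r x) - 1)%:E + (g x)%:E))%E).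
  apply: measurable_le_integral => [||x].
  - exact: measurable_lne.
  - by apply: emeasurable_funD; [exact: measurable_int il1 | exact: measurable_int ig].
  - have [F1|F1] := leP (F (X x)) 0; first by rewrite le0_lneNy ?leNye.
    rewrite lne_EFin// -EFinD lee_fin.
    have -> : F (X x) = g x * r x by rewrite mulfVK// gt_eqF.
    have gx : 0 < g x by rewrite divr_gt0.
    rewrite lnM ?posrE//; have := le_ln1Dx (x := g x - 1).
    by rewrite subrKC; lra.
rewrite integralD//= intg -EFin_mean// -EFinD lee_fin.
rewrite meanB//; last exact: bounded_measurable_cst.
by rewrite mean_cst subrK.
Qed.

(** Gibbs' inequality. With [F] the density of [gamma], [g = s / F] has mean at most 1 under
    [gamma], and [ln F >= ln s + 1 - g] wherever [F] is positive. *)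
Lemma relative_entropy_ge d (T : measurableType d) (R : realType)
    (gamma rho : probability T R) (s : T -> R) :
  bounded_positive s -> mean rho s <= 1 ->
  ((mean gamma (fun x => ln (s x)))%:E <= relative_entropy gamma rho)%E.
Proof.
move=> ps ms; have [bs [a a0 sa]] := ps.
have s0 x := bounded_positive_gt0 x ps.
have bls := bounded_measurable_ln bs a0 sa.
have [dom|ndom] := pselect (gamma `<< rho); last first.
  by rewrite /relative_entropy asboolF// leey.
have [F [mF F0 Fint ->]] := relative_entropyE dom.
have mFV : measurable_fun setT (fun x => (F x)^-1).
  rewrite (_ : (fun x => (F x)^-1)
      = (fun x => if F x <= 0 then 0 else expR (- ln (F x)))); last first.
    apply/funext => x; case: ifPn => [Fx|]; last first.
      by rewrite -ltNge => Fx; rewrite expRN lnK.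
    have -> : F x = 0 by apply/eqP; rewrite eq_le Fx F0.
    by rewrite invr0.
  apply: measurable_fun_ifT; first exact: measurable_fun_ler.
    exact: measurable_cst.
  apply: measurableT_comp => //; apply: measurableT_comp => //.
  by apply: measurableT_comp => //; exact: measurable_ln.
pose g x := s x / F x.
have g0 x : 0 <= g x by rewrite divr_ge0// ltW.
have mg : measurable_fun setT g by apply: measurable_funM => //; case: bs.
have intg : (\int[gamma]_x (g x)%:E <= 1)%E.
  rewrite (Fint (EFin \o g)); last 2 first.
  - exact/measurable_EFinP.
  - by move=> x /=; rewrite lee_fin.
  apply: (@le_trans _ _ (\int[rho]_x (s x)%:E)%E); last by rewrite -EFin_mean.
  apply: ge0_le_integral => //.
  - by move=> x _; rewrite /= mule_ge0// lee_fin.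
  - by apply: emeasurable_funM; exact/measurable_EFinP.
  - by apply/measurable_EFinP; case: bs.
  - move=> x _ /=; rewrite -EFinM lee_fin /g.
    have [->|Fx] := eqVneq (F x) 0; first by rewrite mulr0 ltW.
    by rewrite mulfVK.
have ig : gamma.-integrable setT (EFin \o g).
  apply/integrableP; split; first exact/measurable_EFinP.
  under eq_integral do rewrite gee0_abs ?lee_fin//=.
  by rewrite (le_lt_trans intg)// ltry.
have bl1 : bounded_measurable (fun x => ln (s x) + 1).
  by apply: bounded_measurableD => //; exact: bounded_measurable_cst.
have il1 := bounded_measurable_integrable gamma bl1.
have igl : gamma.-integrable setT
    (fun x => (ln (s x) + 1)%:E - (g x)%:E)%E by exact: integrableB.
(* Where [F] vanishes, [g] is 0 and the lower bound on [lne F] fails. That set is null for [gamma];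
   the maximum makes the comparison hold everywhere without changing the integral. *)
pose f x := maxe (lne (F x)%:E) ((ln (s x) + 1)%:E - (g x)%:E)%E.
have mf : measurable_fun setT f.
  apply: measurable_maxe; first exact: measurable_lne.
  exact: measurable_int igl.
have mF0 : measurable [set x | F x = 0].
  by have := mF measurableT _ (measurable_set1 0); rewrite setTI.
have gF0 : gamma [set x | F x = 0] = 0%E.
  rewrite -[X in gamma X]setIT -integral_indic// Fint.
  - apply: integral0_eq => x _ /=; rewrite indicE.
    have [/set_mem ->|_] := boolP (x \in [set x | F x = 0]).
      by rewrite mule0.
    by rewrite mul0e.
  - by apply/measurable_EFinP; exact: measurable_indic.
  - by move=> x; rewrite lee_fin indicE ler0n.
have -> : (\int[gamma]_x lne (F x)%:E = \int[gamma]_x f x)%E.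
  apply: ae_eq_integral => //; first exact: measurable_lne.
  exists [set x | F x = 0]; split => // x /= xF; apply: contrapT => /eqP Fx0.
  apply: xF => _; rewrite /f; apply/esym/max_l.
  have Fx : 0 < F x by rewrite lt_neqAle eq_sym Fx0 F0.
  rewrite lne_EFin// -EFinB lee_fin.
  have gx : 0 < g x by rewrite divr_gt0.
  have -> : ln (s x) = ln (g x) + ln (F x).
    by rewrite -lnM ?posrE// mulfVK// gt_eqF.
  have := le_ln1Dx (x := g x - 1).
  by rewrite subrKC; lra.
apply: (@le_trans _ _ (\int[gamma]_x ((ln (s x) + 1)%:E - (g x)%:E))%E).
  rewrite integralB//= -EFin_mean//.
  rewrite meanD//; last exact: bounded_measurable_cst.
  have fg : (\int[gamma]_x (g x)%:E)%E \is a fin_num.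
    exact: (integrable_fin_num measurableT ig).
  move: intg; rewrite mean_cst -(fineK fg) -EFinB !lee_fin; lra.
apply: measurable_le_integral => //; first exact: measurable_int igl.
by move=> x; rewrite le_max lexx orbT.
Qed.

(** * The circle and the torus *)

(* The distance to the nearest integer; it does not depend on the choice of
   representative, see [circle_norm_pi]. *)
Definition circle_norm (R : realType) (x : circle R) : R :=
  `|(repr x : R) - (Num.floor ((repr x : R) + 2^-1))%:~R|.

Section circle_norm_theory.
Context (R : realType).
Implicit Types (r : R) (x y : circle R) (m : nat).

Lemma circle_piD r s : circle_pi (r + s) = circle_pi r + circle_pi s.
Proof. exact: raddfD. Qed.

Lemma circle_piN r : circle_pi (- r) = - circle_pi r.
Proof. exact: raddfN. Qed.

Lemma circle_piB r s : circle_pi (r - s) = circle_pi r - circle_pi s.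
Proof. exact: raddfB. Qed.

Lemma circle_pi_int (n : int) : circle_pi (n%:~R : R) = 0.
Proof.
have -> : 0 = circle_pi (0 : R) by rewrite /circle_pi raddf0.
by apply/circle_pi_eq; rewrite subr0 intr_int.
Qed.

Lemma circle_norm_pi r :
  circle_norm (circle_pi r) = `|r - (Num.floor (r + 2^-1))%:~R|.
Proof.
rewrite /circle_norm; have : repr (circle_pi r) - r \is a Num.int.
  by apply/circle_pi_eq; rewrite circle_pi_repr.
move=> /intrP[k]; move/eqP; rewrite subr_eq => /eqP ->.
rewrite -[k%:~R + r + 2^-1]addrA floorDzr ?intr_int// intrKfloor intrD.
by congr (`|_|); ring.
Qed.

Lemma circle_norm_exists x : exists2 r, circle_pi r = x &
  circle_norm x = `|r| /\ `|r| <= 2^-1.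
Proof.
pose r : R := repr x; exists (r - (Num.floor (r + 2^-1))%:~R).
  by rewrite circle_piB circle_pi_int subr0 circle_pi_repr.
split=> //; have /andP[] := floor_itv (r + 2^-1).
by rewrite intrD ler_norml; lra.
Qed.

Lemma circle_norm_pi_small r : `|r| <= 2^-1 -> circle_norm (circle_pi r) = `|r|.
Proof.
move=> r2; have [s sr [-> s2]] := circle_norm_exists (circle_pi r).
move/circle_pi_eq: sr => /intrP[k ke].
have : `|k%:~R : R| <= 1.
  by rewrite -ke (le_trans (ler_normB _ _))//; lra.
rewrite -intr_norm -[1]/(1%:~R : R) ler_int => k1.
(* Both representatives lie in [[-1/2, 1/2]], so they are equal or they are the two endpoints, whose
   absolute values agree. *)
have [|[|]] : k = -1 \/ k = 0 \/ k = 1 by move: k1; case: k {ke} => [[|[|]]|[|]] //=; auto.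
all: move=> kE; move: ke; rewrite kE => ke.
- have : s = r - 1 by move: ke; rewrite mulrN1z; lra.
  move=> sE; have : r = 2^-1 by move: s2 r2; rewrite !ler_norml sE; lra.
  by move=> rE; rewrite sE rE -normrN; congr (`|_|); lra.
- by have -> : s = r by move: ke; rewrite mulr0z; lra.
- have : s = r + 1 by move: ke; rewrite mulr1z; lra.
  move=> sE; have : r = - 2^-1 by move: s2 r2; rewrite !ler_norml sE; lra.
  by move=> rE; rewrite sE rE -normrN; congr (`|_|); lra.
Qed.

Lemma circle_norm_pi_le r : circle_norm (circle_pi r) <= `|r|.
Proof.
have [r2|r2] := leP `|r| 2^-1; first by rewrite circle_norm_pi_small.
have [s _ [-> s2]] := circle_norm_exists (circle_pi r).
exact: le_trans s2 (ltW r2).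
Qed.

Lemma circle_norm_ge0 x : 0 <= circle_norm x.
Proof. exact: normr_ge0. Qed.

Lemma circle_norm_le_half x : circle_norm x <= 2^-1.
Proof. by have [r _ [-> ]] := circle_norm_exists x. Qed.

Lemma circle_normN x : circle_norm (- x) = circle_norm x.
Proof.
have [r <- [-> r2]] := circle_norm_exists x.
by rewrite -circle_piN circle_norm_pi_small normrN.
Qed.

Lemma circle_norm_sub x y : circle_norm (x - y) = circle_norm (y - x).
Proof. by rewrite -circle_normN opprB. Qed.

Lemma circle_normD x y : circle_norm (x + y) <= circle_norm x + circle_norm y.
Proof.
have [r <- [-> _]] := circle_norm_exists x.
have [s <- [-> _]] := circle_norm_exists y.
by rewrite -circle_piD (le_trans (circle_norm_pi_le _))// ler_normD.
Qed.

Lemma circle_norm_le_sub x y : circle_norm x <= circle_norm y + circle_norm (x - y).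
Proof. by rewrite (le_trans _ (circle_normD _ _))// subrKC. Qed.

(** Both norms are at most 1/2, so in the factorisation of the difference of squares the sum of the
    norms is at most 1. *)
Lemma circle_norm_sqr_lip x y :
  `|circle_norm x ^+ 2 - circle_norm y ^+ 2| <= circle_norm (x - y).
Proof.
have h1 := circle_norm_le_sub x y; have h2 := circle_norm_le_sub y x.
rewrite circle_norm_sub in h2.
have x0 := circle_norm_ge0 x; have y0 := circle_norm_ge0 y.
have x2 := circle_norm_le_half x; have y2 := circle_norm_le_half y.
by rewrite ler_norml; apply/andP; split; nra.
Qed.

(** For representatives [r] and [s] of least size, [r + s] and [r - s] bound the norms of [x + y]
    and [x - y] from above, while [r] computes that of [x] exactly. The parallelogram identity
    leaves [2 * s ^+ 2]. *)
Lemma circle_norm_sqr_semiconcave x y e : circle_norm y <= e ->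
  circle_norm (x + y) ^+ 2 + circle_norm (x - y) ^+ 2
  - 2 * circle_norm x ^+ 2 <= 2 * e ^+ 2.
Proof.
have [r <- [-> _]] := circle_norm_exists x.
have [s <- [-> _]] := circle_norm_exists y => se.
rewrite -circle_piD -circle_piB.
have h1 := circle_norm_pi_le (r + s); have h2 := circle_norm_pi_le (r - s).
have h3 := circle_norm_ge0 (circle_pi (r + s)).
have h4 := circle_norm_ge0 (circle_pi (r - s)).
have {}h1 : circle_norm (circle_pi (r + s)) ^+ 2 <= (r + s) ^+ 2.
  by rewrite -[leRHS]real_normK ?num_real// ler_sqr ?nnegrE//.
have {}h2 : circle_norm (circle_pi (r - s)) ^+ 2 <= (r - s) ^+ 2.
  by rewrite -[leRHS]real_normK ?num_real// ler_sqr ?nnegrE//.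
have h5 : s ^+ 2 <= e ^+ 2.
  rewrite -[leLHS]real_normK ?num_real// ler_sqr ?nnegrE//.
  exact: le_trans (normr_ge0 _) se.
rewrite (real_normK (num_real r)).
have : (r + s) ^+ 2 + (r - s) ^+ 2 = 2 * r ^+ 2 + 2 * s ^+ 2 by ring.
lra.
Qed.

(** When [r + s] and [r - s] stay within 1/2 of the origin they compute the norms exactly, and the
    second difference is [2 * s ^+ 2]. *)
Lemma circle_norm_sqr_semiconvex x y e : circle_norm y <= e ->
  circle_norm x + e <= 2^-1 ->
  0 <= circle_norm (x + y) ^+ 2 + circle_norm (x - y) ^+ 2
  - 2 * circle_norm x ^+ 2.
Proof.
have [r <- [-> _]] := circle_norm_exists x.
have [s <- [-> _]] := circle_norm_exists y => se re.
rewrite -circle_piD -circle_piB !circle_norm_pi_small; last 2 first.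
- by rewrite (le_trans (ler_normB _ _))//; lra.
- by rewrite (le_trans (ler_normD _ _))//; lra.
rewrite !real_normK ?num_real//.
by have := sqr_ge0 s; nra.
Qed.

(** Across the concave kink at 1/2 only the Lipschitz bound on each of the two increments
    survives. *)
Lemma circle_norm_sqr_second_diff_ge x y e : circle_norm y <= e ->
  - (2 * e) <= circle_norm (x + y) ^+ 2 + circle_norm (x - y) ^+ 2
  - 2 * circle_norm x ^+ 2.
Proof.
move=> ye; have h1 := circle_norm_sqr_lip (x + y) x.
have h2 := circle_norm_sqr_lip (x - y) x.
move: h1 h2; rewrite addrAC subrr add0r addrAC subrr add0r circle_normN !ler_norml.
lra.
Qed.

Lemma measurable_circle_norm : measurable_fun setT (@circle_norm R).
Proof.
apply: measurable_circle.
rewrite [X in measurable_fun _ X](_ : _ =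
  (fun x : R => `|x - (Num.floor (x + 2^-1))%:~R|)); last first.
  by apply/funext => x /=; exact: circle_norm_pi.
apply: measurableT_comp => //; apply: measurable_funB => //.
apply: nondecreasing_measurable => // x y xy.
by rewrite ler_int le_floor// lerD2r.
Qed.

End circle_norm_theory.

(** * Invariance of the Lebesgue measure of the circle *)

Section circle_leb_invariance.
Context (R : realType).
Local Notation leb := (@lebesgue_measure R).

Lemma lebesgue_measure_translation (t : R) (A : set (measurableTypeR R)) :
  measurable A -> leb ((fun x => x + t) @^-1` A) = leb A.
Proof.
move=> mA; pose f (x : R) : measurableTypeR R := x + t.
change (pushforward leb f A = leb A).
apply/esym; apply: lebesgue_measure_unique => //= [|mf _ [[a b]] _ <-].
  by apply: measurable_funD => //; exact: measurable_cst.
rewrite /pushforward.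
have -> : f @^-1` `]a, b] = `]a - t, b - t]%classic.
  by apply/seteqP; split => x /=; rewrite !in_itv/= ltrBlDr lerBrDr.
rewrite !lebesgue_measure_itv/= !lte_fin ltrD2r.
by case: ifPn => // _; rewrite -!EFinB; congr (_%:E); ring.
Qed.

(** Taking opposites exchanges the two kinds of half-open interval; they differ by endpoints, which
    are null. *)
Lemma lebesgue_measure_bndo (a b : R) (B : set (measurableTypeR R)) :
  measurable B -> leb (B `&` `]a, b]) = leb (B `&` `[a, b[).
Proof.
move=> mB.
have mi : measurable (B `&` `]a, b[) by exact: measurableI.
have null (c : R) : measurable (B `&` [set c]) /\ leb (B `&` [set c]) = 0%E.
  have mc : measurable (B `&` [set c]) by apply: measurableI.
  split => //; apply: (subset_measure0 (mu := leb) mc (measurable_set1 c)).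
    exact: subIsetr.
  exact: lebesgue_measure_set1.
have [|ab] := leP b a.
  by move=> ba; rewrite !set_itv_ge ?setI0// -leNgt/= bnd_simp.
have [[ma na] [mb nb]] := (null a, null b).
have -> : `]a, b]%classic = `]a, b[ `|` [set b].
  by rewrite (@setUitv1 _ _ (BRight a) b true)// bnd_simp.
have -> : `[a, b[%classic = [set a] `|` `]a, b[.
  by rewrite (@setU1itv _ _ (BLeft b) a false)// bnd_simp.
rewrite !setIUr [in RHS]setUC.
apply: etrans (measureU0 mi mb nb) _.
exact: esym (measureU0 mi ma na).
Qed.

Variable B : set (measurableTypeR R).
Hypothesis mB : measurable B.
Hypothesis B_periodic : forall x (n : int), B (x + n%:~R) <-> B x.

Let window_split (a b c : R) : a <= b -> b <= c ->
  leb (B `&` `[a, c[) = (leb (B `&` `[a, b[) + leb (B `&` `[b, c[))%E.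
Proof.
move=> ab bc; rewrite -measureU; last 3 first.
- exact: measurableI.
- exact: measurableI.
- apply/seteqP; split => // x /= [[_ +] [_]]; rewrite !in_itv/=.
  by move=> /andP[_ h1] /andP[h2 _]; move: (lt_le_trans h1 h2); rewrite ltxx.
congr (leb _); rewrite -setIUr; congr (_ `&` _).
by rewrite -itv_bndbnd_setU ?bnd_simp.
Qed.

Let window_shift (a b : R) (n : int) :
  leb (B `&` `[a + n%:~R, b + n%:~R[) = leb (B `&` `[a, b[).
Proof.
rewrite -(lebesgue_measure_translation n%:~R); last exact: measurableI.
congr (leb _); apply/seteqP; split => x /=.
  by move=> [/B_periodic ?]; rewrite !in_itv/= lerD2r ltrD2r.
by move=> [? xab]; split; [exact/B_periodic | move: xab; rewrite !in_itv/= lerD2r ltrD2r].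
Qed.

(** With [n] the floor of [t], the part of the window beyond [n + 1] is moved back by 1, where it
    completes the window starting at [n]. *)
Lemma periodic_window (t : R) :
  leb (B `&` `[t, t + 1[) = leb (B `&` `[0, 1[).
Proof.
pose n := Num.floor t; have /andP[] := floor_itv t; rewrite -/n intrD => h1 h2.
rewrite (@window_split t (n%:~R + 1) (t + 1)); [|lra..].
have -> : leb (B `&` `[n%:~R + 1, t + 1[) = leb (B `&` `[n%:~R, t[).
  exact: (window_shift n%:~R t 1).
rewrite addeC -window_split//; last by rewrite ltW.
have -> : `[n%:~R, n%:~R + 1[%classic = `[0 + n%:~R, 1 + n%:~R[%classic :> set R.
  by rewrite add0r addrC.
exact: window_shift.
Qed.

Lemma periodic_translation (t : R) :
  leb ((fun x => x + t) @^-1` B `&` `[0, 1[) = leb (B `&` `[0, 1[).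
Proof.
rewrite -(periodic_window t) -[RHS](lebesgue_measure_translation t).
  congr (leb _); apply/seteqP; split => x /=; rewrite !in_itv/=;
  by move=> [? /andP[h1 h2]]; split => //; apply/andP; split; lra.
exact: measurableI.
Qed.

Lemma periodic_opposite :
  leb (-%R @^-1` B `&` `[0, 1[) = leb (B `&` `[0, 1[).
Proof.
rewrite -(periodic_window (- 1)) addrC subrr -[RHS]lebesgue_measure_bndo//.
have mI : measurable (B `&` `](- 1), 0]) by exact: measurableI.
rewrite -(lebesgue_measureN mI) /pushforward.
congr (leb _); apply/seteqP; split => x /=; rewrite !in_itv/=;
by move=> [? /andP[h1 h2]]; split => //; apply/andP; split; lra.
Qed.

End circle_leb_invariance.

Section circle_leb_theory.
Context (R : realType).
Local Notation leb := (@lebesgue_measure R).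
Local Notation circle_leb := (circle_leb R).

Lemma circle_lebE (A : set (circle R)) : measurable A ->
  circle_leb A = leb (circle_pi @^-1` A `&` `[0, 1[).
Proof.
move=> mA; rewrite /circle_leb /distribution /pushforward.
have mB : measurable (circle_pi @^-1` A : set (measurableTypeR R)).
  by rewrite -[X in measurable X]setTI; exact: measurable_circle_pi.
change (uniform_prob (@ltr01 R) (circle_pi @^-1` A) =
  leb (circle_pi @^-1` A `&` `[0, 1[)).
rewrite -lebesgue_measure_bndo// /uniform_prob integral_uniform_pdf.
have m01 : measurable (circle_pi @^-1` A `&` `[0, 1]).
  by apply: measurableI.
have m01' : measurable (circle_pi @^-1` A `&` `]0, 1]).
  by apply: measurableI.
transitivity (\int[leb]_(x in circle_pi @^-1` A `&` `[0%R, 1%R]) cst 1 x)%E.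
  apply: eq_integral => x /set_mem[_]; rewrite /= in_itv /uniform_pdf /= => ->.
  by rewrite subr0 invr1.
rewrite integral_cst// mul1e.
have -> : `[0, 1]%classic = [set 0] `|` `]0, 1] :> set R.
  by rewrite (@setU1itv _ _ (BRight 1) 0 false)// bnd_simp.
rewrite setIUr setUC.
have m0 : measurable (circle_pi @^-1` A `&` [set 0]) by exact: measurableI.
apply: (measureU0 (mu := leb)) => //.
apply: (subset_measure0 (mu := leb) m0 (measurable_set1 0)).
  exact: subIsetr.
exact: lebesgue_measure_set1.
Qed.

Let periodic_preimage (A : set (circle R)) (x : R) (n : int) :
  (circle_pi @^-1` A) (x + n%:~R) <-> (circle_pi @^-1` A) x.
Proof. by rewrite /= circle_piD circle_pi_int addr0. Qed.

Lemma measurable_circle_add (t : circle R) :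
  measurable_fun setT (fun x : circle R => x + t).
Proof.
apply: measurable_circle.
rewrite (_ : _ \o _ = circle_pi \o (fun x : R => x + repr t)); last first.
  by apply/funext => x /=; rewrite circle_piD circle_pi_repr.
apply: measurableT_comp => //.
by apply: measurable_funD => //; exact: measurable_cst.
Qed.

Lemma measurable_circle_opp : measurable_fun setT (fun x : circle R => - x).
Proof.
apply: measurable_circle.
rewrite (_ : _ \o _ = circle_pi \o (fun x : R => - x)); last first.
  by apply/funext => x /=; rewrite circle_piN.
by apply: measurableT_comp => //; exact: oppr_measurable.
Qed.

Lemma circle_leb_add (t : circle R) :
  pushes (fun x : circle R => x + t) circle_leb circle_leb.
Proof.
split; first exact: measurable_circle_add.
move=> A mA; have mA' : measurable ((fun x : circle R => x + t) @^-1` A).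
  by rewrite -[X in measurable X]setTI; exact: measurable_circle_add.
rewrite circle_lebE// [RHS]circle_lebE//.
rewrite -(@periodic_translation _ _ _ (periodic_preimage A) (repr t)).
  congr (leb (_ `&` _)); apply/seteqP; split => x /=;
  by rewrite circle_piD circle_pi_repr.
by rewrite -[X in measurable X]setTI; exact: measurable_circle_pi.
Qed.

Lemma circle_leb_opp : pushes (fun x : circle R => - x) circle_leb circle_leb.
Proof.
split; first exact: measurable_circle_opp.
move=> A mA; have mA' : measurable ((fun x : circle R => - x) @^-1` A).
  by rewrite -[X in measurable X]setTI; exact: measurable_circle_opp.
rewrite circle_lebE// [RHS]circle_lebE//.
rewrite -(@periodic_opposite _ _ _ (periodic_preimage A)).
  congr (leb (_ `&` _)); apply/seteqP; split => x /=;
  by rewrite circle_piN.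
by rewrite -[X in measurable X]setTI; exact: measurable_circle_pi.
Qed.

End circle_leb_theory.

(** * Rounding to the grid and reflection of the cells *)

Section circle_grid.
Context (R : realType) (m : nat).
Hypothesis m_gt0 : (0 < m)%N.
Local Notation leb := (@lebesgue_measure R).
Local Notation q := (@circle_round R m).
Local Notation g := (fun k : int => circle_pi (k%:~R / m%:R : R)).

Let m0 : m%:R != 0 :> R. Proof. by rewrite pnatr_eq0 -lt0n. Qed.

Let m_pos : 0 < m%:R :> R. Proof. by rewrite ltr0n. Qed.

Lemma circle_norm_eq0 (x : circle R) : circle_norm x = 0 -> x = 0.
Proof.
have [r <- [-> _]] := circle_norm_exists x => /normr0_eq0 ->.
exact: (circle_pi_int _ 0).
Qed.

Lemma measurable_circle_set1 (a : circle R) : measurable [set a].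
Proof.
have mf : measurable_fun setT (fun x : circle R => circle_norm (x - a)).
  apply: measurableT_comp; first exact: measurable_circle_norm.
  exact: measurable_circle_add.
have := mf measurableT _ (measurable_set1 0); rewrite setTI.
congr (measurable _); apply/seteqP; split => x /=.
  by move=> /circle_norm_eq0/eqP; rewrite subr_eq0 => /eqP.
by move=> ->; rewrite subrr -(circle_pi_int _ 0) circle_norm_pi_small normr0 ?invr_ge0.
Qed.

Lemma circle_round_grid (x : circle R) : exists k : int, q x = g k.
Proof. by exists (Num.floor (m%:R * repr x + 2^-1)). Qed.

Lemma circle_grid_mod (k l : int) : g (k + m%:Z * l) = g k.
Proof.
apply/circle_pi_eq; rewrite -mulrBl intrD addrAC subrr add0r intrM.
by rewrite [_ * l%:~R]mulrC mulfK// intr_int.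
Qed.

Lemma circle_round_ord (x : circle R) : exists k : 'I_m, q x = g k.
Proof.
have [k ->] := circle_round_grid x.
have k0 : (0 <= (k %% m%:Z)%Z)%R by rewrite modz_ge0// -lt0n.
have km : ((k %% m%:Z)%Z < m%:Z)%R by rewrite ltz_pmod.
have e : `|(k %% m%:Z)%Z|%N%:Z = (k %% m%:Z)%Z by rewrite gez0_abs.
have lt : (`|(k %% m%:Z)%Z| < m)%N by rewrite -ltz_nat e.
exists (Ordinal lt) => /=; rewrite e.
have {1}-> : k = (k %% m%:Z)%Z + m%:Z * (k %/ m%:Z)%Z.
  by rewrite [RHS]addrC [X in X + _]mulrC -divz_eq.
exact: circle_grid_mod.
Qed.

Lemma circle_grid_inj (k l : 'I_m) : g k = g l -> k = l.
Proof.
move/circle_pi_eq; rewrite -mulrBl => /intrP[n /eqP].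
rewrite -(inj_eq (mulIf m0)) divfK// -intrB -[m%:R]/((m%:Z)%:~R) -intrM eqr_int.
move=> /eqP kl; apply/val_inj => /=.
have kE : k%:Z = n * m%:Z + l%:Z by rewrite -kl subrK.
have := congr1 (modz^~ m%:Z) kE.
by rewrite modzMDl !modz_small ?ltz_nat ?ltn_ord//= => -[].
Qed.

Lemma circle_round_gridD (k : int) (x : circle R) : q (g k + x) = g k + q x.
Proof.
rewrite -[x]circle_pi_repr -circle_piD !circle_round_pi -circle_piD -mulrDl.
rewrite mulrDr mulrCA divff// mulr1 -addrA floorDzr ?intr_int// intrKfloor.
by rewrite intrD.
Qed.

Lemma circle_norm_round (x : circle R) : circle_norm (x - q x) <= m%:R^-1 / 2.
Proof.
rewrite -[x]circle_pi_repr circle_round_pi -circle_piB.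
rewrite (le_trans (circle_norm_pi_le _))//.
set r : R := repr x; have /andP[] := floor_itv (m%:R * r + 2^-1).
move: (Num.floor _) => n; rewrite intrD => h1 h2.
have -> : r - n%:~R / m%:R = m%:R^-1 * (m%:R * r - n%:~R).
  by rewrite mulrBr mulKf// [in RHS]mulrC.
rewrite normrM ger0_norm ?invr_ge0// ler_pM2l ?invr_gt0//.
by rewrite ler_norml; lra.
Qed.

(** The ties of the rounding, where [m * x] is a half-integer. All ties are rounded up, so the
    rounding is not odd there. *)
Definition cell_boundary : set (circle R) := [set x | x *+ m = circle_pi 2^-1].

Lemma cell_boundary_null :
  measurable cell_boundary /\ circle_leb R cell_boundary = 0%E.
Proof.
have pre : circle_pi @^-1` cell_boundary
    `<=` range (fun n : int => (n%:~R + 2^-1) / m%:R : measurableTypeR R).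
  move=> r; rewrite /cell_boundary/= => h.
  have : circle_pi (m%:R * r) = circle_pi 2^-1.
    by rewrite -h /circle_pi -raddfMn mulr_natl.
  move/circle_pi_eq => /intrP[n ne]; exists n => //.
  by rewrite -ne subrK mulrC mulKf.
have cpre : countable (circle_pi @^-1` cell_boundary).
  apply: sub_countable (subset_card_le pre) _.
  exact: sub_countable (card_image_le _ _) (countableP _).
have mb : measurable cell_boundary.
  change (measurable (setT `&` circle_pi @^-1` cell_boundary : set (measurableTypeR R))).
  rewrite setTI.
  by apply: countable_measurable => // t; exact: measurable_set1.
split => //; rewrite circle_lebE//.
apply/countable_lebesgue_measure0.
exact: sub_countable (subset_card_le (@subIsetl _ _ _)) cpre.
Qed.

Lemma circle_roundN (x : circle R) : ~ cell_boundary x -> q (- x) = - q x.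
Proof.
rewrite -[x]circle_pi_repr -circle_piN !circle_round_pi; move: (repr x) => r.
rewrite /cell_boundary/= => rb; rewrite -circle_piN -mulNr -intrN.
congr (circle_pi (_%:~R / _)).
have /andP[] := floor_itv (m%:R * r + 2^-1).
set n := Num.floor (m%:R * r + 2^-1); rewrite intrD => h1 h2.
(* Off the ties the lower bound of the floor is strict, as the upper bound for the opposite point
   requires. *)
have {}h1 : n%:~R < m%:R * r + 2^-1.
  rewrite lt_neqAle h1 andbT; apply/eqP => e; apply: rb.
  rewrite -raddfMn; apply/circle_pi_eq.
  have -> : r *+ m - 2^-1 = (n - 1)%:~R.
    by rewrite -[r *+ m]mulr_natl intrB e; lra.
  exact: intr_int.
apply: floor_def; rewrite intrD intrN mulrN; apply/andP; split; lra.
Qed.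

(** This is [2 q(x) - x], split so that [circle_round_gridD] applies to the grid points in it. *)
Definition circle_reflect (x : circle R) : circle R := q x + (q x - x).

Lemma circle_reflect_round (x : circle R) : ~ cell_boundary x ->
  q (circle_reflect x) = q x.
Proof.
move=> xb; rewrite /circle_reflect.
have [k kE] := circle_round_grid x; rewrite kE !circle_round_gridD circle_roundN//.
by rewrite kE subrr addr0.
Qed.

(** On the cell of the grid point [g k] the reflection is [rho k], an involution of the whole circle
    that preserves the measure. The mean is split over the cells, [rho k] is moved from [f] to the
    indicator of the cell, and this indicator is invariant under [rho k] off the ties. *)
Lemma circle_leb_reflect (f : circle R -> R) : bounded_measurable f ->
  mean (circle_leb R) (f \o circle_reflect) = mean (circle_leb R) f.
Proof.
move=> bf.
pose cell (k : 'I_m) : set (circle R) := q @^-1` [set g k].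
pose rho (k : 'I_m) (x : circle R) := - x + (g k + g k).
have mcell k : measurable (cell k).
  rewrite -[X in measurable X]setTI; apply: measurable_circle_round => //.
  exact: measurable_circle_set1.
have mrho k : measurable_fun setT (rho k).
  by apply: measurableT_comp (measurable_circle_add _) (@measurable_circle_opp _).
have cell_sum (x : circle R) (F : 'I_m -> R) (k : 'I_m) : q x = g k ->
    \sum_(j < m) F j * \1_(cell j) x = F k.
  move=> xk; rewrite (bigD1 k)//= big1 => [|j jk].
    by rewrite indicE mem_set// mulr1 addr0.
  rewrite indicE memNset ?mulr0// /cell/= xk => /circle_grid_inj e.
  by rewrite e eqxx in jk.
have bc k : bounded_measurable (\1_(cell k) : circle R -> R).
  exact: bounded_measurable_indic.
have bfr k : bounded_measurable (f \o rho k) by exact: bounded_measurable_comp.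
have e1 : mean (circle_leb R) (f \o circle_reflect) =
    mean (circle_leb R) (fun x => \sum_(k < m) f (rho k x) * \1_(cell k) x).
  apply: eq_mean => x /=; have [k xk] := circle_round_ord x.
  rewrite (cell_sum x (fun k => f (rho k x)) k xk); congr f.
  rewrite /circle_reflect /rho xk.
  by rewrite [RHS]addrC addrA.
have e2 : mean (circle_leb R) f =
    mean (circle_leb R) (fun x => \sum_(k < m) f x * \1_(cell k) x).
  apply: eq_mean => x /=; have [k xk] := circle_round_ord x.
  by rewrite (cell_sum x (fun=> f x) k xk).
rewrite e1 e2 mean_sum; last by move=> k; exact: (bounded_measurableM (bfr k) (bc k)).
rewrite mean_sum; last by move=> k; exact: (bounded_measurableM bf (bc k)).
apply: eq_bigr => k _.
have rhoK x : rho k (rho k x) = x.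
  by rewrite /rho opprD opprK addrAC -addrA subrr addr0.
have rhoP h : bounded_measurable h ->
    mean (circle_leb R) (h \o rho k) = mean (circle_leb R) h.
  move=> bh; have bh' : bounded_measurable (h \o (fun x => x + (g k + g k))).
    by apply: bounded_measurable_comp => //; exact: measurable_circle_add.
  rewrite [RHS](mean_pushes (circle_leb_add (g k + g k)) bh).
  by rewrite [RHS](mean_pushes (circle_leb_opp R) bh').
have bcr : bounded_measurable (fun x => \1_(cell k) (rho k x) : R).
  exact: bounded_measurable_comp.
have -> : mean (circle_leb R) (fun x => f (rho k x) * \1_(cell k) x) =
    mean (circle_leb R) (fun x => f x * \1_(cell k) (rho k x)).
  rewrite -[RHS]rhoP; last exact: bounded_measurableM.
  by apply: eq_mean => x /=; rewrite rhoK.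
apply: ae_eq_mean; [exact: bounded_measurableM..|].
have [mb b0] := cell_boundary_null.
exists cell_boundary; split => // x /= xh; apply: contrapT => xb; apply: xh.
congr (_ * _); rewrite !indicE; congr (_%:R).
have -> : (rho k x \in cell k) = (x \in cell k); last by [].
have qr : q (rho k x) = g k + g k - q x.
  by rewrite /rho addrC -addrA !circle_round_gridD circle_roundN// addrA.
apply/idP/idP; rewrite !inE /cell /= qr.
- by move/(canRL (subrK _))/addrI.
- by move=> ->; rewrite addrK.
Qed.

End circle_grid.

(** * Means over the torus, one coordinate at a time *)

Definition torus_map (R : realType) (d : nat) (s : circle R -> circle R)
    (x : torus R d) : torus R d := [tuple of map s x].

Lemma measurable_torus_map (R : realType) (d : nat) (s : circle R -> circle R) :
  measurable_fun setT s -> measurable_fun setT (@torus_map R d s).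
Proof.
move=> ms; apply/measurable_fun_tnthP => i.
rewrite [X in measurable_fun _ X](_ : _ = s \o (fun x : torus R d => tnth x i)).
  by apply: measurableT_comp => //; exact: measurable_tnth.
by apply/funext => x /=; rewrite tnth_map.
Qed.

Section torus_leb_theory.
Context (R : realType).

Lemma mean_torus_leb_cons (d : nat) (f : torus R d.+1 -> R) :
  bounded_measurable f ->
  mean (torus_leb R d.+1) f = mean (circle_leb R) (fun a =>
    mean (torus_leb R d) (fun x => f (torus_cons (a, x)))).
Proof.
move=> bf; rewrite [LHS]mean_distribution// mean_product12//.
by apply: bounded_measurable_comp => //; exact: measurable_torus_cons.
Qed.

Lemma bounded_measurable_torus_cons (d : nat) (f : torus R d.+1 -> R) :
  bounded_measurable f ->
  bounded_measurable (fun z : circle R * torus R d => f (torus_cons z)).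
Proof.
by move=> bf; apply: (bounded_measurable_comp bf); exact: measurable_torus_cons.
Qed.

Lemma mean_torus_leb_map (d : nat) (s : circle R -> circle R)
    (f : torus R d -> R) : measurable_fun setT s ->
  (forall h, bounded_measurable h ->
    mean (circle_leb R) (h \o s) = mean (circle_leb R) h) ->
  bounded_measurable f ->
  mean (torus_leb R d) (f \o torus_map s) = mean (torus_leb R d) f.
Proof.
move=> ms hs; elim: d f => [|d IH] f bf.
  by apply: eq_mean => x /=; congr f; rewrite tuple0 [RHS]tuple0.
have bfs : bounded_measurable (f \o torus_map s).
  by apply: bounded_measurable_comp bf _; exact: measurable_torus_map.
have bc := bounded_measurable_torus_cons bf.
rewrite !mean_torus_leb_cons//.
rewrite -[RHS](hs (fun a => mean _ (fun x => f (torus_cons (a, x))))); last first.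
  exact: (bounded_measurable_mean2 (circle_leb R) (torus_leb R d) bc).
apply: eq_mean => a /=.
rewrite -[RHS]IH; last exact: (bounded_measurable_pair2 (s a) bc).
by apply: eq_mean => x /=; congr f; apply: val_inj.
Qed.

Lemma mean_torus_leb_tnth (d : nat) (i : 'I_d) (g : circle R -> R) :
  bounded_measurable g ->
  mean (torus_leb R d) (fun x => g (tnth x i)) = mean (circle_leb R) g.
Proof.
move=> bg; elim: d i => [[]//|d IH] i.
rewrite mean_torus_leb_cons; last first.
  by apply: (bounded_measurable_comp bg); exact: measurable_tnth.
have [j ->|->] /= := unliftP ord0 i; last first.
  apply: eq_mean => a; rewrite -[RHS](mean_cst (torus_leb R d)).
  by apply: eq_mean => x; rewrite /torus_cons tnth0.
rewrite -[RHS](mean_cst (circle_leb R)); apply: eq_mean => a.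
rewrite -(IH j); apply: eq_mean => x.
by rewrite /torus_cons tnthS.
Qed.

(** Union bound: [f] and [f'] differ by at most [B] times the sum over the coordinates of the
    indicator of [b], and each term has mean zero. *)
Lemma mean_torus_leb_null (d : nat) (b : set (circle R)) (f f' : torus R d -> R) :
  measurable b -> circle_leb R b = 0%E ->
  bounded_measurable f -> bounded_measurable f' ->
  (forall x, (forall i, ~ b (tnth x i)) -> f x = f' x) ->
  mean (torus_leb R d) f = mean (torus_leb R d) f'.
Proof.
move=> mb b0 bf bf' ff'.
have bd := bounded_measurableB bf bf'; have bn := bounded_measurable_norm bd.
have [_ [B fB]] := bd.
have bb : bounded_measurable (\1_b : circle R -> R).
  exact: bounded_measurable_indic.
have bt i : bounded_measurable (fun x : torus R d => \1_b (tnth x i) : R).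
  by apply: (bounded_measurable_comp bb); exact: measurable_tnth.
have bs : bounded_measurable (fun x : torus R d => \sum_(i < d) (\1_b (tnth x i) : R)).
  exact: bounded_measurable_sum.
have bBs : bounded_measurable
    (fun x : torus R d => B * \sum_(i < d) (\1_b (tnth x i) : R)).
  by apply: bounded_measurableM => //; exact: bounded_measurable_cst.
suff : `|mean (torus_leb R d) f - mean (torus_leb R d) f'| <= 0.
  by rewrite normr_le0 subr_eq0 => /eqP.
rewrite -meanB// (le_trans (le_norm_mean _ bd))//.
rewrite (le_trans (le_mean _ bn bBs _))//.
  move=> x; have [h|] := pselect (forall i, ~ b (tnth x i)).
    rewrite ff'// subrr normr0 mulr_ge0 ?sumr_ge0//.
    exact: le_trans (normr_ge0 _) (fB x).
  move/existsNP => [i /contrapT bi]; rewrite (bigD1 i)//= indicE mem_set// mulrDr.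
  rewrite mulr1 (le_trans (fB x))// lerDl mulr_ge0 ?sumr_ge0//.
  exact: le_trans (normr_ge0 _) (fB x).
rewrite meanZ// mean_sum// big1 ?mulr0// => i _.
by rewrite mean_torus_leb_tnth//; apply: EFin_inj; rewrite mean_indic.
Qed.

End torus_leb_theory.

(** [repr] is an arbitrary choice, but its fractional part [r] does not depend on the choice and is
    measurable; it lifts the subtraction to the real line. *)
Lemma measurable_circle_norm_sub d (T : measurableType d) (R : realType)
    (f g : T -> circle R) : measurable_fun setT f -> measurable_fun setT g ->
  measurable_fun setT (fun x => circle_norm (f x - g x)).
Proof.
move=> mf mg; pose r (x : circle R) : R := repr x - (Num.floor (repr x : R))%:~R.
have piB (x : R) : circle_pi (x - (Num.floor x)%:~R) = circle_pi x.
  by rewrite circle_piB circle_pi_int subr0.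
have rK x : circle_pi (r x) = x by rewrite piB circle_pi_repr.
have mr : measurable_fun setT r.
  apply: measurable_circle.
  rewrite (_ : r \o _ = fun x : R => x - (Num.floor x)%:~R).
    apply: measurable_funB => //; apply: nondecreasing_measurable => // x y xy.
    by rewrite ler_int le_floor.
  apply/funext => x /=; rewrite /r.
  have : repr (circle_pi x) - x \is a Num.int.
    by apply/circle_pi_eq; rewrite circle_pi_repr.
  move=> /intrP[k]; move/eqP; rewrite subr_eq => /eqP ->.
  by rewrite floorDzr ?intr_int// intrKfloor intrD; ring.
have mpi : measurable_fun setT (fun x : R => circle_norm (circle_pi x)).
  exact: measurableT_comp (@measurable_circle_norm R) (@measurable_circle_pi R).
rewrite (_ : (fun x => _) = fun x => circle_norm (circle_pi (r (f x) - r (g x)))).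
  apply: (measurableT_comp mpi); apply: measurable_funB.
    exact: measurableT_comp mr mf.
  exact: measurableT_comp mr mg.
by apply/funext => x; rewrite circle_piB !rK.
Qed.

(** * The squared distance of the torus, coordinate by coordinate *)

Definition torus_l1 (R : realType) (d : nat) (x y : torus R d) : R :=
  \sum_(i < d) circle_norm (tnth x i - tnth y i).

Definition torus_cost (R : realType) (d : nat) (z : torus R d * torus R d) : R :=
  torus_dist z.2 z.1 ^+ 2.

Section torus_cost_theory.
Context (R : realType) (d : nat).
Implicit Types (x y : torus R d) (z : torus R d * torus R d).

(** A representative of least norm competes with the vector whose coordinates are all of least size,
    and each of its own coordinates is at least that large. *)
Lemma torus_dist_sqr x y :
  torus_dist x y ^+ 2 = \sum_(i < d) circle_norm (tnth x i - tnth y i) ^+ 2.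
Proof.
have normE (w : 'rV[R]_d) : eucl_norm w ^+ 2 = \sum_(i < d) w ord0 i ^+ 2.
  by rewrite sqr_sqrtr// sumr_ge0// => i _; exact: sqr_ge0.
have [zw wmin] := min_representativeP (torus_sub x y).
rewrite /torus_dist; set w := min_representative _ in zw wmin *.
have wi i : circle_pi (w ord0 i) = tnth x i - tnth y i.
  by rewrite zw tnth_mktuple.
have /choice[r hr] i : exists r : R, circle_pi r = tnth x i - tnth y i /\
    circle_norm (tnth x i - tnth y i) = `|r|.
  by have [r ? [? _]] := circle_norm_exists (tnth x i - tnth y i); exists r.
apply/eqP; rewrite eq_le; apply/andP; split.
  have -> : \sum_(i < d) circle_norm (tnth x i - tnth y i) ^+ 2
      = eucl_norm (\row_i r i) ^+ 2.
    rewrite normE; apply: eq_bigr => i _; have [_ ->] := hr i.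
    by rewrite mxE real_normK// num_real.
  rewrite ler_sqr ?nnegrE ?sqrtr_ge0//; apply: wmin => i.
  by rewrite mxE tnth_mktuple; have [] := hr i.
rewrite normE; apply: ler_sum => i _.
rewrite -[leRHS]real_normK ?num_real// ler_sqr ?nnegrE ?circle_norm_ge0//.
by rewrite -wi circle_norm_pi_le.
Qed.

Lemma torus_l1_ge0 x y : 0 <= torus_l1 x y.
Proof. by apply: sumr_ge0 => i _; exact: circle_norm_ge0. Qed.

Lemma torus_l1_triangle x y t : torus_l1 x t <= torus_l1 x y + torus_l1 y t.
Proof.
rewrite -big_split; apply: ler_sum => i _ /=.
by rewrite (le_trans _ (circle_normD _ _))// addrA subrK.
Qed.

Lemma torus_dist_le_l1 x y : torus_dist x y <= torus_l1 x y.
Proof.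
rewrite -ler_sqr ?nnegrE ?torus_l1_ge0 ?sqrtr_ge0// torus_dist_sqr expr2.
rewrite mulr_suml; apply: ler_sum => i _.
rewrite expr2 ler_wpM2l ?circle_norm_ge0// /torus_l1 (bigD1 i)//= lerDl.
by apply: sumr_ge0 => j _; exact: circle_norm_ge0.
Qed.

Lemma torus_costE z :
  torus_cost z = \sum_(i < d) circle_norm (tnth z.2 i - tnth z.1 i) ^+ 2.
Proof. exact: torus_dist_sqr. Qed.

Lemma torus_cost_ge0 z : 0 <= torus_cost z.
Proof. exact: sqr_ge0. Qed.

Lemma torus_cost_le z : torus_cost z <= d%:R.
Proof.
rewrite torus_costE -[X in _ <= X%:R](card_ord d) -sumr_const.
apply: ler_sum => i _.
have := circle_norm_ge0 (tnth z.2 i - tnth z.1 i).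
by have := circle_norm_le_half (tnth z.2 i - tnth z.1 i); nra.
Qed.

Lemma torus_cost_lip z z' : `|torus_cost z - torus_cost z'|
  <= torus_l1 z.1 z'.1 + torus_l1 z.2 z'.2.
Proof.
rewrite !torus_costE -sumrB (le_trans (ler_norm_sum _ _ _))//.
rewrite addrC -big_split; apply: ler_sum => i _ /=.
rewrite (le_trans (circle_norm_sqr_lip _ _))//.
rewrite -[circle_norm (tnth z.1 i - _)]circle_normN.
rewrite (le_trans _ (circle_normD _ _))// le_eqVlt; apply/orP; left.
by apply/eqP; congr circle_norm; rewrite !opprB addrACA [RHS]addrACA [X in _ + X]addrC.
Qed.

Lemma bounded_measurable_torus_cost : bounded_measurable (@torus_cost R d).
Proof.
split; last first.
  exists d%:R => z; rewrite ger0_norm ?torus_cost_ge0//; exact: torus_cost_le.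
rewrite (_ : @torus_cost R d = fun z =>
  \sum_(i < d) circle_norm (tnth z.2 i - tnth z.1 i) ^+ 2); last first.
  by apply/funext => z; rewrite torus_costE.
apply: measurable_sum => i; apply: measurable_funX.
have mtnth := @measurable_tnth _ (circle R) d i.
exact: (measurable_circle_norm_sub (measurableT_comp mtnth measurable_snd)
  (measurableT_comp mtnth measurable_fst)).
Qed.

End torus_cost_theory.

(** * The discretization error of a slowly varying density *)

Lemma mean_product_map d1 d2 (T1 : measurableType d1) (T2 : measurableType d2)
    (R : realType) (P : probability T1 R) (Q : probability T2 R)
    (S1 : T1 -> T1) (S2 : T2 -> T2) (f : T1 * T2 -> R) :
  measurable_fun setT S1 -> measurable_fun setT S2 ->
  (forall g, bounded_measurable g -> mean P (g \o S1) = mean P g) ->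
  (forall g, bounded_measurable g -> mean Q (g \o S2) = mean Q g) ->
  bounded_measurable f ->
  mean (P \x Q)%E (fun z => f (S1 z.1, S2 z.2)) = mean (P \x Q)%E f.
Proof.
move=> mS1 mS2 PS1 QS2 bf; rewrite !mean_product12//; last first.
  apply: (bounded_measurable_comp bf); apply: measurable_fun_pair.
    by apply: measurableT_comp => //; exact: measurable_fst.
  by apply: measurableT_comp => //; exact: measurable_snd.
rewrite -[RHS](PS1 (fun x => mean Q (fun y => f (x, y)))); last first.
  exact: (bounded_measurable_mean2 P Q bf).
apply: eq_mean => x /=; rewrite -[RHS]QS2//.
exact: (bounded_measurable_pair2 _ bf).
Qed.

(** * Mass of a neighbourhood of the cut locus *)

Section antidiagonal_strip.
Context (R : realType) (d : nat).
Implicit Types (x y : torus R d).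
Local Notation leb2 := (torus_leb R d \x torus_leb R d)%E.

(* The cut locus of the cost in the [i]-th coordinate, thickened by [r]. *)
Definition strip (i : 'I_d) (r : R) : set (torus R d * torus R d) :=
  [set z | 2^-1 - r < circle_norm (tnth z.2 i - tnth z.1 i)].

Lemma measurable_strip i r : measurable (strip i r).
Proof.
have mtnth := @measurable_tnth _ (circle R) d i.
have mf := measurable_circle_norm_sub
  (measurableT_comp mtnth (@measurable_snd _ _ (torus R d) (torus R d)))
  (measurableT_comp mtnth (@measurable_fst _ _ (torus R d) (torus R d))).
have := mf measurableT `]2^-1 - r, +oo[%classic (measurable_itv _).
rewrite setTI; congr (measurable _); apply/seteqP; split => z /=.
  by rewrite in_itv/= andbT.
by rewrite in_itv/= andbT.
Qed.

(** Turns membership of the strip into closeness to a single point, the antipode of the origin, so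
    that the triangle inequality can separate translates. *)
Lemma circle_norm_antipode (x : circle R) :
  circle_norm (x - circle_pi 2^-1) <= 2^-1 - circle_norm x.
Proof.
have [r <- [-> r2]] := circle_norm_exists x.
have [r0|r0] := leP 0 r.
  rewrite -circle_piB (le_trans (circle_norm_pi_le _))//.
  by move: r2; rewrite (ger0_norm r0) => r2; rewrite ler0_norm; lra.
have -> : circle_pi r - circle_pi 2^-1 = circle_pi (r + 2^-1).
  rewrite -circle_piB; apply/circle_pi_eq.
  have -> : r - 2^-1 - (r + 2^-1) = (-1)%:~R by rewrite intrN; lra.
  exact: intr_int.
rewrite (le_trans (circle_norm_pi_le _))//.
by move: r2; rewrite (ltr0_norm r0) => r2; rewrite ger0_norm; lra.
Qed.

Lemma circle_norm_pi_ge (s r : R) : r <= s -> s <= 1 - r -> 0 <= r ->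
  r <= circle_norm (circle_pi s).
Proof.
move=> rs s1 r0; have [s2|s2] := leP s 2^-1.
  by rewrite circle_norm_pi_small ger0_norm; lra.
have -> : circle_pi s = circle_pi (s - 1).
  apply/circle_pi_eq; have -> : s - (s - 1) = 1%:~R by rewrite subKr.
  exact: intr_int.
by rewrite circle_norm_pi_small ler0_norm; lra.
Qed.

Definition torus_shift (t : R) (x : torus R d) : torus R d :=
  torus_map (fun a => a + circle_pi t) x.

Lemma measurable_torus_shift t : measurable_fun setT (torus_shift t).
Proof. by apply: measurable_torus_map; exact: measurable_circle_add. Qed.

Lemma mean_torus_shift t (f : torus R d -> R) : bounded_measurable f ->
  mean (torus_leb R d) (f \o torus_shift t) = mean (torus_leb R d) f.
Proof.
apply: mean_torus_leb_map; first exact: measurable_circle_add.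
by move=> h bh; exact: esym (mean_pushes (circle_leb_add (circle_pi t)) bh).
Qed.

Lemma torus_l1_shift t x : 0 <= t -> torus_l1 x (torus_shift t x) <= d%:R * t.
Proof.
move=> t0; rewrite -[X in X%:R * _](card_ord d) -sumr_const mulr_suml.
apply: ler_sum => i _; rewrite mul1r tnth_map opprD addrA subrr add0r.
by rewrite circle_normN (le_trans (circle_norm_pi_le _))// ger0_norm.
Qed.

(* [n] translates of the strip by multiples of [2 r] are disjoint as long as
   [n * 2 r <= 1], and a density that varies slowly gives them comparable
   masses. *)
Lemma strip_mass (w : torus R d * torus R d -> R) (i : 'I_d) (r B : R)
    (n : nat) : 0 < r -> bounded_positive w -> mean leb2 w = 1 ->
  n%:R * (2 * r) <= 1 -> 0 <= B ->
  (forall (k : 'I_n) z, w z <= B * w (torus_shift (k%:R * (2 * r)) z.1, z.2)) ->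
  n%:R * mean leb2 (fun z => w z * \1_(strip i r) z) <= B.
Proof.
move=> r0 pw w1 nr B0 hw; have [bw _] := pw.
have w0 z := bounded_positive_gt0 z pw.
pose tau (k : 'I_n) (z : torus R d * torus R d) :=
  (torus_shift (k%:R * (2 * r)) z.1, z.2).
pose S (k : 'I_n) : set (torus R d * torus R d) :=
  [set z | 2^-1 - r < circle_norm
    (tnth z.2 i - tnth z.1 i + circle_pi (k%:R * (2 * r)))].
have mtau t : measurable_fun setT
    (fun z : torus R d * torus R d => (torus_shift t z.1, z.2)).
  apply: measurable_fun_pair; last exact: measurable_snd.
  apply: measurableT_comp; first exact: measurable_torus_shift.
  exact: measurable_fst.
have mS k : measurable (S k).
  have := mtau (- (k%:R * (2 * r))) measurableT _ (measurable_strip i r).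
  rewrite setTI; congr (measurable _); apply/seteqP; split => z /=;
  by rewrite /strip/= tnth_map circle_piN opprB addrA addrAC.
have bS k : bounded_measurable (\1_(S k) : _ -> R).
  exact: bounded_measurable_indic.
have bI : bounded_measurable (\1_(strip i r) : _ -> R).
  by apply: bounded_measurable_indic; exact: measurable_strip.
(* [tau k], which preserves the measure, carries the strip onto [S k] and loses at most the factor
   [B] on the density. *)
have mass k : mean leb2 (fun z => w z * \1_(strip i r) z)
    <= B * mean leb2 (fun z => w z * \1_(S k) z).
  have bwS : bounded_measurable (fun z => w z * \1_(S k) z).
    exact: bounded_measurableM.
  have -> : mean leb2 (fun z => w z * \1_(S k) z)
      = mean leb2 (fun z => w (tau k z) * \1_(S k) (tau k z)).
    symmetry; apply: (@mean_product_map _ _ _ _ R (torus_leb R d)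
      (torus_leb R d) (torus_shift (k%:R * (2 * r))) idfun
      (fun z => w z * \1_(S k) z)) => //.
    - exact: measurable_torus_shift.
    - exact: measurable_id.
    - by move=> g bg; exact: mean_torus_shift.
  have bwt : bounded_measurable (fun z => w (tau k z) * \1_(S k) (tau k z)).
    exact: bounded_measurable_comp bwS (mtau _).
  rewrite -meanZ//; apply: le_mean.
  - exact: bounded_measurableM.
  - by apply: bounded_measurableM => //; exact: bounded_measurable_cst.
  - move=> z; have -> : \1_(S k) (tau k z) = \1_(strip i r) z :> R.
      rewrite !indicE; suff -> : (tau k z \in S k) = (z \in strip i r) by [].
      apply/idP/idP; rewrite !inE /S /strip /tau/=;
      by rewrite tnth_map opprD addrA subrK.
    by rewrite mulrA ler_wpM2r//; exact: hw.
have sumS z : \sum_(k < n) (\1_(S k) z : R) <= 1.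
  have [[k Sk]|noS] := pselect (exists k, S k z); last first.
    rewrite big1// => k _; rewrite indicE memNset// => Sk.
    by apply: noS; exists k.
  rewrite (bigD1 k)//= big1 ?addr0 => [|l lk].
    by rewrite indicE; case: (_ \in _).
  rewrite indicE memNset// => Sl.
  (* Both shifted differences would be within less than [r] of the antipode, yet the two shifts are
     at least [2 * r] apart modulo 1: they differ by at least one multiple of [2 * r] and by at most
     [n - 1] of them. *)
  have far (a b : 'I_n) : (a < b)%N -> S a z -> S b z -> False.
    move=> ab Sa Sb.
    set u := tnth z.2 i - tnth z.1 i in Sa Sb *.
    have h1 := circle_norm_antipode (u + circle_pi (a%:R * (2 * r))).
    have h2 := circle_norm_antipode (u + circle_pi (b%:R * (2 * r))).
    have h3 : 2 * r <= circle_norm (circle_pi ((b%:R - a%:R) * (2 * r))).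
      have ba : 1 <= b%:R - a%:R :> R.
        by have : a%:R + 1 <= b%:R :> R by [rewrite natr1 ler_nat]; lra.
      have bn : b%:R - a%:R <= n%:R - 1 :> R.
        have : b%:R + 1 <= n%:R :> R by rewrite natr1 ler_nat.
        by have : 0 <= a%:R :> R by []; lra.
      apply: circle_norm_pi_ge; nra.
    have := circle_normD (u + circle_pi (b%:R * (2 * r)) - circle_pi 2^-1)
      (- (u + circle_pi (a%:R * (2 * r)) - circle_pi 2^-1)).
    rewrite circle_normN.
    have -> : u + circle_pi (b%:R * (2 * r)) - circle_pi 2^-1
        - (u + circle_pi (a%:R * (2 * r)) - circle_pi 2^-1)
        = circle_pi ((b%:R - a%:R) * (2 * r)).
      rewrite mulrBl circle_piB [u + circle_pi (b%:R * _) - _]addrAC.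
      by rewrite [u + circle_pi (a%:R * _) - _]addrAC opprD addrACA subrr add0r.
    move: Sa Sb; rewrite /S/= -/u; lra.
  by move: lk; rewrite neq_ltn => /orP[] /far; apply.
have -> : n%:R * mean leb2 (fun z => w z * \1_(strip i r) z)
    = \sum_(k < n) mean leb2 (fun z => w z * \1_(strip i r) z).
  by rewrite sumr_const card_ord mulr_natl.
apply: (@le_trans _ _ (\sum_(k < n) B * mean leb2 (fun z => w z * \1_(S k) z))).
  exact: ler_sum.
rewrite -mulr_sumr -[leRHS]mulr1 ler_wpM2l//.
rewrite -mean_sum; last by move=> k; exact: bounded_measurableM.
rewrite -w1; apply: le_mean => //.
  by apply: bounded_measurable_sum => k; exact: bounded_measurableM.
by move=> z; rewrite -mulr_sumr -[leRHS]mulr1 ler_wpM2l// ltW.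
Qed.

End antidiagonal_strip.

Lemma measurable_circle_reflect (R : realType) (m : nat) :
  measurable_fun setT (@circle_reflect R m).
Proof.
apply: measurable_circle.
pose r (x : R) : R := (Num.floor (m%:R * x + 2^-1))%:~R / m%:R.
rewrite (_ : _ \o _ = circle_pi \o (fun x : R => r x + (r x - x))); last first.
  by apply/funext => x /=; rewrite /circle_reflect circle_round_pi circle_piD circle_piB.
have mr : measurable_fun setT r.
  apply: nondecreasing_measurable => // x y xy.
  by rewrite ler_wpM2r ?invr_ge0// ler_int le_floor// lerD2r ler_wpM2l.
apply: measurableT_comp; first exact: measurable_circle_pi.
by apply: measurable_funD => //; exact: measurable_funB.
Qed.

Lemma mean_torus_leb2_null (R : realType) (d : nat) (b : set (circle R))
    (f f' : torus R d * torus R d -> R) :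
  measurable b -> circle_leb R b = 0%E ->
  bounded_measurable f -> bounded_measurable f' ->
  (forall z, (forall i, ~ b (tnth z.1 i)) -> (forall i, ~ b (tnth z.2 i)) ->
    f z = f' z) ->
  mean (torus_leb R d \x torus_leb R d)%E f
  = mean (torus_leb R d \x torus_leb R d)%E f'.
Proof.
move=> mb b0 bf bf' ff'; rewrite !mean_product12//.
apply: (mean_torus_leb_null mb b0).
- exact: (bounded_measurable_mean2 (torus_leb R d) (torus_leb R d) bf).
- exact: (bounded_measurable_mean2 (torus_leb R d) (torus_leb R d) bf').
move=> x xb; apply: (mean_torus_leb_null mb b0).
- exact: (bounded_measurable_pair2 x bf).
- exact: (bounded_measurable_pair2 x bf').
- by move=> y yb; exact: ff'.
Qed.

(** * Symmetrisation of the rounding error over the cells *)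

Section discretization_error.
Context (R : realType) (d m : nat) (C L : R).
Hypotheses (m_gt0 : (0 < m)%N) (L_ge0 : 0 <= L).
Local Notation h := (m%:R^-1 : R).
Hypothesis hL : h * L <= C.
Implicit Types (x y : torus R d) (z : torus R d * torus R d).
Local Notation leb2 := (torus_leb R d \x torus_leb R d)%E.
Local Notation q := (@grid_round R d m).

Let h_gt0 : 0 < h. Proof. by rewrite invr_gt0 ltr0n. Qed.

Let C_ge0 : 0 <= C.
Proof. by apply: le_trans hL; rewrite mulr_ge0// ltW. Qed.

(* Log-Lipschitz up to an error of the order of the grid step, as is the
   composition of a log-Lipschitz function with the rounding. *)
Definition slowly_varying (w : torus R d * torus R d -> R) : Prop :=
  forall z z', w z <= expR (L * (torus_l1 z.1 z'.1 + torus_l1 z.2 z'.2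
                                 + 2 * d%:R * h)) * w z'.

Variable w : torus R d * torus R d -> R.
Hypotheses (pw : bounded_positive w) (mean_w : mean leb2 w = 1)
  (sw : slowly_varying w).

Let w_gt0 z : 0 < w z. Proof. exact: bounded_positive_gt0. Qed.
Let bw : bounded_measurable w. Proof. by case: pw. Qed.

Let torus_l1xx x : torus_l1 x x = 0.
Proof.
rewrite /torus_l1 big1// => i _.
by rewrite subrr -(circle_pi_int _ 0) circle_norm_pi_small normr0// invr_ge0.
Qed.

Lemma strip_mass_le (i : 'I_d) :
  mean leb2 (fun z => w z * \1_(strip i (2 * h)) z)
  <= 8 * h * (L + 1) * expR (d%:R + 2 * d%:R * C).
Proof.
set mass := mean _ _; set B := expR _.
have mS := @measurable_strip R d i (2 * h).
have bI : bounded_measurable (\1_(strip i (2 * h)) : _ -> R).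
  exact: bounded_measurable_indic.
have B1 : 1 <= B.
  by rewrite -expR0 ler_expR addr_ge0// mulr_ge0// mulr_ge0.
have hL0 : 0 < h * (L + 1) by rewrite mulr_gt0// ltr_wpDl.
have mass1 : mass <= 1.
  rewrite -mean_w; apply: le_mean => //; first exact: bounded_measurableM.
  move=> z; apply: ler_piMr; first exact: ltW.
  by rewrite indicE; case: (_ \in _).
(* When there is no room for a single translate, the claimed bound exceeds 1 and the total mass
   suffices. *)
have [big|small] := ltP 1 (4 * (h * (L + 1))).
  rewrite (le_trans mass1)//.
  have : 1 <= 8 * h * (L + 1) by rewrite -mulrA; lra.
  by move=> h8; rewrite -[leLHS]mulr1 ler_pM.
(* With [n] the integer part of [a], all shifts are at most [n * 4 * h <= (L + 1)^-1]. This is at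
   most 1, so the translates are disjoint, and [L] times it is at most 1, so the density changes by
   a bounded factor: the exponent [d] comes from the l1 length of the shift, [2 * d * C] from the
   slack in [slowly_varying]. *)
pose a := (4 * (h * (L + 1)))^-1.
have a1 : 1 <= a by rewrite invf_ge1// mulr_gt0.
have a0 : 0 < a by exact: lt_le_trans a1.
pose n := Num.truncn a; have /andP[na an] := truncn_itv (ltW a0).
have n1 : 1 <= n%:R :> R.
  rewrite -[1]/(1%:R) ler_nat -(truncn1 R); exact: le_truncn.
have aE : a * (4 * (h * (L + 1))) = 1 by rewrite mulVf// gt_eqF// mulr_gt0.
have nL : n%:R * (2 * (2 * h)) * (L + 1) <= 1.
  have -> : n%:R * (2 * (2 * h)) * (L + 1) = n%:R * (4 * (h * (L + 1))).
    by ring.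
  by rewrite -[leRHS]aE ler_wpM2r// mulr_ge0// ltW.
have n4 : 0 <= n%:R * (2 * (2 * h)).
  by rewrite mulr_ge0// mulr_ge0// mulr_ge0// ltW.
have hn : n%:R * mass <= B.
  apply: strip_mass pw mean_w _ (le_trans ler01 B1) _.
  - by rewrite mulr_gt0.
  - by apply: le_trans nL; rewrite ler_peMr// lerDr.
  - move=> k z.
    apply: (le_trans (sw z (torus_shift (k%:R * (2 * (2 * h))) z.1, z.2))).
    apply: ler_wpM2r; first exact: ltW.
    rewrite ler_expR /= torus_l1xx addr0.
    have t0 : 0 <= k%:R * (2 * (2 * h)) by rewrite mulr_ge0// mulr_ge0// mulr_ge0// ltW.
    have kn : k%:R * (2 * (2 * h)) <= n%:R * (2 * (2 * h)).
      by rewrite ler_wpM2r ?ler_nat 1?ltnW// mulr_ge0// mulr_ge0// ltW.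
    have l1 := torus_l1_shift z.1 t0.
    have Lt : L * (k%:R * (2 * (2 * h))) <= 1.
      rewrite (le_trans (ler_wpM2l L_ge0 kn))// mulrC.
      by apply: le_trans nL; rewrite ler_wpM2l// lerDl.
    have d0 : 0 <= d%:R :> R by [].
    have e1 : L * torus_l1 z.1 (torus_shift (k%:R * (2 * (2 * h))) z.1)
        <= d%:R.
      rewrite (le_trans (ler_wpM2l L_ge0 l1))//.
      by rewrite mulrCA -[leRHS]mulr1 ler_wpM2l.
    have e2 : L * (2 * d%:R * h) <= 2 * d%:R * C.
      have -> : L * (2 * d%:R * h) = 2 * d%:R * (h * L) by ring.
      by rewrite ler_wpM2l// mulr_ge0.
    by rewrite mulrDr lerD.
(* Replacing [a] by its integer part costs a factor 2, which turns the 4 of [a] into the 8 of the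
   bound. *)
have n2 : a <= 2 * n%:R by move: an; rewrite -natr1; lra.
have mass0 : 0 <= mass.
  apply: mean_ge_cst; first exact: bounded_measurableM.
  by move=> z; apply: mulr_ge0 => //; exact: ltW.
have h2 : a * mass <= 2 * B.
  by have := ler_wpM2r mass0 n2; nra.
have : 4 * (h * (L + 1)) * (a * mass) <= 4 * (h * (L + 1)) * (2 * B).
  by rewrite ler_wpM2l// mulr_ge0// ltW.
have -> : 4 * (h * (L + 1)) * (a * mass) = a * (4 * (h * (L + 1))) * mass by ring.
have -> : 4 * (h * (L + 1)) * (2 * B) = 8 * h * (L + 1) * B by ring.
by rewrite aE mul1r.
Qed.

Let cost := @torus_cost R d.
Let sigma := torus_map (circle_reflect m) : torus R d -> torus R d.
Let Q z := (q z.1, q z.2).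
Let S z := (sigma z.1, sigma z.2).

Let mQ : measurable_fun setT Q.
Proof.
apply: measurable_fun_pair.
  by apply: measurableT_comp measurable_fst; exact: measurable_grid_round.
by apply: measurableT_comp measurable_snd; exact: measurable_grid_round.
Qed.

Let mS : measurable_fun setT S.
Proof.
have ms : measurable_fun setT sigma.
  by apply: measurable_torus_map; exact: measurable_circle_reflect.
apply: measurable_fun_pair.
  exact: (measurableT_comp ms measurable_fst).
exact: (measurableT_comp ms measurable_snd).
Qed.

Let mean_S f : bounded_measurable f -> mean leb2 (f \o S) = mean leb2 f.
Proof.
have ms : measurable_fun setT sigma.
  by apply: measurable_torus_map; exact: measurable_circle_reflect.
have hs g : bounded_measurable g ->
    mean (torus_leb R d) (g \o sigma) = mean (torus_leb R d) g.
  apply: mean_torus_leb_map; first exact: measurable_circle_reflect.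
  exact: circle_leb_reflect.
exact: (mean_product_map ms ms hs hs).
Qed.

Let bcost : bounded_measurable cost.
Proof. exact: bounded_measurable_torus_cost. Qed.

Let QS z : (forall i, ~ cell_boundary m (tnth z.1 i)) ->
  (forall i, ~ cell_boundary m (tnth z.2 i)) -> Q (S z) = Q z.
Proof.
have e x : (forall i, ~ cell_boundary m (tnth x i)) -> q (sigma x) = q x.
  move=> xb; apply: eq_from_tnth => i.
  by rewrite !tnth_mktuple tnth_map circle_reflect_round.
by move=> h1 h2; rewrite /Q /S /= !e.
Qed.

Let half_cell x i : circle_norm (tnth x i - tnth (q x) i) <= h / 2.
Proof. by rewrite tnth_mktuple; exact: circle_norm_round. Qed.

(* The displacements of two points from the centers of their cells differ by
   at most [h]. *)
Let offset z (i : 'I_d) : circle R :=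
  (tnth z.2 i - tnth (q z.2) i) - (tnth z.1 i - tnth (q z.1) i).

Let offset_le z i : circle_norm (offset z i) <= h.
Proof.
rewrite (le_trans (circle_normD _ _))// circle_normN.
by have := half_cell z.1 i; have := half_cell z.2 i; lra.
Qed.

Let diffE z i : tnth z.2 i - tnth z.1 i
  = (tnth (q z.2) i - tnth (q z.1) i) + offset z i.
Proof.
rewrite /offset; move: (tnth (q z.1) i) (tnth (q z.2) i) => qa qb.
rewrite -[tnth z.1 i]circle_pi_repr -[tnth z.2 i]circle_pi_repr.
rewrite -[qa]circle_pi_repr -[qb]circle_pi_repr.
by rewrite -!circle_piB -circle_piD; congr circle_pi; ring.
Qed.

Let diffSE z i : tnth (S z).2 i - tnth (S z).1 i
  = (tnth (q z.2) i - tnth (q z.1) i) - offset z i.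
Proof.
rewrite /S/= [tnth (sigma z.1) i]tnth_map [tnth (sigma z.2) i]tnth_map.
rewrite /circle_reflect.
have -> : circle_round m (tnth z.1 i) = tnth (q z.1) i by rewrite tnth_mktuple.
have -> : circle_round m (tnth z.2 i) = tnth (q z.2) i by rewrite tnth_mktuple.
rewrite /offset; move: (tnth (q z.1) i) (tnth (q z.2) i) => qa qb.
rewrite -[tnth z.1 i]circle_pi_repr -[tnth z.2 i]circle_pi_repr.
rewrite -[qa]circle_pi_repr -[qb]circle_pi_repr.
by rewrite -!circle_piB -!circle_piD -!circle_piB; congr circle_pi; ring.
Qed.

Let second_diff z := cost z + cost (S z) - 2 * cost (Q z).

Let second_diffE z : second_diff z = \sum_(i < d)
  (circle_norm (tnth (q z.2) i - tnth (q z.1) i + offset z i) ^+ 2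
   + circle_norm (tnth (q z.2) i - tnth (q z.1) i - offset z i) ^+ 2
   - 2 * circle_norm (tnth (q z.2) i - tnth (q z.1) i) ^+ 2).
Proof.
rewrite sumrB big_split/= -mulr_sumr /second_diff /cost !torus_costE.
congr (_ + _ - _); apply: eq_bigr => i _; first by rewrite diffE.
by rewrite diffSE.
Qed.

Let second_diff_le z : second_diff z <= 2 * d%:R * h ^+ 2.
Proof.
rewrite second_diffE mulrAC -[X in _ * X%:R](card_ord d) -sumr_const mulr_sumr.
apply: ler_sum => i _; rewrite mulr1.
exact: circle_norm_sqr_semiconcave.
Qed.

(** Off the strip a coordinate difference has norm at most [1/2 - 2 * h]. Rounding moves it by at
    most [h], and semiconvexity at the rounded point needs another [h] of room below 1/2; hence the
    width. *)
Let second_diff_ge z :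
  - (2 * h) * \sum_(i < d) \1_(strip i (2 * h)) z <= second_diff z.
Proof.
rewrite second_diffE mulr_sumr; apply: ler_sum => i _; rewrite indicE.
have oh := offset_le z i.
have [Sz|Sz] := boolP (z \in strip i (2 * h)).
  by rewrite mulr1; exact: circle_norm_sqr_second_diff_ge.
rewrite mulr0; apply: (circle_norm_sqr_semiconvex oh).
move: Sz; rewrite notin_setE /strip/= => /negP; rewrite -leNgt diffE => Sz.
set a := _ - _ in Sz *; have := circle_norm_le_sub a (a + offset z i).
have -> : a - (a + offset z i) = - offset z i.
  by rewrite opprD addrA subrr add0r.
by rewrite circle_normN; have := offset_le z i; lra.
Qed.

Let l1_half x : torus_l1 (q x) (sigma x) <= d%:R * (h / 2).
Proof.
rewrite -[X in X%:R * _](card_ord d) -sumr_const mulr_suml.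
apply: ler_sum => i _; rewrite mul1r [tnth (sigma x) i]tnth_map /circle_reflect.
have -> : circle_round m (tnth x i) = tnth (q x) i by rewrite tnth_mktuple.
by rewrite opprD addrA subrr add0r opprB half_cell.
Qed.

Let l1_half' x : torus_l1 x (q x) <= d%:R * (h / 2).
Proof.
rewrite -[X in X%:R * _](card_ord d) -sumr_const mulr_suml.
by apply: ler_sum => i _; rewrite mul1r half_cell.
Qed.

Let cost_diff_le z : `|cost (S z) - cost (Q z)| <= d%:R * h.
Proof.
rewrite distrC (le_trans (torus_cost_lip _ _))//.
by have := l1_half z.1; have := l1_half z.2; rewrite /S /Q/=; lra.
Qed.

(** The reflection moves each of the two points by at most [d * h] in the l1 distance, and the slack
    in [slowly_varying] adds [2 * d * h]. *)
Let e := 4 * d%:R * (h * L).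

Let wS_le z : w (S z) <= expR e * w z /\ w z <= expR e * w (S z).
Proof.
have l1S x : torus_l1 x (sigma x) <= d%:R * h.
  rewrite (le_trans (torus_l1_triangle _ (q x) _))//.
  by have := l1_half x; have := l1_half' x; lra.
have l1C x y : torus_l1 x y = torus_l1 y x.
  by apply: eq_bigr => i _; rewrite circle_norm_sub.
have D0 : torus_l1 z.1 (S z).1 + torus_l1 z.2 (S z).2 + 2 * d%:R * h
    <= 4 * d%:R * h.
  by have := l1S z.1; have := l1S z.2; rewrite /S/=; lra.
have eE : e = L * (4 * d%:R * h) by rewrite /e; ring.
split.
  apply: (le_trans (sw (S z) z)); apply: ler_wpM2r; first exact: ltW.
  by rewrite ler_expR eE ler_wpM2l// [torus_l1 (S z).1 _]l1C [torus_l1 (S z).2 _]l1C.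
apply: (le_trans (sw z (S z))); apply: ler_wpM2r; first exact: ltW.
by rewrite ler_expR eE ler_wpM2l.
Qed.

(** [expR e - 1 <= e * expR e] keeps one factor [e], of order [h * L]; the other factor is bounded
    because [h * L <= C]. *)
Let wS_diff z : `|w (S z) - w z| <= e * expR (4 * d%:R * C) * w z.
Proof.
have [h1 h2] := wS_le z; have wz := w_gt0 z; have wSz := w_gt0 (S z).
have e0 : 0 <= e by rewrite !mulr_ge0// ltW.
have E0 : 0 < expR e by exact: expR_gt0.
have eC : expR e <= expR (4 * d%:R * C).
  by rewrite ler_expR ler_wpM2l// mulr_ge0.
have h3 : 1 - e <= expR (- e) by exact: expR_ge1Dx.
have h4 : expR (- e) * expR e = 1 by rewrite -expRD addNr expR0.
have h5 : expR e - 1 <= e * expR e by nra.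
have h6 : e * expR e <= e * expR (4 * d%:R * C) by rewrite ler_wpM2l.
have E1 : 1 <= expR e by rewrite -expR0 ler_expR.
have h7 : (expR e - 1) * w z <= e * expR (4 * d%:R * C) * w z.
  by rewrite ler_wpM2r ?(ltW wz)//; lra.
have h8 : expR e * w (S z) - w (S z) <= (expR e - 1) * (expR e * w z).
  by nra.
have h9 : w z - w (S z) <= (expR e - 1) * w z.
  have : expR e * (w z - w (S z)) <= expR e * ((expR e - 1) * w z) by nra.
  by rewrite ler_pM2l.
rewrite ler_norml; apply/andP; split; lra.
Qed.

(** The three terms of the constant are, in order, half of: the upper bound on the second
    difference, the product of the variations of cost and density, and the loss [2 * h] on each of
    the [d] strips times its mass. *)
Lemma discretization_error :
  `|mean leb2 (fun z => (torus_cost z - torus_cost (q z.1, q z.2)) * w z)|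
  <= (d%:R + 2 * d%:R ^+ 2 * expR (4 * d%:R * C)
      + 8 * d%:R * expR (d%:R + 2 * d%:R * C)) * (h ^+ 2 * (L + 1)).
Proof.
have bQ (f : torus R d * torus R d -> R) : bounded_measurable f -> bounded_measurable (f \o Q).
  by move=> bf; exact: bounded_measurable_comp.
have bS (f : torus R d * torus R d -> R) : bounded_measurable f -> bounded_measurable (f \o S).
  by move=> bf; exact: bounded_measurable_comp.
have bcQ := bQ _ bcost; have bcS := bS _ bcost; have bwS := bS _ bw.
have sym : 2 * mean leb2 (fun z => (cost z - cost (Q z)) * w z)
    = mean leb2 (fun z => second_diff z * w z)
      + mean leb2 (fun z => (cost (S z) - cost (Q z)) * (w (S z) - w z)).
  have [mb b0] := @cell_boundary_null R m m_gt0.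
  have i1 : mean leb2 (fun z => cost (S z) * w (S z))
      = mean leb2 (fun z => cost z * w z).
    by rewrite -(mean_S (bounded_measurableM bcost bw)).
  have i2 : mean leb2 (fun z => cost (Q z) * w (S z))
      = mean leb2 (fun z => cost (Q z) * w z).
    rewrite -(mean_S (bounded_measurableM bcQ bw)).
    apply: (mean_torus_leb2_null mb b0).
    - exact: (bounded_measurableM bcQ bwS).
    - exact: (bS _ (bounded_measurableM bcQ bw)).
    - by move=> z h1 h2 /=; rewrite QS.
  have b1 := bounded_measurableM bcost bw.
  have b2 := bounded_measurableM bcQ bw.
  have b3 := bounded_measurableM bcS bwS.
  have b4 := bounded_measurableM bcQ bwS.
  have b5 := bounded_measurableB b1 b2.
  have b6 := bounded_measurableB b3 b4.
  have bsd : bounded_measurable second_diff.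
    apply: bounded_measurableB; first exact: bounded_measurableD.
    by apply: bounded_measurableM => //; exact: bounded_measurable_cst.
  rewrite -meanD; last 2 first.
  - exact: bounded_measurableM.
  - by apply: bounded_measurableM; exact: bounded_measurableB.
  (* The right-hand side regroups into the quantity to be bounded and its analogue at the reflected
     point; by [i1] and [i2] both have the same mean. *)
  transitivity (mean leb2 (fun z => (cost z * w z - cost (Q z) * w z)
      + (cost (S z) * w (S z) - cost (Q z) * w (S z)))); last first.
    by apply: eq_mean => z; rewrite /second_diff; ring.
  rewrite (meanD _ b5 b6) (meanB _ b1 b2) (meanB _ b3 b4) i1 i2.
  rewrite (eq_mean _ (fun z => mulrBl (w z) (cost z) (cost (Q z)))).
  by rewrite (meanB _ b1 b2) mulr_natl mulr2n.
have bsd : bounded_measurable second_diff.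
  apply: bounded_measurableB; first exact: bounded_measurableD.
  by apply: bounded_measurableM => //; exact: bounded_measurable_cst.
have bsdw := bounded_measurableM bsd bw.
have bst i : bounded_measurable (fun z => w z * \1_(strip i (2 * h)) z).
  apply: bounded_measurableM => //; apply: bounded_measurable_indic.
  exact: measurable_strip.
set B := expR (d%:R + _); set E := expR (4 * d%:R * C).
have mean_wZ c : c = mean leb2 (fun z => c * w z).
  by rewrite meanZ// mean_w mulr1.
have up : mean leb2 (fun z => second_diff z * w z) <= 2 * d%:R * h ^+ 2.
  rewrite [leRHS]mean_wZ; apply: le_mean => //.
    by apply: bounded_measurableM => //; exact: bounded_measurable_cst.
  by move=> z; apply: ler_wpM2r; [exact: ltW | exact: second_diff_le].
have lo : - (2 * h) * (d%:R * (8 * h * (L + 1) * B))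
    <= mean leb2 (fun z => second_diff z * w z).
  apply: (@le_trans _ _ (- (2 * h) *
    \sum_(i < d) mean leb2 (fun z => w z * \1_(strip i (2 * h)) z))).
    rewrite !mulNr lerN2 ler_wpM2l ?mulr_ge0 ?(ltW h_gt0)//.
    rewrite -[X in _ <= X%:R * _](card_ord d) -sumr_const mulr_suml.
    by apply: ler_sum => i _; rewrite mul1r; exact: strip_mass_le.
  rewrite -mean_sum// -meanZ; last exact: bounded_measurable_sum.
  apply: le_mean => //.
    apply: bounded_measurableM; first exact: bounded_measurable_cst.
    exact: bounded_measurable_sum.
  move=> z; rewrite -mulr_sumr mulrCA mulrC.
  by apply: ler_wpM2r; [exact: ltW | exact: second_diff_ge].
have mid : `|mean leb2 (fun z => (cost (S z) - cost (Q z)) * (w (S z) - w z))|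
    <= d%:R * h * (e * E).
  have b1 : bounded_measurable
      (fun z => (cost (S z) - cost (Q z)) * (w (S z) - w z)).
    by apply: bounded_measurableM; exact: bounded_measurableB.
  rewrite (le_trans (le_norm_mean _ b1))//.
  rewrite [leRHS]mean_wZ; apply: le_mean.
  - exact: bounded_measurable_norm.
  - by apply: bounded_measurableM => //; exact: bounded_measurable_cst.
  - move=> z; rewrite normrM -[leRHS]mulrA.
    have h1 := cost_diff_le z; have h2 := wS_diff z.
    exact: ler_pM.
have hh : 0 <= h ^+ 2 by rewrite exprn_ge0// ltW.
have hhL : 0 <= h ^+ 2 * L by rewrite mulr_ge0.
have d0 : 0 <= d%:R :> R by [].
have k1 : d%:R * h ^+ 2 <= d%:R * (h ^+ 2 * (L + 1)).
  by rewrite ler_wpM2l// mulrDr mulr1 lerDr.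
have k2 : d%:R * h * (e * E) = 2 * (2 * d%:R ^+ 2 * E * (h ^+ 2 * L)).
  by rewrite /e; ring.
have E0 : 0 <= E by exact: expR_ge0.
have k3 : 2 * d%:R ^+ 2 * E * (h ^+ 2 * L)
    <= 2 * d%:R ^+ 2 * E * (h ^+ 2 * (L + 1)).
  rewrite ler_wpM2l ?mulr_ge0// ?exprn_ge0//.
  by rewrite mulrDr mulr1 lerDl.
have k4 : 0 <= 8 * d%:R * B * (h ^+ 2 * (L + 1)).
  by rewrite !mulr_ge0 ?expR_ge0// ?addr_ge0.
have k5 : - (2 * h) * (d%:R * (8 * h * (L + 1) * B))
    = - (2 * (8 * d%:R * B * (h ^+ 2 * (L + 1)))) by ring.
have k6 : 0 <= 2 * d%:R ^+ 2 * E * (h ^+ 2 * (L + 1)).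
  by rewrite !mulr_ge0// ?exprn_ge0// ?addr_ge0.
have k7 : 0 <= d%:R * (h ^+ 2 * (L + 1)) by rewrite !mulr_ge0// ?addr_ge0.
move: mid; rewrite k2 !ler_norml; rewrite k5 in lo.
move: sym; rewrite /cost /Q => sym; rewrite !mulrDl.
by move=> /andP[m1 m2]; apply/andP; split; lra.
Qed.

End discretization_error.

(** * Entropic transport *)

Lemma coupling_fst d1 d2 (T1 : measurableType d1) (T2 : measurableType d2)
    (R : realType) (mu : probability T1 R) (nu : probability T2 R)
    (gamma : probability (T1 * T2)%type R) :
  couplings mu nu gamma -> pushes fst gamma mu.
Proof.
move=> [g1 _]; split; first exact: measurable_fst.
move=> A mA; rewrite -(g1 A mA); congr (gamma _).
by apply/seteqP; split => z //= [].
Qed.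

Lemma coupling_snd d1 d2 (T1 : measurableType d1) (T2 : measurableType d2)
    (R : realType) (mu : probability T1 R) (nu : probability T2 R)
    (gamma : probability (T1 * T2)%type R) :
  couplings mu nu gamma -> pushes snd gamma nu.
Proof.
move=> [_ g2]; split; first exact: measurable_snd.
move=> A mA; rewrite -(g2 A mA); congr (gamma _).
by apply/seteqP; split => z //= [].
Qed.

Lemma pushes_id d (T : measurableType d) (R : realType) (P : probability T R) :
  pushes idfun P P.
Proof. by split; first exact: measurable_id. Qed.

Lemma has_density_coupling d1 d2 (T1 : measurableType d1)
    (T2 : measurableType d2) (R : realType) (mu : probability T1 R)
    (nu : probability T2 R) (gamma : probability (T1 * T2)%type R)
    (r : T1 * T2 -> R) :
  has_density gamma (mu \x nu)%E r ->
  (forall x, mean nu (fun y => r (x, y)) = 1) ->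
  (forall y, mean mu (fun x => r (x, y)) = 1) -> couplings mu nu gamma.
Proof.
move=> dr r1 r2; have [[br _] _] := dr; split=> A mA.
  have bA : bounded_measurable (\1_A : T1 -> R) by exact: bounded_measurable_indic.
  have mAT : measurable (A `*` [set: T2]) by exact: measurableX.
  have bAT : bounded_measurable (\1_(A `*` [set: T2]) : _ -> R).
    exact: bounded_measurable_indic.
  rewrite -!mean_indic//; congr (_%:E).
  rewrite (mean_has_density dr bAT) mean_product12; last exact: bounded_measurableM.
  apply: eq_mean => x; rewrite -[RHS]mulr1 -(r1 x) -meanZ; last first.
    exact: (bounded_measurable_pair2 x br).
  apply: eq_mean => y; congr (_ * _); rewrite !indicE.
  suff -> : ((x, y) \in A `*` [set: T2]) = (x \in A) by [].
  by apply/idP/idP; rewrite !inE => //= -[].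
have bA : bounded_measurable (\1_A : T2 -> R) by exact: bounded_measurable_indic.
have mAT : measurable ([set: T1] `*` A) by exact: measurableX.
have bAT : bounded_measurable (\1_([set: T1] `*` A) : _ -> R).
  exact: bounded_measurable_indic.
rewrite -!mean_indic//; congr (_%:E).
rewrite (mean_has_density dr bAT) mean_product21; last exact: bounded_measurableM.
apply: eq_mean => y; rewrite -[RHS]mulr1 -(r2 y) -meanZ; last first.
  exact: (bounded_measurable_pair1 y br).
apply: eq_mean => x; congr (_ * _); rewrite !indicE.
suff -> : ((x, y) \in [set: T1] `*` A) = (y \in A) by [].
by apply/idP/idP; rewrite !inE => //= -[].
Qed.

(** * The Schroedinger system and duality *)

Section schroedinger_system.
Context (R : realType) (d : nat) (lambda : R).
Hypothesis lambda_gt0 : 0 < lambda.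
Local Notation X := (torus R d).
Implicit Types (mu nu : probability X R).

Definition gibbs_kernel (z : X * X) : R :=
  expR (- (2 * lambda)^-1 * torus_cost z).

Definition schroedinger_density (u v : X -> R) (z : X * X) : R :=
  u z.1 * gibbs_kernel z * v z.2.

(** The entropic dual functional at the potentials [2 * lambda * ln u] and [2 * lambda * ln v]; its
    exponential term drops out when the associated plan has mass one. *)
Definition dual_value mu nu (u v : X -> R) : R :=
  2 * lambda * (mean mu (fun x => ln (u x)) + mean nu (fun y => ln (v y))).

(* Mass one on every fibre, not just almost every one: this is what makes
   the density of the discrete problem, extended to the cells, a coupling of the
   continuous measures. *)
Definition schroedinger_potentials mu nu (u v : X -> R) : Prop :=
  [/\ bounded_positive u, bounded_positive v,
    forall x, mean nu (fun y => schroedinger_density u v (x, y)) = 1,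
    forall y, mean mu (fun x => schroedinger_density u v (x, y)) = 1 &
    forall z z', schroedinger_density u v z
      <= expR (lambda^-1 * (torus_l1 z.1 z'.1 + torus_l1 z.2 z'.2))
         * schroedinger_density u v z'].

Let i2l := (2 * lambda)^-1.

Let i2l_gt0 : 0 < i2l.
Proof. by rewrite invr_gt0 mulr_gt0. Qed.

Let bK : bounded_measurable gibbs_kernel.
Proof.
apply: bounded_measurable_expR; apply: bounded_measurableM.
  exact: bounded_measurable_cst.
exact: bounded_measurable_torus_cost.
Qed.

Let k := expR (- i2l * d%:R).

Let k_gt0 : 0 < k. Proof. exact: expR_gt0. Qed.

Let kK z : k <= gibbs_kernel z.
Proof.
rewrite ler_expR !mulNr lerN2; apply: ler_wpM2l; first exact: ltW.
exact: torus_cost_le.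
Qed.

Let K1 z : gibbs_kernel z <= 1.
Proof.
rewrite -expR0 ler_expR mulNr oppr_le0; apply: mulr_ge0; first exact: ltW.
exact: torus_cost_ge0.
Qed.

Let torus_l1_sym (x y : X) : torus_l1 x y = torus_l1 y x.
Proof. by apply: eq_bigr => i _; rewrite circle_norm_sub. Qed.

Let torus_l1xx (x : X) : torus_l1 x x = 0.
Proof.
rewrite /torus_l1 big1// => i _.
by rewrite subrr -(circle_pi_int _ 0) circle_norm_pi_small normr0// invr_ge0.
Qed.

Let K_lip z z' : gibbs_kernel z
  <= expR (i2l * (torus_l1 z.1 z'.1 + torus_l1 z.2 z'.2)) * gibbs_kernel z'.
Proof.
rewrite /gibbs_kernel -expRD ler_expR.
have := ler_wpM2l (ltW i2l_gt0) (torus_cost_lip z' z).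
have := ler_norm (torus_cost z' - torus_cost z).
rewrite [torus_l1 z'.1 _]torus_l1_sym [torus_l1 z'.2 _]torus_l1_sym -/i2l.
by move=> h1; have := ler_wpM2l (ltW i2l_gt0) h1; lra.
Qed.

(** A half-step averages the kernel, so each potential inherits the log-Lipschitz constant
    [(2 * lambda)^-1] of the kernel. Each variable enters the kernel and one potential, and the two
    contributions add up to [lambda^-1]. *)
Lemma schroedinger_potentials_exist mu nu :
  exists u v, schroedinger_potentials mu nu u v.
Proof.
have [u [v [pu pv uE vE]]] := sinkhorn_potentials mu nu bK k_gt0 kK K1.
have [bu _] := pu; have [bv _] := pv.
have u0 x := bounded_positive_gt0 x pu; have v0 x := bounded_positive_gt0 x pv.
have bK' : bounded_measurable (fun z : X * X => gibbs_kernel (z.2, z.1)).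
  apply: (bounded_measurable_comp bK); apply: measurable_fun_pair.
    exact: measurable_snd.
  exact: measurable_fst.
have kK' z : k <= gibbs_kernel (z.2, z.1) by exact: kK.
have half_lip P (K : X * X -> R) (t : X -> R) (x x' : X) (e : R) :
    bounded_measurable K -> (forall z, k <= K z) -> bounded_positive t ->
    (forall y, K (x', y) <= expR e * K (x, y)) ->
    half_step P K t x <= expR e * half_step P K t x'.
  move=> bK0 kK0 pt Ke; have [bt _] := pt.
  have t0 y := bounded_positive_gt0 y pt.
  have pG := bounded_positive_kernel_mean P bK0 k_gt0 kK0 pt.
  rewrite /half_step ler_pdivlMr ?(bounded_positive_gt0 _ pG)//.
  rewrite ler_pdivrMl ?(bounded_positive_gt0 _ pG)// mulrC.
  have bKt z : bounded_measurable (fun y => K (z, y) * t y).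
    apply: bounded_measurableM => //; exact: bounded_measurable_pair2.
  rewrite /kernel_mean -meanZ//; apply: le_mean => //.
    by apply: bounded_measurableM => //; exact: bounded_measurable_cst.
  by move=> y; rewrite mulrA ler_wpM2r// ltW.
have u_lip x x' : u x <= expR (i2l * torus_l1 x x') * u x'.
  rewrite uE; apply: half_lip => // y.
  by have := K_lip (x', y) (x, y); rewrite /= torus_l1xx addr0 torus_l1_sym.
have v_lip y y' : v y <= expR (i2l * torus_l1 y y') * v y'.
  rewrite vE; apply: half_lip => // x.
  by have := K_lip (x, y') (x, y); rewrite /= torus_l1xx add0r torus_l1_sym.
exists u, v; split => //.
- move=> x; rewrite -(half_step_kernel_mean nu bK k_gt0 kK x pv) -uE.
  rewrite /kernel_mean -meanZ; last first.
    apply: bounded_measurableM => //; exact: (bounded_measurable_pair2 x bK).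
  by apply: eq_mean => y; rewrite /schroedinger_density mulrA.
- move=> y; rewrite -(half_step_kernel_mean mu bK' k_gt0 kK' y pu) -vE.
  rewrite /kernel_mean -meanZ; last first.
    apply: bounded_measurableM => //; exact: (bounded_measurable_pair2 y bK').
  by apply: eq_mean => x; rewrite /schroedinger_density/=; ring.
- move=> z z'; rewrite /schroedinger_density.
  have h1 := u_lip z.1 z'.1; have h2 := K_lip z z'; have h3 := v_lip z.2 z'.2.
  have K0 t : 0 <= gibbs_kernel t by exact: expR_ge0.
  have := ler_pM (mulr_ge0 (ltW (u0 z.1)) (K0 z)) (ltW (v0 z.2))
    (ler_pM (ltW (u0 z.1)) (K0 z) h1 h2) h3.
  move/le_trans; apply; rewrite le_eqVlt; apply/orP; left; apply/eqP.
  have -> : lambda^-1 = 2 * i2l by rewrite /i2l invfM mulrA mulfV ?mul1r.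
  have -> : 2 * i2l * (torus_l1 z.1 z'.1 + torus_l1 z.2 z'.2)
    = i2l * torus_l1 z.1 z'.1 + i2l * (torus_l1 z.1 z'.1 + torus_l1 z.2 z'.2)
      + i2l * torus_l1 z.2 z'.2 by ring.
  by rewrite !expRD; ring.
Qed.

Section optimality.
Variables (mu nu : probability X R) (u v : X -> R).
Hypothesis uv : schroedinger_potentials mu nu u v.
Local Notation r := (schroedinger_density u v).

Let pu : bounded_positive u. Proof. by case: uv. Qed.
Let pv : bounded_positive v. Proof. by case: uv. Qed.

Lemma bounded_positive_schroedinger : bounded_positive r.
Proof.
have [bu [a a0 au]] := pu; have [bv [b b0 bv']] := pv; split.
  apply: bounded_measurableM; last exact: bounded_measurable_snd.
  by apply: bounded_measurableM => //; exact: bounded_measurable_fst.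
exists (a * k * b); first by rewrite !mulr_gt0.
move=> z; apply: ler_pM => //.
- by rewrite mulr_ge0// ltW.
- exact: ltW.
- by apply: ler_pM => //; exact: ltW.
Qed.

Lemma bounded_measurable_ln_potential (w : X -> R) : bounded_positive w ->
  bounded_measurable (fun x => ln (w x)).
Proof. by move=> [bw [a a0 aw]]; exact: bounded_measurable_ln bw a0 aw. Qed.

(** The left-hand side separates into functions of one variable, so its mean under a coupling
    depends on the marginals only. *)
Lemma ln_schroedinger z : torus_cost z + 2 * lambda * ln (r z)
  = 2 * lambda * (ln (u z.1) + ln (v z.2)).
Proof.
have u0 := bounded_positive_gt0 z.1 pu; have v0 := bounded_positive_gt0 z.2 pv.
have K0 : 0 < gibbs_kernel z by exact: expR_gt0.
rewrite /schroedinger_density lnM ?posrE ?mulr_gt0// lnM ?posrE// expRK.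
have cE : torus_cost z = 2 * lambda * ((2 * lambda)^-1 * torus_cost z).
  by rewrite mulVKf// gt_eqF// mulr_gt0.
by rewrite mulNr {1}cE; move: (_^-1 * _) => t; ring.
Qed.

Lemma mean_schroedinger : mean (mu \x nu)%E r = 1.
Proof.
have [br _] := bounded_positive_schroedinger.
by rewrite mean_product12//; case: uv => _ _ h _ _; rewrite (eq_mean _ h) mean_cst.
Qed.

Lemma coupling_dual_value (gamma : probability (X * X)%type R) :
  couplings mu nu gamma ->
  mean gamma (fun z => 2 * lambda * (ln (u z.1) + ln (v z.2)))
  = dual_value mu nu u v.
Proof.
move=> g; have blu := bounded_measurable_ln_potential pu.
have blv := bounded_measurable_ln_potential pv.
have b1 := @bounded_measurable_fst _ _ X X R _ blu.
have b2 := @bounded_measurable_snd _ _ X X R _ blv.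
rewrite meanZ; last exact: bounded_measurableD.
rewrite meanD// /dual_value (mean_pushes (coupling_fst g) blu).
by rewrite (mean_pushes (coupling_snd g) blv).
Qed.

(** Gibbs' inequality with the plan density [r] as test function bounds the entropy of any coupling
    by the mean of [ln r]; the separated form then gives the same value for all couplings. *)
Lemma dual_value_le_entropic_cost :
  ((dual_value mu nu u v)%:E <= entropic_cost lambda mu nu)%E.
Proof.
apply: le_ereal_inf_tmp => _ [gamma g <-].
have [br _] := bounded_positive_schroedinger.
have bc := bounded_measurable_torus_cost R d.
have bl : bounded_measurable (fun z => ln (r z)).
  have [_ [a a0 ar]] := bounded_positive_schroedinger.
  exact: bounded_measurable_ln br a0 ar.
rewrite -(coupling_dual_value g) -(eq_mean _ ln_schroedinger).
rewrite meanD//; last first.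
  by apply: bounded_measurableM => //; exact: bounded_measurable_cst.
rewrite meanZ// EFinD /transport_cost -(EFin_mean _ bc); apply: leeD2l.
rewrite EFinM lee_pmul2l ?lte_fin ?mulr_gt0//.
apply: relative_entropy_ge; first exact: bounded_positive_schroedinger.
by rewrite mean_schroedinger.
Qed.

End optimality.

End schroedinger_system.

(** [M] is an arbitrary real; its sign comes from two points at positive distance, the origin and
    the point with all coordinates 1/2, which differ because [0 < d]. *)
Lemma lipschitz_const_ge0 (R : realType) (d : nat) (M : R) (f : torus R d -> R) :
  (0 < d)%N -> (forall x y, `|f x - f y| <= M * torus_dist x y) -> 0 <= M.
Proof.
move=> d0 fM; pose x : torus R d := [tuple circle_pi 0 | i < d].
pose y : torus R d := [tuple circle_pi 2^-1 | i < d].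
have h2 : `|2^-1 : R| <= 2^-1 by rewrite ger0_norm.
have xy0 : torus_dist y x != 0.
  rewrite -sqrf_eq0 torus_dist_sqr gt_eqF//.
  have -> : \sum_(i < d) circle_norm (tnth y i - tnth x i) ^+ 2
      = \sum_(i < d) (2^-1 : R) ^+ 2.
    apply: eq_bigr => i _; rewrite !tnth_mktuple -circle_piB subr0.
    by rewrite circle_norm_pi_small// ger0_norm.
  by rewrite sumr_const card_ord pmulrn_lgt0// exprn_gt0.
have : 0 < torus_dist y x by rewrite lt_neqAle eq_sym xy0 sqrtr_ge0.
by move=> xy; rewrite -(pmulr_lge0 _ xy) (le_trans (normr_ge0 _) (fM y x)).
Qed.

(** The torus has finite diameter, so a Lipschitz log-density is bounded and the density is bounded
    away from zero. *)
Lemma lipschitz_log_density (R : realType) (d : nat) (M : R)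
    (mu : probability (torus R d) R) : (0 < d)%N ->
  has_lipschitz_log_density M mu -> 0 <= M /\ exists p,
    has_density mu (torus_leb R d) p /\
    forall x y, p x <= expR (M * torus_l1 x y) * p y.
Proof.
move=> d0 [f [mf muE fM]]; have M0 := lipschitz_const_ge0 d0 fM.
split => //; exists (fun x => expR (f x)).
have fl x y : `|f x - f y| <= M * torus_l1 x y.
  by rewrite (le_trans (fM x y))// ler_wpM2l// torus_dist_le_l1.
have fB x : `|f x - f point| <= M * d%:R.
  rewrite (le_trans (fl x _))// ler_wpM2l//.
  rewrite -[X in _ <= X%:R](card_ord d) -sumr_const; apply: ler_sum => i _.
  by apply: le_trans (circle_norm_le_half _) _; lra.
have bf : bounded_measurable f.
  split => //; exists (M * d%:R + `|f point|) => x.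
  by rewrite -[f x](subrK (f point)) (le_trans (ler_normD _ _))// lerD2r.
split.
  split; last exact: muE.
  split; first exact: bounded_measurable_expR.
  exists (expR (f point - M * d%:R)); first exact: expR_gt0.
  by move=> x; rewrite ler_expR; have := fB x; rewrite ler_norml; lra.
move=> x y; rewrite -expRD ler_expR.
by have := fl x y; rewrite ler_norml; lra.
Qed.

(** * Discretization of couplings and product measures *)

Definition grid_round2 (R : realType) (d m : nat)
    (z : torus R d * torus R d) : torus R d * torus R d :=
  (grid_round m z.1, grid_round m z.2).

Lemma measurable_grid_round2 (R : realType) (d m : nat) :
  measurable_fun setT (@grid_round2 R d m).
Proof.
apply: measurable_fun_pair.
  by apply: measurableT_comp measurable_fst; exact: measurable_grid_round.
by apply: measurableT_comp measurable_snd; exact: measurable_grid_round.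
Qed.

HB.instance Definition _ (R : realType) (d m : nat) :=
  isMeasurableFun.Build _ _ _ _ (@grid_round2 R d m)
    (@measurable_grid_round2 R d m).

(** The rounding acts on each factor separately, so both measures agree on rectangles, which
    determine a product measure. *)
Lemma pushes_product_discretization (R : realType) (d m : nat)
    (mu nu : probability (torus R d) R) :
  pushes (@grid_round2 R d m) (mu \x nu)%E
    (discretization m mu \x discretization m nu)%E.
Proof.
split; first exact: measurable_grid_round2.
move=> A mA.
have mq (B : set (torus R d)) : measurable B ->
    measurable (@grid_round R d m @^-1` B).
  by move=> mB; rewrite -[X in measurable X]setTI; exact: measurable_grid_round.
pose P : {measure set (torus R d * torus R d) -> \bar R} :=
  distribution (mu \x nu)%E (@grid_round2 R d m).
have PE A1 A2 : measurable A1 -> measurable A2 ->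
    P (A1 `*` A2) = (discretization m mu A1 * discretization m nu A2)%E.
  by move=> mA1 mA2; exact: (product_measure1E mu nu (mq _ mA1) (mq _ mA2)).
exact: (product_measure_unique PE mA).
Qed.

Lemma coupling_discretization (R : realType) (d m : nat)
    (mu nu : probability (torus R d) R)
    (gamma : probability (torus R d * torus R d)%type R) :
  couplings mu nu gamma ->
  couplings (discretization m mu) (discretization m nu)
    (distribution gamma (@grid_round2 R d m)).
Proof.
have mq (B : set (torus R d)) : measurable B ->
    measurable (@grid_round R d m @^-1` B).
  by move=> mB; rewrite -[X in measurable X]setTI; exact: measurable_grid_round.
by move=> [g1 g2]; split=> A mA; [exact: (g1 _ (mq _ mA)) | exact: (g2 _ (mq _ mA))].
Qed.

Lemma mean_product_density d1 d2 (T1 : measurableType d1)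
    (T2 : measurableType d2) (R : realType) (mu rho1 : probability T1 R)
    (nu rho2 : probability T2 R) (p1 : T1 -> R) (p2 : T2 -> R)
    (f : T1 * T2 -> R) :
  has_density mu rho1 p1 -> has_density nu rho2 p2 -> bounded_measurable f ->
  mean (mu \x nu)%E f
  = mean (rho1 \x rho2)%E (fun z => f z * (p1 z.1 * p2 z.2)).
Proof.
move=> d1p d2p bf; have [[bp1 _] _] := d1p; have [[bp2 _] _] := d2p.
have b1 := @bounded_measurable_fst _ _ T1 T2 R _ bp1.
have b2 := @bounded_measurable_snd _ _ T1 T2 R _ bp2.
have bb := bounded_measurableM b1 b2.
rewrite [LHS]mean_product12// [RHS]mean_product12; last exact: bounded_measurableM.
have bm := bounded_measurable_mean2 mu nu bf.
rewrite (mean_has_density d1p bm); apply: eq_mean => x /=.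
have bx := bounded_measurable_pair2 x bf.
rewrite (mean_has_density d2p bx) mulrC -meanZ; last exact: bounded_measurableM.
by apply: eq_mean => y; ring.
Qed.

(** * Comparison of the continuous and the discrete problem *)

Section proposition6_proof.
Context (R : realType) (d m : nat) (C M lambda : R).
Variables mu nu : probability (torus R d) R.
Hypotheses (d_gt0 : (0 < d)%N) (m_gt0 : (0 < m)%N) (lambda_gt0 : 0 < lambda).
Hypotheses (lmu : has_lipschitz_log_density M mu)
  (lnu : has_lipschitz_log_density M nu).
Local Notation h := (m%:R^-1 : R).
Hypothesis hC : h * (M + lambda^-1) <= C.
Local Notation X := (torus R d).
Local Notation Q := (@grid_round2 R d m).
Local Notation mu_h := (discretization m mu).
Local Notation nu_h := (discretization m nu).

Definition error_bound : R :=
  (d%:R + 2 * d%:R ^+ 2 * expR (4 * d%:R * C)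
   + 8 * d%:R * expR (d%:R + 2 * d%:R * C)) * (h ^+ 2 * (M + lambda^-1 + 1)).

Let h_gt0 : 0 < h. Proof. by rewrite invr_gt0 ltr0n. Qed.

Let M_ge0 : 0 <= M. Proof. by have [] := lipschitz_log_density d_gt0 lmu. Qed.

Let ilambda_gt0 : 0 < lambda^-1. Proof. by rewrite invr_gt0. Qed.

(** The density with respect to the Lebesgue measure is [s] times those of [mu] and [nu], whence the
    constant [M + lambda^-1]. The slack admits a density composed with the rounding, which moves
    each of the four points by at most [d * h / 2]. *)
Lemma density_discretization_error (gamma : probability (X * X)%type R)
    (s : X * X -> R) :
  has_density gamma (mu \x nu)%E s ->
  (forall z z', s z <= expR (lambda^-1 * (torus_l1 z.1 z'.1
     + torus_l1 z.2 z'.2 + 2 * d%:R * h)) * s z') ->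
  `|mean gamma (fun z => torus_cost z - torus_cost (Q z))| <= error_bound.
Proof.
move=> ds sl; have [ps _] := ds; have [bs _] := ps.
have [_ [p1 [d1 l1]]] := lipschitz_log_density d_gt0 lmu.
have [_ [p2 [d2 l2]]] := lipschitz_log_density d_gt0 lnu.
have [pp1 _] := d1; have [pp2 _] := d2.
have [bp1 [a1 a10 ap1]] := pp1; have [bp2 [a2 a20 ap2]] := pp2.
have [_ [a0 a00 as0]] := ps.
have b1 := @bounded_measurable_fst _ _ X X R _ bp1.
have b2 := @bounded_measurable_snd _ _ X X R _ bp2.
pose w z := s z * (p1 z.1 * p2 z.2).
have bw : bounded_measurable w.
  by apply: bounded_measurableM => //; exact: bounded_measurableM.
have pw : bounded_positive w.
  split => //; exists (a0 * (a1 * a2)); first by rewrite !mulr_gt0.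
  move=> z; apply: ler_pM => //; [exact: ltW | by rewrite mulr_ge0// ltW |].
  by apply: ler_pM => //; exact: ltW.
have w1 : mean (torus_leb R d \x torus_leb R d)%E w = 1.
  by rewrite -(mean_product_density d1 d2 bs) (mean_density ds).
have sw : slowly_varying m (M + lambda^-1) w.
  move=> z z'; rewrite /w.
  have s0 t := bounded_positive_gt0 t ps.
  have p10 t := bounded_positive_gt0 t pp1.
  have p20 t := bounded_positive_gt0 t pp2.
  have h2 := ler_pM (ltW (p10 _)) (ltW (p20 _)) (l1 z.1 z'.1) (l2 z.2 z'.2).
  have h3 := ler_pM (ltW (s0 _)) (mulr_ge0 (ltW (p10 _)) (ltW (p20 _))) (sl z z') h2.
  apply: (le_trans h3).
  set D := torus_l1 z.1 z'.1 + torus_l1 z.2 z'.2 + _.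
  have -> : expR (lambda^-1 * D) * s z' * (expR (M * torus_l1 z.1 z'.1) * p1 z'.1
      * (expR (M * torus_l1 z.2 z'.2) * p2 z'.2))
    = expR (lambda^-1 * D + M * torus_l1 z.1 z'.1 + M * torus_l1 z.2 z'.2)
      * (s z' * (p1 z'.1 * p2 z'.2)) by rewrite !expRD; ring.
  apply: ler_wpM2r; first by rewrite !mulr_ge0// ltW.
  rewrite ler_expR.
  have : 0 <= M * (2 * d%:R * h) by rewrite !mulr_ge0// ltW.
  by rewrite /D; lra.
have bQ : bounded_measurable (fun z => torus_cost (Q z)).
  apply: (bounded_measurable_comp (bounded_measurable_torus_cost R d)).
  exact: measurable_grid_round2.
have bcQ := bounded_measurableB (bounded_measurable_torus_cost R d) bQ.
have L0 : 0 <= M + lambda^-1 by rewrite addr_ge0// ltW.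
rewrite (mean_has_density ds bcQ).
rewrite (mean_product_density d1 d2 (bounded_measurableM bcQ bs)).
rewrite (eq_mean _ (fun z => esym (mulrA _ _ _))).
exact: (discretization_error m_gt0 L0 hC pw w1 sw).
Qed.

Let bcost := bounded_measurable_torus_cost R d.

Let bcostQ : bounded_measurable (fun z : X * X => torus_cost (Q z)).
Proof.
by apply: (bounded_measurable_comp bcost); exact: measurable_grid_round2.
Qed.

Lemma transport_cost_le (mu' nu' : probability X R)
    (gamma gamma' : probability (X * X)%type R) (s : X * X -> R) :
  ((relative_entropy gamma' (mu' \x nu')%E)
     <= (mean gamma (fun z => ln (s z)))%:E)%E ->
  (transport_cost lambda mu' nu' gamma'
     <= (mean gamma' (@torus_cost R d)
         + 2 * lambda * mean gamma (fun z => ln (s z)))%:E)%E.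
Proof.
move=> H; rewrite /transport_cost EFinD -(EFin_mean _ bcost) [X in (_ <= _ + X)%E]EFinM.
by apply: leeD2l; rewrite lee_pmul2l ?lte_fin ?mulr_gt0.
Qed.

Let bln (s : X * X -> R) : bounded_positive s ->
  bounded_measurable (fun z => ln (s z)).
Proof. by move=> [bs [a a0 sa]]; exact: bounded_measurable_ln bs a0 sa. Qed.

(* Push the optimal plan of the continuous problem to the grid. *)
Lemma entropic_cost_discretization_le u v :
  schroedinger_potentials lambda mu nu u v ->
  (entropic_cost lambda mu_h nu_h
     <= (dual_value lambda mu nu u v + error_bound)%:E)%E.
Proof.
move=> uv; pose r := schroedinger_density lambda u v.
have pr : bounded_positive r by exact: (bounded_positive_schroedinger lambda_gt0 uv).
have [gamma dg] := has_density_exists pr (mean_schroedinger lambda_gt0 uv).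
have [_ _ uv1 uv2 uvl] := uv.
have cg : couplings mu nu gamma by exact: has_density_coupling dg uv1 uv2.
pose gamma' : probability (X * X)%type R := distribution gamma Q.
have pg : pushes Q gamma gamma' by split; first exact: measurable_grid_round2.
apply: ge_ereal_inf; exists (transport_cost lambda mu_h nu_h gamma').
  by exists gamma' => //; exact: coupling_discretization.
apply: le_trans (transport_cost_le (gamma := gamma) (s := r) _) _.
  exact: relative_entropy_pushes_le dg pg (pushes_product_discretization m mu nu).
rewrite lee_fin (mean_pushes pg bcost) -(coupling_dual_value uv cg).
rewrite -(eq_mean _ (ln_schroedinger lambda_gt0 uv)).
have blr : bounded_measurable (fun z => ln (r z)) by exact: bln.
rewrite meanD//; last first.
  by apply: bounded_measurableM => //; exact: bounded_measurable_cst.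
rewrite meanZ//.
have /(_ gamma r dg)h1 := density_discretization_error.
have : `|mean gamma (fun z => torus_cost z - torus_cost (Q z))| <= error_bound.
  apply: h1 => z z'; apply: (le_trans (uvl z z')); apply: ler_wpM2r.
    by rewrite ltW// bounded_positive_gt0.
  rewrite ler_expR ler_wpM2l ?(ltW ilambda_gt0)// lerDl !mulr_ge0// ltW.
by rewrite meanB// ler_norml; lra.
Qed.

(* Spread the optimal plan of the discrete problem over the cells. *)
Lemma entropic_cost_le_discretization u v :
  schroedinger_potentials lambda mu_h nu_h u v ->
  (entropic_cost lambda mu nu
     <= (dual_value lambda mu_h nu_h u v + error_bound)%:E)%E.
Proof.
move=> uv; pose r := schroedinger_density lambda u v.
have pr : bounded_positive r by exact: (bounded_positive_schroedinger lambda_gt0 uv).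
have [br [a a0 ra]] := pr.
have [_ _ uv1 uv2 uvl] := uv.
pose s z := r (Q z).
have bs : bounded_measurable s.
  by apply: (bounded_measurable_comp br); exact: measurable_grid_round2.
have ps : bounded_positive s by split => //; exists a => // z; exact: ra.
have s1 x : mean nu (fun y => s (x, y)) = 1.
  rewrite -[RHS](uv1 (grid_round m x)) mean_distribution//.
  exact: (bounded_measurable_pair2 _ br).
have s2 y : mean mu (fun x => s (x, y)) = 1.
  rewrite -[RHS](uv2 (grid_round m y)) mean_distribution//.
  exact: (bounded_measurable_pair1 _ br).
have ms : mean (mu \x nu)%E s = 1.
  by rewrite mean_product12// (eq_mean _ s1) mean_cst.
have [gamma dg] := has_density_exists ps ms.
have cg : couplings mu nu gamma by exact: has_density_coupling dg s1 s2.
pose gamma' : probability (X * X)%type R := distribution gamma Q.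
have pg : pushes Q gamma gamma' by split; first exact: measurable_grid_round2.
have cg' : couplings mu_h nu_h gamma' by exact: coupling_discretization.
apply: ge_ereal_inf; exists (transport_cost lambda mu nu gamma).
  by exists gamma.
apply: le_trans (transport_cost_le (gamma := gamma) (s := s) _) _.
  exact: relative_entropy_pushes_le dg (pushes_id _) (pushes_id _).
(* The rounded plan couples the discrete measures, so the dual value is its mean of the cost plus
   [2 * lambda * ln r]. Pulled back along the rounding, the logarithm becomes [ln s], and only the
   costs differ. *)
rewrite lee_fin -(coupling_dual_value uv cg').
rewrite -(eq_mean _ (ln_schroedinger lambda_gt0 uv)).
have blr : bounded_measurable (fun z => ln (r z)) by exact: bln.
have bls : bounded_measurable (fun z => ln (s z)) by exact: bln.
rewrite meanD//; last first.
  by apply: bounded_measurableM => //; exact: bounded_measurable_cst.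
rewrite meanZ// (mean_pushes pg bcost) (mean_pushes pg blr).
have /(_ gamma s dg)h1 := density_discretization_error.
have : `|mean gamma (fun z => torus_cost z - torus_cost (Q z))| <= error_bound.
  apply: h1 => z z'; apply: (le_trans (uvl (Q z) (Q z'))); apply: ler_wpM2r.
    by rewrite ltW// bounded_positive_gt0.
  rewrite ler_expR ler_wpM2l ?(ltW ilambda_gt0)//=.
  have l1q (x x' : X) : torus_l1 (grid_round m x) (grid_round m x')
      <= torus_l1 x x' + d%:R * h.
    rewrite -[X in X%:R * _](card_ord d) -sumr_const mulr_suml -big_split.
    apply: ler_sum => i _ /=; rewrite mul1r !tnth_mktuple.
    have c1 := circle_norm_round m_gt0 (tnth x i).
    have c2 := circle_norm_round m_gt0 (tnth x' i).
    rewrite circle_norm_sub in c1.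
    move: (tnth x i) (tnth x' i) c1 c2 => t t' c1 c2.
    have c3 := circle_normD (circle_round m t - t) (t - circle_round m t').
    have c4 := circle_normD (t - t') (t' - circle_round m t').
    by move: c3 c4; rewrite !addrA !subrK; lra.
  by have := l1q z.1 z'.1; have := l1q z.2 z'.2; lra.
rewrite meanB// ler_norml /s /comp; lra.
Qed.

(** Each cost is at least its own dual value and at most the dual value of the other problem plus
    the error; these bounds also exclude infinite costs. *)
Lemma entropic_cost_discretization_error :
  (`|entropic_cost lambda mu_h nu_h - entropic_cost lambda mu nu|
     <= error_bound%:E)%E.
Proof.
have [u [v uv]] := schroedinger_potentials_exist lambda_gt0 mu nu.
have [u' [v' uv']] := schroedinger_potentials_exist lambda_gt0 mu_h nu_h.
have := dual_value_le_entropic_cost lambda_gt0 uv.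
have := dual_value_le_entropic_cost lambda_gt0 uv'.
have := entropic_cost_discretization_le uv.
have := entropic_cost_le_discretization uv'.
case: (entropic_cost lambda mu nu) => [t||]//; case: (entropic_cost _ _ _) => [t'||]//.
by rewrite -EFinB /= !lee_fin ler_norml; lra.
Qed.

End proposition6_proof.

Theorem proposition6 (R : realType) (d : nat) (hd : (0 < d)%N)
    (C : R) (hC : 0 < C) :
  exists C' : R,
    forall (mu nu : probability (torus R d) R) (M lambda : R) (m : nat),
      has_lipschitz_log_density M mu ->
      has_lipschitz_log_density M nu ->
      0 < lambda ->
      (0 < m)%N ->
      let h := m%:R^-1 in
      h * (M + lambda^-1) <= C ->
      (`|entropic_cost lambda (discretization m mu) (discretization m nu)
         - entropic_cost lambda mu nu|
       <= (C' * Num.min h (h ^+ 2 * (lambda^-1 + M + 1)))%:E)%E.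
Proof.
(* One estimate yields both members of the minimum: [h <= 1] and [h * (M + lambda^-1) <= C] give [h
   ^+ 2 * (M + lambda^-1 + 1) <= h * (C + 1)], and for the other member the factor [C + 1] is at
   least 1. *)
exists ((d%:R + 2 * d%:R ^+ 2 * expR (4 * d%:R * C)
  + 8 * d%:R * expR (d%:R + 2 * d%:R * C)) * (C + 1)).
move=> mu nu M lambda m lmu lnu lambda0 m0 h hC'.
apply: le_trans (entropic_cost_discretization_error hd m0 lambda0 lmu lnu hC') _.
rewrite lee_fin /error_bound -[leRHS]mulrA; apply: ler_wpM2l.
  have d0 : 0 <= d%:R :> R by [].
  by rewrite !addr_ge0 ?mulr_ge0 ?expR_ge0 ?exprn_ge0.
have h0 : 0 < h by rewrite invr_gt0 ltr0n.
have h1 : h <= 1 by rewrite invf_le1 ?ltr0n// ler1n.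
have C1 : 0 < C + 1 by rewrite addr_gt0.
rewrite -ler_pdivrMl// le_min -/h [lambda^-1 + M]addrC; apply/andP; split.
  rewrite ler_pdivrMl// expr2 -mulrA [leRHS]mulrC ler_wpM2l ?(ltW h0)//.
  by rewrite mulrDr mulr1 lerD.
rewrite ler_pdivrMl// ler_peMl ?lerDr ?(ltW hC)//.
have [M0 _] := lipschitz_log_density hd lmu.
by rewrite mulr_ge0 ?exprn_ge0 ?(ltW h0)// !addr_ge0// invr_ge0 ltW.
Qed.
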